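(* Let $\nu$ be a Beurling weight which is increasing on $\mathbb{Z}_+$ (i.e. $\nu_j \leq \nu_k$ for $0 \leq j < k$), and let $d\mu(z) = w(z)\,|dz|$ be a measure on $\Gamma$ with $w \in W_{\nu}$, $w(z) \neq 0$ for $z \in \mathcal{R}_{\nu}$ and $\mathrm{wind}(w,0) = 0$. Let $n_0$ be such that the monic orthogonal polynomials $\Phi_n$ exist and are unique for all $n\ge n_0$, let $\alpha_{n-1} = -\overline{\Phi_n(0)}$ for $n \geq n_0$ and $\alpha_{n-1} = 0$ for $1\le n < n_0$, and let $S(z) = -\sum_{n=1}^{\infty}\alpha_{n-1} z^n$. Then the function $g = \overline{D_i}\,\overline{D_e} - S$ on $\Gamma$ satisfies \[ \sum_{n \geq 0} \nu_n^3\, |g_n| < \infty , \] i.e. the nonnegative-frequency part of $\overline{D_i}\,\overline{D_e} - S$ lies in $W_{\nu^3}^{+}$. In particular, if $w$ is positive on $\Gamma$, then the nonnegative-frequency part of $\frac{\overline{D_i}}{D_i} - S$ lies in $W_{\nu^3}^{+}$.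
   Context: $\Gamma = \{|z|=1\}$; for $\varphi\in L^1(\Gamma)$, $\varphi_k=\int_{-\pi}^{\pi}e^{-ik\theta}\varphi(e^{i\theta})\frac{d\theta}{2\pi}$. A Beurling weight is a sequence $\nu=(\nu_k)_{k\in\mathbb{Z}}$ with $\nu_j\ge 1$, $\nu_j=\nu_{-j}$, $\nu_{j+k}\le\nu_j\nu_k$; $W_\nu=\{\varphi\in L^1(\Gamma):\sum_j\nu_j|\varphi_j|<\infty\}$; $W_{\nu^3}$ is defined with the weight $(\nu_k^3)_k$, and $W^+_{\nu^3}$ consists of its elements with vanishing negative Fourier coefficients. $A(\nu)=\lim_{k\to\infty}\frac{\log\nu_k}{k}$, $\mathcal{R}_\nu=\{e^{-A(\nu)}\le|z|\le e^{A(\nu)}\}$, and elements of $W_\nu$ are extended to $\mathcal{R}_\nu$ by their Fourier series. $\mathrm{wind}(w,0)$ is the winding number of $w|_\Gamma$ about $0$. A monic orthogonal polynomial of degree $n$ for $w$ is $\Phi_n(z)=z^n+\dots$ with $\int_\Gamma\Phi_n(z)z^{-k}w(z)|dz|=0$ for $0\le k\le n-1$; under the hypotheses these exist and are unique for all large $n$. Under the hypotheses $w$ has a continuous logarithm $\log w\in W_\nu$; the Szegő function is $D(z)=\exp\big(\frac{1}{4\pi}\int_0^{2\pi}\log w(e^{i\theta})\frac{e^{i\theta}+z}{e^{i\theta}-z}d\theta\big)$ for $z\notin\Gamma$, $D_i$ and $D_e$ denote its restrictions to $|z|<1$ and $|z|>1$ and also their continuous boundary values on $\Gamma$; $\overline{D_i},\overline{D_e}$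 denote the complex conjugates of these boundary values on $\Gamma$. *)

(* Defs.v *)
From Stdlib Require Import Reals ZArith.
From Coquelicot Require Import Coquelicot.
Open Scope R_scope.

Definition cis (t : R) : C := (cos t, sin t).

Definition cexp (z : C) : C :=
  (exp (fst z) * cos (snd z), exp (fst z) * sin (snd z)).

Definition Cpowz (z : C) (k : Z) : C :=
  match k with
  | Z0 => RtoC 1
  | Zpos p => pow_n z (Pos.to_nat p)
  | Zneg p => Cinv (pow_n z (Pos.to_nat p))
  end.

Definition CSeries (a : nat -> C) : C :=
  iota (fun l : C_R_CompleteNormedModule => is_series a l).

Definition CZsum (f : Z -> C) : C :=
  Cplus (CSeries (fun n => f (Z.of_nat n)))
        (CSeries (fun n => f (- Z.of_nat (S n))%Z)).

Definition beurling_weight (nu : Z -> R) : Prop :=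
  (forall j, 1 <= nu j) /\
  (forall j, nu j = nu (- j)%Z) /\
  (forall j k, nu (j + k)%Z <= nu j * nu k).

Definition increasing_on_Zplus (nu : Z -> R) : Prop :=
  forall j k : Z, (0 <= j)%Z -> (j < k)%Z -> nu j <= nu k.

Definition A_nu (nu : Z -> R) : R :=
  real (Lim_seq (fun k : nat => ln (nu (Z.of_nat k)) / INR k)).

Definition in_annulus (nu : Z -> R) (z : C) : Prop :=
  exp (- A_nu nu) <= Cmod z <= exp (A_nu nu).

(* the coefficient sequence c is in the weighted l^1 space, i.e. the function
   with Fourier coefficients c lies in W_nu: sum_j nu_j |c_j| < oo *)
Definition in_W (nu : Z -> R) (c : Z -> C) : Prop :=
  ex_series (fun n : nat => nu (Z.of_nat n) * Cmod (c (Z.of_nat n))) /\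
  ex_series (fun n : nat => nu (- Z.of_nat (S n))%Z * Cmod (c (- Z.of_nat (S n))%Z)).

(* the element of W_nu with Fourier coefficients c, evaluated (extended) at z
   by its Fourier series  sum_k c_k z^k *)
Definition fseries (c : Z -> C) (z : C) : C :=
  CZsum (fun k => Cmult (c k) (Cpowz z k)).

(* Fourier coefficient phi_k = \int_{-pi}^{pi} e^{-ik t} phi(e^{it}) dt/(2 pi),
   for phi given as the function t |-> phi(e^{it}) *)
Definition fourier (g : R -> C) (k : Z) : C :=
  Cmult (RtoC (/ (2 * PI)))
        (RInt (V := C_R_CompleteNormedModule)
              (fun t => Cmult (Cpowz (cis t) (- k)%Z) (g t)) (- PI) PI).

(* winding number of t |-> f t (t in [0, 2 pi], f(t) = w(e^{it})) about 0,
   via a continuous lift of the argument / logarithm *)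
Definition wind_number (f : R -> C) (m : Z) : Prop :=
  exists h : R -> C,
    (forall t, continuous h t) /\
    (forall t, cexp (h t) = f t) /\
    Cminus (h (2 * PI)) (h 0) = (0, 2 * PI * IZR m).

(* L is a continuous logarithm of w on Gamma, L t = log w(e^{it}) *)
Definition is_cont_log (f : R -> C) (L : R -> C) : Prop :=
  (forall t, continuous L t) /\
  (forall t, L (t + 2 * PI) = L t) /\
  (forall t, cexp (L t) = f t).

Definition Szego (L : R -> C) (z : C) : C :=
  cexp (Cmult (RtoC (/ (4 * PI)))
     (RInt (V := C_R_CompleteNormedModule)
        (fun t => Cmult (L t) (Cdiv (Cplus (cis t) z) (Cminus (cis t) z)))
        0 (2 * PI))).

Definition peval (p : nat -> C) (n : nat) (z : C) : C :=
  sum_n (fun j => Cmult (p j) (pow_n z j)) n.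

Definition is_monic_OP (w : C -> C) (n : nat) (p : nat -> C) : Prop :=
  p n = RtoC 1 /\
  forall k : nat, (k < n)%nat ->
    RInt (V := C_R_CompleteNormedModule)
      (fun t => Cmult (Cmult (peval p n (cis t)) (Cpowz (cis t) (- Z.of_nat k)%Z))
                      (w (cis t))) (- PI) PI = RtoC 0.

(* alpha_{m} (= alpha_{n-1} with n = m+1) *)
Definition alpha (n0 : nat) (Phi : nat -> nat -> C) (m : nat) : C :=
  if Nat.leb n0 (S m) then Copp (Cconj (Phi (S m) O)) else RtoC 0.

(* Fourier coefficients of S(z) = - sum_{n >= 1} alpha_{n-1} z^n
   (nonnegative frequencies) *)
Definition Scoef (n0 : nat) (Phi : nat -> nat -> C) (n : nat) : C :=
  match n with
  | O => RtoC 0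
  | S m => Copp (alpha n0 Phi m)
  end.

(* Main.v *)
(* By a theorem of Wiener-Levy type (proved in Newman's way: approximate [w] by a Laurent polynomial,
   factor it, and control the powers of its inverse by Cauchy's estimate on a larger annulus),
   [log w] lies in [W_nu].  Splitting its Fourier series gives [w = w_+ w_-] with [D_i = w_+] and
   [D_e = 1 / w_-].  Put [a = D_i D_e = w_+ / w_-] and [b = 1 / a].  Orthogonality says that
   [Phi_n w = z^n F_+ + H_-] with [F_+] of nonnegative and [H_-] of negative frequency; comparing
   Fourier coefficients in [z^(-n) Phi_n w_- = f + z^(-n) h b] and [Phi_n w_+ = z^n f a + h], where
   [f = F_+ / w_+] and [h = H_- / w_-], gives a pair of linear equations for [f] and [h] whose
   coefficients are the tails [a_(-k)], [b_k], [k >= n].  Eliminating [h], [Phi_n(0) - a_(-n)] is a sum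
   of products of three such coefficients, each of index at least [n]; as [nu] is increasing, [nu_n^3]
   is absorbed by the three factors.  The sums over [n] converge because
   [sum_(n + i = q) |f^(n)_i|] is bounded uniformly in [q].  Finally [conj (a_(-n))] is the [n]-th
   Fourier coefficient of [conj (D_i) conj (D_e)]. *)

Require Import Defs.
From Stdlib Require Import Reals ZArith.
From Coquelicot Require Import Coquelicot.
From Stdlib Require Import List Permutation Lra Lia Classical ClassicalEpsilon ssreflect.
From mathcomp Require boot.all_boot algebra.all_algebra reals_stdlib.Rstruct real_closed.complex.
Open Scope R_scope.

(** The proof works in the logarithmic coordinate u, z = cexp u: the annulus becomes the strip |Re
    u| <= A, every integer power is an exponential, and Cauchy's estimate is a shift of the line of
    integration. Sums are unordered, because the argument mostly exchanges and reindexes double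
    sums. The obstacle is uniformity in n: a bound on f for each single n cannot be added up over n.
    Summing over all n at once along n + i = q leaves one tail of a or b per equation, and
    eliminating h turns a bound z for these sums into |kap| + z ta tb, where ta and tb are l^1
    tails: a contraction far enough out. It needs some finite bound to start from, so n is first
    restricted to a finite window; the limit bound 2 |kap| does not depend on the window. The mean
    of log w is divided evenly between the two factors. This is what the Szego kernel does, and it
    gives w_+ and w_- the same zeroth coefficient kap, which is an exponential and can therefore be
    divided out at the end. *)

Section FTA.
Import all_boot all_algebra Rstruct complex.
Import GRing.Theory.
Local Open Scope ring_scope.

Let toRC (z : C) : complex R := Complex (fst z) (snd z).
Let ofRC (z : complex R) : C := let: Complex x y := z in (x, y).

(** The polynomial is transported to [complex R], which is algebraically closed because [R] is a
    real closed field; the factorization there is carried back. *)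
Lemma C_poly_split (a : nat -> C) (n : nat) :
  a n <> RtoC 0%R ->
  exists rs : list C, forall z : C,
    sum_n (fun j => Cmult (a j) (pow_n z j)) n =
    Cmult (a n) (List.fold_right (fun r acc => Cmult (Cminus z r) acc) (RtoC 1%R) rs).
Proof.
move=> an0.
have toK z : ofRC (toRC z) = z by case: z.
have ofK z : toRC (ofRC z) = z by case: z.
have toM z w : toRC (Cmult z w) = toRC z * toRC w by case: z w => [x y] [x' y'].
have toD z w : toRC (Cplus z w) = toRC z + toRC w by case: z w => [x y] [x' y'].
have toB z w : toRC (Cminus z w) = toRC z - toRC w by case: z w => [x y] [x' y'].
have toX z j : toRC (pow_n z j) = toRC z ^+ j.
  elim: j => [|j IH] //=; rewrite exprS -IH -toM; reflexivity.
pose p : {poly complex R} := \poly_(i < n.+1) toRC (a i).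
have lp : lead_coef p = toRC (a n).
  rewrite lead_coefE size_poly_eq /=; last first.
    apply/eqP => /(congr1 ofRC); rewrite toK => h; apply: an0; exact: h.
  by rewrite coef_poly ltnSn.
have [rs Hp] := closed_field_poly_normal p.
exists (map ofRC rs) => z; rewrite -[LHS]toK -[RHS]toK; congr ofRC.
have -> : toRC (sum_n (fun j => Cmult (a j) (pow_n z j)) n) = p.[toRC z].
  rewrite horner_poly; elim: n {an0 p lp Hp} => [|n IH].
    by rewrite sum_O big_ord1 toM toX.
  rewrite sum_Sn big_ord_recr /= -IH -toX -toM -toD; reflexivity.
rewrite Hp lp hornerZ toM; congr (_ * _).
rewrite horner_prod; elim: rs {Hp} => [|r rs IH]; first by rewrite big_nil.
by rewrite big_cons /= toM IH toB ofK hornerXsubC.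
Qed.
End FTA.

Open Scope general_if_scope.

(** * Unordered sums *)

Definition rsum {I : Type} (f : I -> R) (l : list I) : R :=
  fold_right (fun i s => f i + s) 0 l.

Definition lsum {I : Type} (f : I -> C) (l : list I) : C :=
  fold_right (fun i s => Cplus (f i) s) (RtoC 0) l.

(* With [f >= 0] this says that the unordered sum of [f] is at most [M]. *)
Definition bnd {I : Type} (f : I -> R) (M : R) : Prop :=
  forall l, NoDup l -> rsum f l <= M.

Definition summable {I : Type} (f : I -> C) : Prop :=
  exists M, bnd (fun i => Cmod (f i)) M.

(** Convergence along the finite duplicate-free lists, directed by inclusion. No enumeration of [I]
    enters, so reindexing and exchange of sums need no rearrangement theorem. *)
Definition is_usum {I : Type} (f : I -> C) (s : C) : Prop :=
  forall eps : R, 0 < eps -> exists l0 : list I,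
    forall l, NoDup l -> incl l0 l -> Cmod (Cminus (lsum f l) s) < eps.

Definition classic_eq_dec {I : Type} (x y : I) : {x = y} + {x <> y} :=
  excluded_middle_informative (x = y).

Notation cnodup := (nodup classic_eq_dec).

Lemma incl_cnodup {I : Type} (l : list I) : incl l (cnodup l).
Proof. move=> x; by rewrite nodup_In. Qed.

Lemma Cmod_minus_sym (a b : C) : Cmod (Cminus a b) = Cmod (Cminus b a).
Proof. rewrite -Cmod_opp; f_equal; ring. Qed.

Lemma Cmod_minus_triangle (a b c : C) :
  Cmod (Cminus a c) <= Cmod (Cminus a b) + Cmod (Cminus b c).
Proof.
  have -> : Cminus a c = Cplus (Cminus a b) (Cminus b c) by ring.
  apply Cmod_triangle.
Qed.

Lemma Cmod_le_abs (z : C) : Cmod z <= Rabs (fst z) + Rabs (snd z).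
Proof.
  case: z => x y; rewrite /Cmod /=.
  have := Rabs_pos x; have := Rabs_pos y => hy hx.
  apply Rsqr_incr_0_var; last lra.
  rewrite Rsqr_sqrt; last nra.
  rewrite /Rsqr.
  have := Rsqr_abs x; have := Rsqr_abs y; rewrite /Rsqr; nra.
Qed.

Lemma ball_of_Cmod (x y : C) (eps : R) :
  Cmod (Cminus x y) < eps -> ball (M := C_UniformSpace) y eps x.
Proof.
  move=> h; have hm := Rmax_Cmod (Cminus x y).
  split; (apply: Rle_lt_trans h; apply: Rle_trans hm).
    exact: Rmax_l.
  exact: Rmax_r.
Qed.

Lemma Cmod_of_ball (x y : C) (eps : R) :
  ball (M := C_UniformSpace) y eps x -> Cmod (Cminus x y) < 2 * eps.
Proof.
  move=> [h1 h2]; apply: Rle_lt_trans (Cmod_le_abs _) _.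
  change (Rabs (fst x - fst y) < eps) in h1.
  change (Rabs (snd x - snd y) < eps) in h2.
  rewrite /=; rewrite /Rminus in h1 h2; lra.
Qed.

Section ListSums.
Context {I : Type}.

Lemma rsum_app (f : I -> R) l1 l2 : rsum f (l1 ++ l2) = rsum f l1 + rsum f l2.
Proof. elim: l1 => [|a l1 IH] /=; rewrite ?IH; ring. Qed.

Lemma lsum_app (f : I -> C) l1 l2 : lsum f (l1 ++ l2) = Cplus (lsum f l1) (lsum f l2).
Proof. elim: l1 => [|a l1 IH] /=; rewrite ?IH; ring. Qed.

Lemma rsum_le (f g : I -> R) l : (forall i, In i l -> f i <= g i) -> rsum f l <= rsum g l.
Proof.
  elim: l => [|a l IH] H /=; first lra.
  apply Rplus_le_compat; [apply H; by left | apply IH => i Hi; apply H; by right].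
Qed.

Lemma rsum_ge0 (f : I -> R) l : (forall i, 0 <= f i) -> 0 <= rsum f l.
Proof. move=> H; elim: l => [|a l IH] /=; [lra | move: (H a); lra]. Qed.

Lemma rsum_scal (k : R) (f : I -> R) l : rsum (fun i => k * f i) l = k * rsum f l.
Proof. elim: l => [|a l IH] /=; rewrite ?IH; ring. Qed.

Lemma rsum_plus (f g : I -> R) l : rsum (fun i => f i + g i) l = rsum f l + rsum g l.
Proof. elim: l => [|a l IH] /=; rewrite ?IH; ring. Qed.

Lemma rsum_const (k : R) (l : list I) : rsum (fun _ => k) l = INR (length l) * k.
Proof. elim: l => [|a l IH]; [rewrite /=; ring | rewrite [length _]/= S_INR /= IH; ring]. Qed.

Lemma lsum_scal (k : C) (f : I -> C) l : lsum (fun i => Cmult k (f i)) l = Cmult k (lsum f l).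
Proof. elim: l => [|a l IH] /=; rewrite ?IH; ring. Qed.

Lemma lsum_plus (f g : I -> C) l :
  lsum (fun i => Cplus (f i) (g i)) l = Cplus (lsum f l) (lsum g l).
Proof. elim: l => [|a l IH] /=; rewrite ?IH; ring. Qed.

Lemma lsum_ext (f g : I -> C) l : (forall i, In i l -> f i = g i) -> lsum f l = lsum g l.
Proof.
  elim: l => [|a l IH] H //=.
  rewrite (H a); last by left. rewrite IH // => i Hi; apply H; by right.
Qed.

Lemma lsum_eq0 (f : I -> C) l : (forall i, In i l -> f i = RtoC 0) -> lsum f l = RtoC 0.
Proof.
  elim: l => [|a l IH] H //=.
  rewrite H; last by left. rewrite IH; [ring | move=> i Hi; apply H; by right].
Qed.

Lemma Cmod_lsum (f : I -> C) l : Cmod (lsum f l) <= rsum (fun i => Cmod (f i)) l.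
Proof.
  elim: l => [|a l IH] /=; first by rewrite Cmod_0; lra.
  have := Cmod_triangle (f a) (lsum f l); lra.
Qed.

Lemma rsum_incl (f : I -> R) l l' :
  (forall i, 0 <= f i) -> NoDup l -> incl l l' -> rsum f l <= rsum f l'.
Proof.
  move=> f0; elim: l l' => [|a l IH] l' nd inc /=; first by apply rsum_ge0.
  have [l1 [l2 E]] := in_split a l' (inc a (or_introl eq_refl)).
  inversion nd; subst.
  have : rsum f l <= rsum f (l1 ++ l2).
    apply IH => // x Hx.
    have := inc x (or_intror Hx).
    rewrite !in_app_iff /=; case; [tauto|case; [|tauto]] => e.
    by subst.
  rewrite !rsum_app /=; lra.
Qed.

Lemma bnd_ge0 (f : I -> R) M : bnd f M -> 0 <= M.
Proof. move=> H; exact: (H nil (NoDup_nil _)). Qed.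

Lemma bnd_le (f g : I -> R) M : (forall i, f i <= g i) -> bnd g M -> bnd f M.
Proof. move=> H b l nd; apply: (Rle_trans _ (rsum g l)); [apply rsum_le; auto | by apply b]. Qed.

Lemma bnd_le_r (f : I -> R) M M' : M <= M' -> bnd f M -> bnd f M'.
Proof. move=> H b l nd; have := b l nd; lra. Qed.

Lemma bnd_scal (f : I -> R) M k : 0 <= k -> bnd f M -> bnd (fun i => k * f i) (k * M).
Proof. move=> H b l nd; rewrite rsum_scal; apply Rmult_le_compat_l; auto. Qed.

Lemma bnd_plus (f g : I -> R) M N : bnd f M -> bnd g N -> bnd (fun i => f i + g i) (M + N).
Proof. move=> bf bg l nd; rewrite rsum_plus; have := bf l nd; have := bg l nd; lra. Qed.

Lemma bnd_term (f : I -> R) M i : bnd f M -> f i <= M.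
Proof.
  move=> b; have := b (i :: nil) ltac:(constructor; [tauto | constructor]).
  rewrite /=; lra.
Qed.

(** Choose [l0] with sum within [eps] of the supremum of all finite sums. A list disjoint from it
    can be appended without exceeding the supremum. *)
Lemma bnd_tail (g : I -> R) M eps : (forall i, 0 <= g i) -> bnd g M -> 0 < eps ->
  exists l0, forall l, NoDup l -> (forall i, In i l -> ~ In i l0) -> rsum g l < eps.
Proof.
  move=> g0 b e0.
  pose E x := exists l, NoDup l /\ x = rsum g l.
  have [S [ub lub]] : {S | is_lub E S}.
    apply completeness.
    - exists M => x [l [nd ->]]; auto.
    - exists 0, nil; split; [constructor | done].
  have [l0 [nd0 Hl0]] : exists l0, NoDup l0 /\ S - eps < rsum g l0.
    apply NNPP => H.
    have : S <= S - eps; last lra.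
    apply lub => x [l [nd ->]].
    case: (Rle_or_lt (rsum g l) (S - eps)) => // h.
    by case: H; exists l.
  exists l0 => l nd dis.
  have : rsum g (l0 ++ l) <= S.
    apply ub; exists (l0 ++ l); split => //.
    apply NoDup_app => // x h1 h2; exact: (dis x h2).
  rewrite rsum_app; lra.
Qed.

Lemma usum_unique (f : I -> C) s s' : is_usum f s -> is_usum f s' -> s = s'.
Proof.
  move=> H H'.
  have Z : Cmod (Cminus s s') = 0.
    apply Rle_antisym; last by apply Cmod_ge_0.
    apply le_epsilon => e e0.
    have [l0 h0] := H (e / 2) ltac:(lra).
    have [l1 h1] := H' (e / 2) ltac:(lra).
    pose l := cnodup (l0 ++ l1).
    have nd : NoDup l by apply NoDup_nodup.
    have := h0 l nd ltac:(move=> x hx; apply incl_cnodup, in_or_app; by left).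
    have := h1 l nd ltac:(move=> x hx; apply incl_cnodup, in_or_app; by right).
    have := Cmod_minus_triangle s (lsum f l) s'.
    rewrite (Cmod_minus_sym s (lsum f l)); lra.
  apply Cmod_eq_0 in Z.
  have -> : s = Cplus (Cminus s s') s' by ring.
  rewrite Z; ring.
Qed.

Lemma usum_ext (f g : I -> C) s : (forall i, f i = g i) -> is_usum f s -> is_usum g s.
Proof.
  move=> H u e e0; have [l0 h] := u e e0; exists l0 => l nd inc.
  by rewrite -(lsum_ext f g) //; apply h.
Qed.

Lemma usum_plus (f g : I -> C) s t :
  is_usum f s -> is_usum g t -> is_usum (fun i => Cplus (f i) (g i)) (Cplus s t).
Proof.
  move=> H H' e e0.
  have [l0 h0] := H (e / 2) ltac:(lra).
  have [l1 h1] := H' (e / 2) ltac:(lra).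
  exists (l0 ++ l1) => l nd inc.
  have := h0 l nd ltac:(move=> x hx; apply inc, in_or_app; by left).
  have := h1 l nd ltac:(move=> x hx; apply inc, in_or_app; by right).
  rewrite lsum_plus.
  have -> : Cminus (Cplus (lsum f l) (lsum g l)) (Cplus s t) =
            Cplus (Cminus (lsum f l) s) (Cminus (lsum g l) t) by ring.
  have := Cmod_triangle (Cminus (lsum f l) s) (Cminus (lsum g l) t); lra.
Qed.

Lemma usum_scal (k : C) (f : I -> C) s :
  is_usum f s -> is_usum (fun i => Cmult k (f i)) (Cmult k s).
Proof.
  move=> H e e0.
  have k0 := Cmod_ge_0 k.
  have [l0 h0] := H (e / (Cmod k + 1)) ltac:(apply Rdiv_lt_0_compat; lra).
  exists l0 => l nd inc; rewrite lsum_scal.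
  have -> : Cminus (Cmult k (lsum f l)) (Cmult k s) = Cmult k (Cminus (lsum f l) s) by ring.
  rewrite Cmod_mult.
  have h := h0 l nd inc.
  apply Rle_lt_trans with (Cmod k * (e / (Cmod k + 1))).
    apply Rmult_le_compat_l; lra.
  have -> : Cmod k * (e / (Cmod k + 1)) = e - e / (Cmod k + 1) by field; lra.
  have : 0 < e / (Cmod k + 1) by apply Rdiv_lt_0_compat; lra.
  lra.
Qed.

Lemma usum_bound (f : I -> C) s M :
  bnd (fun i => Cmod (f i)) M -> is_usum f s -> Cmod s <= M.
Proof.
  move=> b u; apply le_epsilon => e e0.
  have [l0 h] := u e e0.
  have nd : NoDup (cnodup l0) by apply NoDup_nodup.
  have := h _ nd (incl_cnodup l0).
  have := Cmod_lsum f (cnodup l0).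
  have := b _ nd.
  have := Cmod_triangle (Cminus s (lsum f (cnodup l0))) (lsum f (cnodup l0)).
  have -> : Cplus (Cminus s (lsum f (cnodup l0))) (lsum f (cnodup l0)) = s by ring.
  rewrite (Cmod_minus_sym s); lra.
Qed.

Lemma usum_single (f : I -> C) i0 : (forall i, i <> i0 -> f i = RtoC 0) -> is_usum f (f i0).
Proof.
  move=> H e e0; exists (i0 :: nil) => l nd inc.
  have [l1 [l2 E]] := in_split i0 l (inc i0 (or_introl eq_refl)).
  subst l; have := NoDup_remove_2 _ _ _ nd; rewrite in_app_iff => nin.
  rewrite lsum_app /= !lsum_eq0.
  - have -> : Cminus (Cplus 0 (Cplus (f i0) 0)) (f i0) = RtoC 0 by ring.
    by rewrite Cmod_0.
  - move=> i hi; apply H => e1; subst; tauto.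
  - move=> i hi; apply H => e1; subst; tauto.
Qed.

(** The lists containing a given list generate a proper filter, so completeness of the complex
    numbers applies. The Cauchy property holds since two lists containing [l0] differ only by terms
    outside it, and [bnd_tail] makes these small. *)
Lemma usum_exists (f : I -> C) : summable f -> exists s, is_usum f s.
Proof.
  move=> [M b].
  pose F : (list I -> Prop) -> Prop := fun P =>
    exists l0, forall l, NoDup l -> incl l0 l -> P l.
  have PF : ProperFilter F.
    constructor.
    - move=> P [l0 h]; exists (cnodup l0); apply h; [apply NoDup_nodup | apply incl_cnodup].
    - constructor.
      + by exists nil.
      + move=> P Q [l0 h0] [l1 h1]; exists (l0 ++ l1) => l nd inc; split;
        [apply h0 | apply h1] => // x hx; apply inc, in_or_app; tauto.
      + move=> P Q PQ [l0 h0]; exists l0 => l nd inc; auto.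
  have [c0 _] := filterlim_locally_cauchy (U := C_R_CompleteNormedModule) (lsum f).
  case: c0.
    move=> eps.
    have [l0 h] := bnd_tail _ M (eps / 2) (fun i => Cmod_ge_0 (f i)) b ltac:(have := cond_pos eps; lra).
    exists (fun l => NoDup l /\ incl l0 l); split; first by exists l0.
    pose rest l := filter (fun i => if in_dec classic_eq_dec i l0 then false else true) l.
    pose part l := filter (fun i => if in_dec classic_eq_dec i l0 then true else false) l.
    have split_l l : lsum f l = Cplus (lsum f (part l)) (lsum f (rest l)).
      elim: l => [|a l IH] /=; first ring.
      rewrite IH; case: in_dec => _ /=; ring.
    have permu l : NoDup l -> incl l0 l -> lsum f (part l) = lsum f (cnodup l0).
      move=> nd inc.
      have P : Permutation (part l) (cnodup l0).
        apply NoDup_Permutation.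
        - by apply NoDup_filter.
        - apply NoDup_nodup.
        - move=> x; rewrite filter_In nodup_In; case: in_dec => h'; split; try tauto.
          + by move=> _; split; [apply inc|].
          + by case.
      elim: P => //=; last by move=> ? ? ? _ -> _ ->.
        by move=> x l1 l2 _ ->.
      by move=> x y l1; ring.
    have small l : NoDup l -> Cmod (lsum f (rest l)) < eps / 2.
      move=> nd; apply: Rle_lt_trans (Cmod_lsum _ _) _.
      apply h; first by apply NoDup_filter.
      by move=> i; rewrite filter_In; case: in_dec => // ? [].
    move=> u v [nu iu] [nv iv].
    have E : Cmod (Cminus (lsum f v) (lsum f u)) < eps.
      rewrite (split_l u) (split_l v) permu // permu //.
      have -> : Cminus (Cplus (lsum f (cnodup l0)) (lsum f (rest v)))
                       (Cplus (lsum f (cnodup l0)) (lsum f (rest u))) =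
                Cplus (lsum f (rest v)) (Copp (lsum f (rest u))) by ring.
      apply: Rle_lt_trans (Cmod_triangle _ _) _.
      rewrite Cmod_opp; move: (small u nu) (small v nv); lra.
    exact: ball_of_Cmod.
  move=> y Hy; exists y => e e0.
  have [l0 h0] := proj1 (filterlim_locally _ _) Hy (mkposreal (e / 2) ltac:(lra)).
  exists l0 => l nd inc.
  have := Cmod_of_ball _ _ _ (h0 l nd inc); rewrite /=; lra.
Qed.

End ListSums.

Lemma bnd_inj {I J : Type} (phi : J -> I) (f : I -> R) M :
  (forall x y, phi x = phi y -> x = y) -> bnd f M -> bnd (fun j => f (phi j)) M.
Proof.
  move=> inj b l nd.
  have -> : rsum (fun j => f (phi j)) l = rsum f (map phi l).
    by elim: l {nd} => //= a l ->.
  apply b; by apply FinFun.Injective_map_NoDup.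
Qed.

Lemma preimage_list {I J : Type} (phi : J -> I) (l : list I) :
  (forall i, In i l -> exists j, phi j = i) -> exists l', l = map phi l'.
Proof.
  elim: l => [|a l IH] H; first by exists nil.
  have [j hj] := H a (or_introl eq_refl).
  have [l' ->] := IH (fun i hi => H i (or_intror hi)).
  by exists (j :: l'); rewrite /= hj.
Qed.

Lemma bnd_extend {I J : Type} (phi : J -> I) (f : I -> R) M :
  (forall i, (forall j, phi j <> i) -> f i = 0) ->
  bnd (fun j => f (phi j)) M -> bnd f M.
Proof.
  move=> z b l nd.
  pose test := fun i => if excluded_middle_informative (exists j, phi j = i) then true else false.
  have [l' Hl'] : exists l', filter test l = map phi l'.
    apply preimage_list => i; rewrite filter_In /test; case: excluded_middle_informative => //.
    by move=> _ [].
  have -> : rsum f l = rsum f (filter test l).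
    elim: l {nd Hl'} => //= a l ->.
    rewrite /test; case: excluded_middle_informative => //= h.
    rewrite z; [ring | move=> j hj; apply h; by exists j].
  have nd' : NoDup (map phi l') by rewrite -Hl'; apply NoDup_filter.
  rewrite Hl'; have -> : rsum f (map phi l') = rsum (fun j => f (phi j)) l'.
    by elim: l' {nd' Hl'} => //= a l' ->.
  by apply b; apply: NoDup_map_inv nd'.
Qed.

Lemma usum_reindex {I J : Type} (phi : J -> I) (f : I -> C) s :
  (forall x y, phi x = phi y -> x = y) ->
  (forall i, (forall j, phi j <> i) -> f i = RtoC 0) ->
  is_usum f s -> is_usum (fun j => f (phi j)) s.
Proof.
  move=> inj z u e e0; have [l0 h] := u e e0.
  pose test := fun i => if excluded_middle_informative (exists j, phi j = i) then true else false.
  have [l0' Hl0'] : exists l', filter test l0 = map phi l'.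
    apply preimage_list => i; rewrite filter_In /test; case: excluded_middle_informative => //.
    by move=> _ [].
  exists l0' => l nd inc.
  (* Entries of [l0] outside the range of [phi] have no preimage. They contribute zero and are
     appended only so that the list contains [l0]. *)
  pose rest := filter (fun i => negb (test i)) (cnodup l0).
  have -> : lsum (fun j => f (phi j)) l = lsum f (map phi l ++ rest).
    rewrite lsum_app (lsum_eq0 f rest).
      rewrite Cplus_0_r; by elim: l {nd inc} => //= a l ->.
    move=> i; rewrite filter_In /test; case: excluded_middle_informative => h' [_ //] _.
    apply z => j hj; apply h'; by exists j.
  apply h.
  - apply NoDup_app.
    + by apply FinFun.Injective_map_NoDup.
    + apply NoDup_filter, NoDup_nodup.
    + move=> x; rewrite in_map_iff => -[j [<- _]]; rewrite filter_In /test.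
      case: excluded_middle_informative => [? [_ //]|[]]; by exists j.
  - move=> x hx; apply in_or_app.
    case E: (test x).
      left; have : In x (map phi l0') by rewrite -Hl0' filter_In.
      rewrite !in_map_iff => -[j [hj hj']]; exists j; split => //; by apply inc.
    right; rewrite filter_In nodup_In E; by split.
Qed.

Lemma rsum_list_prod {I J : Type} (F : I * J -> R) l1 l2 :
  rsum F (list_prod l1 l2) = rsum (fun i => rsum (fun j => F (i, j)) l2) l1.
Proof.
  elim: l1 => //= a l1 IH; rewrite rsum_app IH; f_equal.
  by elim: l2 {IH} => //= b l2 ->.
Qed.

Lemma bnd_prod {I J : Type} (F : I * J -> R) (G : I -> R) M :
  (forall p, 0 <= F p) -> (forall i, bnd (fun j => F (i, j)) (G i)) -> bnd G M -> bnd F M.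
Proof.
  move=> F0 row bG l nd.
  pose l1 := cnodup (map fst l); pose l2 := cnodup (map snd l).
  have inc : incl l (list_prod l1 l2).
    move=> [i j] h; apply in_prod; rewrite nodup_In in_map_iff; by exists (i, j).
  apply: Rle_trans (rsum_incl F _ _ F0 nd inc) _.
  rewrite rsum_list_prod.
  apply: Rle_trans (bG l1 (NoDup_nodup _ _)).
  apply rsum_le => i _; apply row; apply NoDup_nodup.
Qed.

Lemma bnd_row {I J : Type} (F : I * J -> R) M i : bnd F M -> bnd (fun j => F (i, j)) M.
Proof. apply (bnd_inj (fun j => (i, j))) => x y; by case. Qed.

Lemma NoDup_dep_pairs {I J : Type} (L : I -> list J) l :
  NoDup l -> (forall i, NoDup (L i)) -> NoDup (flat_map (fun i => map (pair i) (L i)) l).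
Proof.
  move=> nd HL; elim: l nd => [|a l IH] nd /=; first constructor.
  inversion nd; subst; apply NoDup_app.
  - apply FinFun.Injective_map_NoDup => // x y; by case.
  - by apply IH.
  - move=> [i j]; rewrite in_map_iff => -[j' [[<- _] _]].
    rewrite in_flat_map => -[i' [h1]]; rewrite in_map_iff => -[j'' [[e1 _] _]].
    by subst.
Qed.

Lemma lsum_dep_pairs {I J : Type} (L : I -> list J) (F : I * J -> C) (g : I -> C) d l :
  (forall i, Cmod (Cminus (lsum (fun j => F (i, j)) (L i)) (g i)) <= d) ->
  Cmod (Cminus (lsum F (flat_map (fun i => map (pair i) (L i)) l)) (lsum g l)) <=
  rsum (fun _ => d) l.
Proof.
  move=> H; elim: l => [|a l IH] /=.
    have -> : Cminus 0 0 = RtoC 0 by ring. rewrite Cmod_0; lra.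
  rewrite lsum_app.
  have -> : lsum F (map (pair a) (L a)) = lsum (fun j => F (a, j)) (L a).
    by elim: (L a) => //= b l' ->.
  set x := lsum (fun j => F (a, j)) (L a).
  set y := lsum F _.
  have -> : Cminus (Cplus x y) (Cplus (g a) (lsum g l)) =
            Cplus (Cminus x (g a)) (Cminus y (lsum g l)) by ring.
  apply: Rle_trans (Cmod_triangle _ _) _.
  apply Rplus_le_compat; [apply H | by apply IH].
Qed.

(** Over a given list [l] each row is approximated by a finite list that also contains all second
    indices paired with [i] in [l0]. The union of these rows is a finite set of pairs containing
    [l0], so its sum is near [s]. *)
Lemma fubini {I J : Type} (F : I * J -> C) (g : I -> C) s :
  is_usum F s -> (forall i, is_usum (fun j => F (i, j)) (g i)) -> is_usum g s.
Proof.
  move=> u row e e0.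
  have [l0 h0] := u (e / 2) ltac:(lra).
  exists (map fst l0) => l nd inc.
  have n0 : 0 < INR (length l) + 1 by have := pos_INR (length l); lra.
  (* One error [d] per row; together they stay below e / 2. *)
  pose d := e / (2 * (INR (length l) + 1)).
  have d0 : 0 < d by apply Rdiv_lt_0_compat; lra.
  have ch i : exists li, NoDup li /\ (forall j, In (i, j) l0 -> In j li) /\
                        Cmod (Cminus (lsum (fun j => F (i, j)) li) (g i)) < d.
    have [li hi] := row i d d0.
    pose li' := cnodup (li ++ map snd l0).
    exists li'; split; first by apply NoDup_nodup.
    split.
      move=> j hj; apply incl_cnodup, in_or_app; right.
      rewrite in_map_iff; by exists (i, j).
    apply hi; first by apply NoDup_nodup.
    move=> x hx; apply incl_cnodup, in_or_app; by left.
  pose L i := proj1_sig (constructive_indefinite_description _ (ch i)).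
  have HL i : NoDup (L i) /\ (forall j, In (i, j) l0 -> In j (L i)) /\
                        Cmod (Cminus (lsum (fun j => F (i, j)) (L i)) (g i)) < d.
    exact: (proj2_sig (constructive_indefinite_description _ (ch i))).
  pose big := flat_map (fun i => map (pair i) (L i)) l.
  have bin i j : In (i, j) big <-> In i l /\ In j (L i).
    rewrite in_flat_map; split.
      move=> [i' [h1]]; rewrite in_map_iff => -[j' [e1 h2]]; inversion e1; by subst.
    move=> [h1 h2]; exists i; split => //; rewrite in_map_iff; by exists j.
  have ndb : NoDup big.
    apply NoDup_dep_pairs => // i; apply HL.
  have hb := h0 big ndb ltac:(by move=> [i j] hij; apply bin; split;
     [apply inc; rewrite in_map_iff; exists (i, j) | apply HL]).
  have : Cmod (Cminus (lsum F big) (lsum g l)) <= INR (length l) * d.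
    rewrite -rsum_const; apply lsum_dep_pairs => i; apply Rlt_le, HL.
  have : INR (length l) * d <= e / 2.
    rewrite /d; have -> : e / 2 = (INR (length l) + 1) * (e / (2 * (INR (length l) + 1))) by field; lra.
    apply Rmult_le_compat_r; [exact: Rlt_le | lra].
  have := Cmod_minus_triangle (lsum g l) (lsum F big) s.
  rewrite (Cmod_minus_sym (lsum g l) (lsum F big)); lra.
Qed.

(** A weighted norm of a sequence of sums is bounded through the double family. This yields both the
    norm of a convolution and the sums over n with weight nu_n^3. *)
Lemma fubini_bnd {I J : Type} (F : I * J -> C) (g : I -> C) (w : I -> R) M :
  (forall i, 0 <= w i) ->
  bnd (fun p => w (fst p) * Cmod (F p)) M ->
  (forall i, is_usum (fun j => F (i, j)) (g i)) -> bnd (fun i => w i * Cmod (g i)) M.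
Proof.
  move=> w0 b row l nd; apply le_epsilon => e e0.
  have n0 : 0 < INR (length l) + 1 by have := pos_INR (length l); lra.
  pose d := e / (INR (length l) + 1).
  have d0 : 0 < d by apply Rdiv_lt_0_compat; lra.
  have ch i : exists li, NoDup li /\ w i * Cmod (g i) <=
      rsum (fun j => w i * Cmod (F (i, j))) li + d.
    have w1 : 0 < w i + 1 by have := w0 i; lra.
    have [li hi] := row i (d / (w i + 1)) ltac:(apply Rdiv_lt_0_compat; lra).
    exists (cnodup li); split; first by apply NoDup_nodup.
    have h := hi _ (NoDup_nodup _ _) (incl_cnodup li).
    rewrite rsum_scal.
    set x := lsum _ _ in h.
    have h1 : Cmod (g i) <= Cmod x + d / (w i + 1).
      have -> : g i = Cplus x (Copp (Cminus x (g i))) by ring.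
      apply: Rle_trans (Cmod_triangle _ _) _; rewrite Cmod_opp; lra.
    have h2 := Cmod_lsum (fun j => F (i, j)) (cnodup li).
    have h3 : w i * (d / (w i + 1)) <= d.
      have -> : w i * (d / (w i + 1)) = d - d / (w i + 1) by field; lra.
      have : 0 < d / (w i + 1) by apply Rdiv_lt_0_compat; lra.
      lra.
    have := w0 i; rewrite -/x in h2; nra.
  pose L i := proj1_sig (constructive_indefinite_description _ (ch i)).
  have HL i : NoDup (L i) /\ w i * Cmod (g i) <=
      rsum (fun j => w i * Cmod (F (i, j))) (L i) + d.
    exact: (proj2_sig (constructive_indefinite_description _ (ch i))).
  have nd' := NoDup_dep_pairs L l nd (fun i => proj1 (HL i)).
  have := b _ nd'.
  have -> : rsum (fun p => w (fst p) * Cmod (F p)) (flat_map (fun i => map (pair i) (L i)) l) =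
            rsum (fun i => rsum (fun j => w i * Cmod (F (i, j))) (L i)) l.
    elim: l {nd n0 d d0 ch L HL nd'} (L) => //= a l IH L'.
    rewrite rsum_app IH; f_equal.
    by elim: (L' a) => //= x l' ->.
  have : rsum (fun i => w i * Cmod (g i)) l <=
         rsum (fun i => rsum (fun j => w i * Cmod (F (i, j))) (L i) + d) l.
    by apply rsum_le => i _; apply HL.
  rewrite rsum_plus rsum_const.
  have : INR (length l) * d <= e.
    rewrite /d; have {2}-> : e = (INR (length l) + 1) * (e / (INR (length l) + 1)) by field; lra.
    apply Rmult_le_compat_r; [exact: Rlt_le | lra].
  lra.
Qed.

(** * Unordered sums and ordinary series *)

Lemma sum_n_rsum (f : nat -> R) n : sum_n f n = rsum f (seq 0 (S n)).
Proof.
  elim: n => [|n IH]; first by rewrite sum_O /=; ring.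
  rewrite sum_Sn IH (seq_S (S n)) rsum_app /plus /=; ring.
Qed.

Lemma sum_n_lsum (f : nat -> C) n :
  sum_n (f : nat -> C_R_CompleteNormedModule) n = lsum f (seq 0 (S n)).
Proof.
  elim: n => [|n IH]; first by rewrite sum_O /= Cplus_0_r.
  rewrite sum_Sn IH (seq_S (S n)) lsum_app [lsum f (_ :: nil)]/= Cplus_0_r; reflexivity.
Qed.

Lemma nat_list_bounded (l : list nat) : exists N, incl l (seq 0 N).
Proof.
  exists (S (list_max l)) => x hx; apply in_seq.
  have := proj1 (list_max_le l (list_max l)) (le_n _).
  move/Forall_forall => /(_ x hx); lia.
Qed.

Lemma bnd_ex_series (f : nat -> R) M : (forall n, 0 <= f n) -> bnd f M -> ex_series f.
Proof.
  move=> f0 b.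
  have [l hl] : ex_finite_lim_seq (sum_n f).
    apply (ex_finite_lim_seq_incr _ M) => n.
      rewrite sum_Sn /plus /=; have := f0 (S n); lra.
    rewrite sum_n_rsum; apply b, seq_NoDup.
  by exists l.
Qed.

Lemma is_series_bnd (f : nat -> R) s : (forall n, 0 <= f n) -> is_series f s -> bnd f s.
Proof.
  move=> f0 hs l nd.
  have [N inc] := nat_list_bounded l.
  apply: Rle_trans (rsum_incl f l (seq 0 (S N)) f0 nd _) _.
    move=> x hx; have := inc x hx; rewrite !in_seq; lia.
  rewrite -sum_n_rsum.
  apply (is_lim_seq_incr_compare (sum_n f) s) => // n.
  rewrite sum_Sn /plus /=; have := f0 (S n); lra.
Qed.

Lemma ex_series_bnd (f : nat -> R) : (forall n, 0 <= f n) -> ex_series f -> exists M, bnd f M.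
Proof. by move=> f0 [s hs]; exists s; apply is_series_bnd. Qed.

Lemma usum_is_series (f : nat -> C) s :
  is_usum f s -> is_series (f : nat -> C_R_CompleteNormedModule) s.
Proof.
  move=> u; apply filterlim_locally => eps.
  have [l0 h] := u eps (cond_pos eps).
  have [N inc] := nat_list_bounded l0.
  exists N => n hn.
  have := h (seq 0 (S n)) (seq_NoDup _ _) ltac:(move=> x hx; have := inc x hx; rewrite !in_seq; lia).
  rewrite -sum_n_lsum => E.
  exact: ball_of_Cmod.
Qed.

Lemma CSeries_usum (f : nat -> C) s : is_usum f s -> CSeries f = s.
Proof.
  move=> u; rewrite /CSeries.
  apply (iota_filterlim_locally (V := C_R_CompleteNormedModule) (F := eventually)
     (sum_n (f : nat -> C_R_CompleteNormedModule))).
  exact: (usum_is_series f s u).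
Qed.

(** The bridge to the statement of the theorem, where a sum over the integers is a pair of one-sided
    series: split [f] by the sign of the index and reindex both halves. *)
Lemma CZsum_usum (f : Z -> C) s : summable f -> is_usum f s -> CZsum f = s.
Proof.
  move=> [M b] u.
  pose f1 i := if Z_le_dec 0 i then f i else RtoC 0.
  pose f2 i := if Z_le_dec 0 i then RtoC 0 else f i.
  have [s1 u1] : exists s1, is_usum f1 s1.
    apply usum_exists; exists M; apply: bnd_le b => i; rewrite /f1.
    case: Z_le_dec => _; [lra | rewrite Cmod_0; apply Cmod_ge_0].
  have [s2 u2] : exists s2, is_usum f2 s2.
    apply usum_exists; exists M; apply: bnd_le b => i; rewrite /f2.
    case: Z_le_dec => _; [rewrite Cmod_0; apply Cmod_ge_0 | lra].
  have -> : s = Cplus s1 s2.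
    apply (usum_unique f) => //.
    apply: usum_ext (usum_plus f1 f2 s1 s2 u1 u2) => i.
    rewrite /f1 /f2; case: Z_le_dec => _; ring.
  rewrite /CZsum; f_equal; apply CSeries_usum.
  - have v := usum_reindex Z.of_nat f1 s1 ltac:(move=> x y; lia) _ u1.
    apply: usum_ext (v _) => [n|i hi].
      rewrite /f1; case: (Z_le_dec 0 _) => h //; lia.
    rewrite /f1; case: (Z_le_dec 0 _) => h //.
    case: (hi (Z.to_nat i)); lia.
  - have v := usum_reindex (fun n => (- Z.of_nat (S n))%Z) f2 s2 ltac:(move=> x y; cbv beta; lia) _ u2.
    apply: usum_ext (v _) => [n|i hi].
      rewrite /f2; case: (Z_le_dec 0 _) => h //; lia.
    rewrite /f2; case: (Z_le_dec 0 _) => h //.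
    case: (hi (Z.to_nat (-i-1))); lia.
Qed.

Lemma in_W_bnd nu c : (forall j, 0 <= nu j) -> in_W nu c -> exists M, bnd (fun j => nu j * Cmod (c j)) M.
Proof.
  move=> nu0 [h1 h2].
  have p j : 0 <= nu j * Cmod (c j) by apply Rmult_le_pos; [|apply Cmod_ge_0].
  have [M1 b1] := ex_series_bnd _ (fun n => p (Z.of_nat n)) h1.
  have [M2 b2] := ex_series_bnd _ (fun n => p (- Z.of_nat (S n))%Z) h2.
  exists (M1 + M2).
  pose g := fun j => nu j * Cmod (c j).
  apply (bnd_le _ (fun j => (if Z_le_dec 0 j then g j else 0) + (if Z_le_dec 0 j then 0 else g j))).
    move=> j; rewrite /g; case: (Z_le_dec 0 j) => _; lra.
  apply bnd_plus.
  - apply (bnd_extend Z.of_nat).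
      move=> i hi; case: (Z_le_dec 0 _) => h //; case: (hi (Z.to_nat i)); lia.
    apply: bnd_le b1 => n; case: Z_le_dec => h; [rewrite /g; lra | lia].
  - apply (bnd_extend (fun n => (- Z.of_nat (S n))%Z)).
      move=> i hi; case: (Z_le_dec 0 _) => h //; case: (hi (Z.to_nat (-i-1))); lia.
    apply: bnd_le b2 => n; case: Z_le_dec => h; [lia | rewrite /g; lra].
Qed.

(** * Complex-valued functions of a real variable *)

Lemma ccont_pair {U : UniformSpace} (f : U -> C) (t : U) :
  continuous (fun s => fst (f s)) t -> continuous (fun s => snd (f s)) t -> continuous f t.
Proof.
  move=> h1 h2; apply filterlim_locally => eps.
  pose proof (proj1 (filterlim_locally (F := locally t) _ _) h1 eps) as k1.
  pose proof (proj1 (filterlim_locally (F := locally t) _ _) h2 eps) as k2.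
  apply: filter_imp (filter_and _ _ k1 k2) => x [a b]; by split.
Qed.

Lemma ccont_fst {U : UniformSpace} (f : U -> C) (t : U) : continuous f t -> continuous (fun s => fst (f s)) t.
Proof.
  move=> h; apply: continuous_comp h _; case: (f t) => a b; apply continuous_fst.
Qed.

Lemma ccont_snd {U : UniformSpace} (f : U -> C) (t : U) : continuous f t -> continuous (fun s => snd (f s)) t.
Proof.
  move=> h; apply: continuous_comp h _; case: (f t) => a b; apply continuous_snd.
Qed.

Lemma ccont_plus {U : UniformSpace} (f g : U -> C) (t : U) :
  continuous f t -> continuous g t -> continuous (fun s => Cplus (f s) (g s)) t.
Proof.
  move=> hf hg; apply ccont_pair => /=; apply (continuous_plus (V := R_NormedModule));
  by [apply ccont_fst | apply ccont_snd].
Qed.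

Lemma ccont_const {U : UniformSpace} (c : C) (t : U) : continuous (fun _ : U => c) t.
Proof. apply continuous_const. Qed.

Lemma ccont_mult {U : UniformSpace} (f g : U -> C) (t : U) :
  continuous f t -> continuous g t -> continuous (fun s => Cmult (f s) (g s)) t.
Proof.
  move=> hf hg.
  have := ccont_fst f t hf; have := ccont_fst g t hg.
  have := ccont_snd f t hf; have := ccont_snd g t hg => a b c d.
  apply ccont_pair => /=.
    apply (continuous_minus (V := R_NormedModule)); by apply (continuous_mult (K := R_AbsRing)).
  apply (continuous_plus (V := R_NormedModule)); by apply (continuous_mult (K := R_AbsRing)).
Qed.

Lemma ccont_opp {U : UniformSpace} (f : U -> C) (t : U) :
  continuous f t -> continuous (fun s => Copp (f s)) t.
Proof.
  move=> h; apply ccont_pair => /=; apply (continuous_opp (V := R_NormedModule));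
  by [apply ccont_fst | apply ccont_snd].
Qed.

Lemma ccont_lsum {I : Type} {U : UniformSpace} (f : I -> U -> C) l (t : U) :
  (forall i, continuous (f i) t) -> continuous (fun s => lsum (fun i => f i s) l) t.
Proof.
  move=> h; elim: l => [|a l IH] /=; [apply ccont_const | by apply ccont_plus].
Qed.

Lemma ccont_eps (f : R -> C) t :
  (forall e, 0 < e -> exists d, 0 < d /\ forall s, Rabs (s - t) < d -> Cmod (Cminus (f s) (f t)) < e) <->
  continuous f t.
Proof.
  split => h.
    apply filterlim_locally => eps.
    have [d [d0 hd]] := h eps (cond_pos eps).
    exists (mkposreal d d0) => s hs; exact: ball_of_Cmod (hd s hs).
  move=> e e0.
  have [d hd] := proj1 (filterlim_locally _ _) h (mkposreal (e / 2) ltac:(lra)).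
  exists d; split; first by apply cond_pos.
  move=> s hs; have := Cmod_of_ball _ _ _ (hd s hs); rewrite /=; lra.
Qed.

Lemma cexp_add u v : cexp (Cplus u v) = Cmult (cexp u) (cexp v).
Proof.
  case: u v => [x y] [x' y']; rewrite /cexp /Cmult /Cplus /= exp_plus cos_plus sin_plus.
  by f_equal; ring.
Qed.

Lemma cexp_0 : cexp (RtoC 0) = RtoC 1.
Proof. by rewrite /cexp /= exp_0 cos_0 sin_0; rewrite /RtoC; f_equal; ring. Qed.

Lemma Cmod_cexp u : Cmod (cexp u) = exp (fst u).
Proof.
  case: u => x y; rewrite /cexp /Cmod /=.
  have -> : exp x * cos y * (exp x * cos y * 1) + exp x * sin y * (exp x * sin y * 1) = (exp x)².
    have := sin2_cos2 y; rewrite /Rsqr => h.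
    have -> : exp x * cos y * (exp x * cos y * 1) + exp x * sin y * (exp x * sin y * 1) =
       exp x * exp x * (sin y * sin y + cos y * cos y) by ring.
    rewrite h; ring.
  apply sqrt_Rsqr, Rlt_le, exp_pos.
Qed.

Lemma cexp_neq0 u : cexp u <> RtoC 0.
Proof. move=> h; have := Cmod_cexp u; rewrite h Cmod_0; have := exp_pos (fst u); lra. Qed.

Lemma cexp_opp u : cexp (Copp u) = Cinv (cexp u).
Proof.
  have h := cexp_neq0 u.
  have e : Cmult (cexp u) (cexp (Copp u)) = RtoC 1.
    by rewrite -cexp_add Cplus_opp_r cexp_0.
  rewrite -[cexp (Copp u)]Cmult_1_l -(Cinv_l _ h) -Cmult_assoc e; ring.
Qed.

Lemma cexp_conj u : Cconj (cexp u) = cexp (Cconj u).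
Proof. case: u => x y; rewrite /cexp /Cconj /= cos_neg sin_neg; f_equal; ring. Qed.

Lemma cis_cexp t : cis t = cexp (0, t).
Proof. rewrite /cis /cexp /= exp_0; f_equal; ring. Qed.

Lemma pow_n_cexp u n : pow_n (cexp u) n = cexp (Cmult (RtoC (INR n)) u).
Proof.
  elim: n => [|n IH].
    by rewrite /= Cmult_0_l cexp_0.
  rewrite S_INR RtoC_plus.
  have -> : Cmult (Cplus (INR n) 1) u = Cplus u (Cmult (INR n) u) by ring.
  rewrite cexp_add -IH; reflexivity.
Qed.

Lemma Cpowz_cexp u j : Cpowz (cexp u) j = cexp (Cmult (RtoC (IZR j)) u).
Proof.
  case: j => [|p|p] /=.
  - by rewrite Cmult_0_l cexp_0.
  - by rewrite pow_n_cexp INR_IPR.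
  - rewrite pow_n_cexp -cexp_opp INR_IPR; f_equal.
    rewrite -[IZR (Z.neg p)]/(- IPR p) RtoC_opp; ring.
Qed.

Lemma ccont_cexp {U : UniformSpace} (f : U -> C) (t : U) : continuous f t -> continuous (fun s => cexp (f s)) t.
Proof.
  move=> h; have h1 := ccont_fst f t h; have h2 := ccont_snd f t h.
  have e1 : continuous (fun s => exp (fst (f s))) t.
    by apply: continuous_comp h1 (continuous_exp _).
  apply ccont_pair => /=; apply (continuous_mult (K := R_AbsRing)) => //.
    by apply: continuous_comp h2 (continuous_cos _).
  by apply: continuous_comp h2 (continuous_sin _).
Qed.

Notation CRInt := (RInt (V := C_R_CompleteNormedModule)).
Notation is_CRInt := (is_RInt (V := C_R_CompleteNormedModule)).

Lemma ccont_RInt (f : R -> C) a b : (forall t, continuous f t) -> is_CRInt f a b (CRInt f a b).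
Proof. move=> h; apply RInt_correct, ex_RInt_continuous => z _; apply h. Qed.

Lemma Cmod_RInt_le (f : R -> C) a b s M : a <= b -> (forall t, Cmod (f t) <= M) ->
  is_CRInt f a b s -> Cmod s <= (b - a) * M.
Proof.
  move=> ab h i; rewrite Cmod_norm.
  apply (norm_RInt_le_const (V := C_R_NormedModule) f a b s M ab) => // x _.
  have := h x; by rewrite Cmod_norm.
Qed.

Lemma CRInt_scal (c : C) (f : R -> C) a b s :
  is_CRInt f a b s -> is_CRInt (fun t => Cmult c (f t)) a b (Cmult c s).
Proof.
  move=> h.
  have h1 := is_RInt_fct_extend_fst (U := R_NormedModule) (V := R_NormedModule) f a b s h.
  have h2 := is_RInt_fct_extend_snd (U := R_NormedModule) (V := R_NormedModule) f a b s h.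
  apply (is_RInt_fct_extend_pair (U := R_NormedModule) (V := R_NormedModule)) => /=.
    apply (is_RInt_minus (V := R_NormedModule)); by apply (is_RInt_scal (V := R_NormedModule)).
  apply (is_RInt_plus (V := R_NormedModule)); by apply (is_RInt_scal (V := R_NormedModule)).
Qed.

(** [l0] depends only on the tail bound and not on [f] itself. A bound uniform in a parameter
    therefore gives one list for all parameter values, as in the Weierstrass test below. *)
Lemma usum_tail {I : Type} (f : I -> C) s l0 eps : is_usum f s ->
  (forall l, NoDup l -> (forall i, In i l -> ~ In i l0) -> rsum (fun i => Cmod (f i)) l <= eps) ->
  forall l, NoDup l -> incl l0 l -> Cmod (Cminus (lsum f l) s) <= eps.
Proof.
  move=> u tail l nd inc; apply le_epsilon => e e0.
  have [l1 h1] := u e e0.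
  pose rest := filter (fun i => if in_dec classic_eq_dec i l then false else true) (cnodup l1).
  have hr i : In i rest <-> In i l1 /\ ~ In i l.
    rewrite filter_In nodup_In; case: in_dec => h; split; try tauto; by case.
  have ndr : NoDup rest by apply NoDup_filter, NoDup_nodup.
  have := h1 (l ++ rest) _ _; rewrite lsum_app => h.
  have {}h : Cmod (Cminus (Cplus (lsum f l) (lsum f rest)) s) < e.
    apply h.
      apply NoDup_app => // x h2 h3; by case: (proj1 (hr x) h3).
    move=> x hx; apply in_or_app; case: (in_dec classic_eq_dec x l); first by left.
    by right; apply hr.
  have := tail rest ndr ltac:(move=> i /hr [_ h2] h3; apply h2; by apply inc).
  have := Cmod_lsum f rest.
  have -> : Cminus (lsum f l) s =
     Cplus (Cminus (Cplus (lsum f l) (lsum f rest)) s) (Copp (lsum f rest)) by ring.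
  have := Cmod_triangle (Cminus (Cplus (lsum f l) (lsum f rest)) s) (Copp (lsum f rest)).
  rewrite Cmod_opp; lra.
Qed.

Section UniformSums.
Context {I : Type} (f : I -> R -> C) (m : I -> R) (M : R) (F : R -> C).
Hypothesis fm : forall i t, Cmod (f i t) <= m i.
Hypothesis bm : bnd m M.
Hypothesis fc : forall i t, continuous (f i) t.
Hypothesis fF : forall t, is_usum (fun i => f i t) (F t).

Lemma usum_uniform eps : 0 < eps -> exists l0, forall l t, NoDup l -> incl l0 l ->
  Cmod (Cminus (lsum (fun i => f i t) l) (F t)) <= eps.
Proof.
  move=> e0.
  have m0 i : 0 <= m i by apply: Rle_trans (Cmod_ge_0 (f i 0)) (fm i 0).
  have [l0 h0] := bnd_tail m M eps m0 bm e0.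
  exists l0 => l t nd inc.
  apply (usum_tail _ _ l0) => // l' nd' dis.
  apply: Rle_trans (Rlt_le _ _ (h0 l' nd' dis)).
  by apply rsum_le => i _; apply fm.
Qed.

Lemma usum_continuous t : continuous F t.
Proof.
  apply ccont_eps => e e0.
  have [l0 h0] := usum_uniform (e / 3) ltac:(lra).
  have {}h0 s := h0 (cnodup l0) s (NoDup_nodup _ _) (incl_cnodup l0).
  have [d [d0 hd]] := proj2 (ccont_eps _ t) (ccont_lsum f (cnodup l0) t (fun i => fc i t))
    (e / 3) ltac:(lra).
  exists d; split => // s hs.
  have := hd s hs; have := h0 s; have := h0 t.
  set a := lsum _ _; set b := lsum _ _ => h1 h2 h3.
  have := Cmod_minus_triangle (F s) b (F t).
  have := Cmod_minus_triangle b a (F t).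
  rewrite (Cmod_minus_sym (F s) b); lra.
Qed.

Lemma CRInt_lsum l a b :
  is_CRInt (fun t => lsum (fun i => f i t) l) a b (lsum (fun i => CRInt (f i) a b) l).
Proof.
  elim: l => [|i l IH] /=.
    have := is_RInt_const (V := C_R_NormedModule) a b (RtoC 0).
    by rewrite scal_zero_r.
  apply (is_RInt_plus (V := C_R_NormedModule)) => //.
  by apply ccont_RInt.
Qed.

Lemma usum_RInt a b : a <= b -> is_usum (fun i => CRInt (f i) a b) (CRInt F a b).
Proof.
  move=> ab e e0.
  (* The summand 1 keeps the denominator positive when a = b. *)
  have p : 0 < b - a + 1 by lra.
  have [l0 h0] := usum_uniform (e / (b - a + 1)) ltac:(apply Rdiv_lt_0_compat; lra).
  exists l0 => l nd inc.
  have i1 := CRInt_lsum l a b.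
  have i2 := ccont_RInt F a b usum_continuous.
  have i3 := is_RInt_minus (V := C_R_NormedModule) _ _ a b _ _ i1 i2.
  have := Cmod_RInt_le _ a b _ _ ab (fun t => h0 l t nd inc) i3.
  have -> : (b - a) * (e / (b - a + 1)) = e - e / (b - a + 1) by field; lra.
  have : 0 < e / (b - a + 1) by apply Rdiv_lt_0_compat; lra.
  move=> h1 h2; apply: Rle_lt_trans h2 _; lra.
Qed.

End UniformSums.

(** * Fourier coefficients *)

Lemma cexp_IZR_0t k t : cexp (Cmult (RtoC (IZR k)) (0, t)) = (cos (IZR k * t), sin (IZR k * t)).
Proof.
  rewrite /cexp /Cmult /=.
  have -> : IZR k * 0 - 0 * t = 0 by ring.
  have -> : IZR k * t + 0 * 0 = IZR k * t by ring.
  rewrite exp_0; f_equal; ring.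
Qed.

Lemma sin_IZR_PI k : sin (IZR k * PI) = 0.
Proof. apply sin_eq_0_1; by exists k. Qed.

(** The starting point is free because Fourier coefficients are integrated over [-pi, pi] and the
    Szego integral over [0, 2 pi]. *)
Lemma is_CRInt_cexp k (kn : k <> 0%Z) a :
  is_CRInt (fun t => cexp (Cmult (RtoC (IZR k)) (0, t))) a (a + 2 * PI) (RtoC 0).
Proof.
  have kr : IZR k <> 0 by apply not_0_IZR.
  have per (g : R -> R) x : (g = sin \/ g = cos) -> g (IZR k * (x + 2 * PI)) = g (IZR k * x).
    have -> : IZR k * (x + 2 * PI) = IZR k * x + 2 * (IZR k * PI) by ring.
    have h1 := sin_IZR_PI k.
    have h2 : sin (2 * (IZR k * PI)) = 0 by rewrite sin_2a h1; ring.
    have h3 : cos (2 * (IZR k * PI)) = 1 by rewrite cos_2a_sin h1; ring.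
    case=> ->; rewrite ?sin_plus ?cos_plus h2 h3; ring.
  apply (is_RInt_ext (V := C_R_NormedModule) (fun t => (cos (IZR k * t), sin (IZR k * t)))).
    by move=> x _; rewrite cexp_IZR_0t.
  apply (is_RInt_fct_extend_pair (U := R_NormedModule) (V := R_NormedModule)) => /=.
  - have -> : 0 = minus (sin (IZR k * (a + 2 * PI)) / IZR k) (sin (IZR k * a) / IZR k).
      rewrite (per sin); [rewrite /minus /plus /opp /=; ring | by left].
    apply (is_RInt_derive (V := R_CompleteNormedModule) (fun t => sin (IZR k * t) / IZR k)) => x _.
      auto_derive => //; field => //.
    apply (ex_derive_continuous (V := R_NormedModule)); by auto_derive.
  - have -> : 0 = minus (- cos (IZR k * (a + 2 * PI)) / IZR k) (- cos (IZR k * a) / IZR k).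
      rewrite (per cos); [rewrite /minus /plus /opp /=; field => // | by right].
    apply (is_RInt_derive (V := R_CompleteNormedModule) (fun t => - cos (IZR k * t) / IZR k)) => x _.
      auto_derive => //; field => //.
    apply (ex_derive_continuous (V := R_NormedModule)); by auto_derive.
Qed.

Lemma CRInt_const (c : C) a b : is_CRInt (fun _ => c) a b (Cmult (RtoC (b - a)) c).
Proof.
  have := is_RInt_const (V := C_R_NormedModule) a b c.
  rewrite scal_R_Cmult; exact.
Qed.

Lemma ccont_trig (x t : R) : continuous (fun t : R => cexp (Cmult (RtoC x) (0, t))) t.
Proof.
  apply ccont_cexp, ccont_mult; first by apply ccont_const.
  apply ccont_pair => /=; [apply continuous_const | apply continuous_id].
Qed.

Lemma usum_trig_continuous (c : Z -> C) M (g : R -> C) :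
  bnd (fun j => Cmod (c j)) M ->
  (forall t, is_usum (fun j => Cmult (c j) (cexp (Cmult (RtoC (IZR j)) (0, t)))) (g t)) ->
  forall t, continuous g t.
Proof.
  move=> b u.
  apply (usum_continuous (fun j t => Cmult (c j) (cexp (Cmult (RtoC (IZR j)) (0, t))))
    (fun j => Cmod (c j)) M) => //.
    move=> j t; rewrite Cmod_mult Cmod_cexp /=.
    have -> : IZR j * 0 - 0 * t = 0 by ring.
    rewrite exp_0; lra.
  move=> j t; apply ccont_mult; first by apply ccont_const.
  apply ccont_trig.
Qed.

Lemma trig_RInt (c : Z -> C) M (g : R -> C) j a :
  bnd (fun j => Cmod (c j)) M ->
  (forall t, is_usum (fun j => Cmult (c j) (cexp (Cmult (RtoC (IZR j)) (0, t)))) (g t)) ->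
  CRInt (fun t => Cmult (cexp (Cmult (RtoC (IZR j)) (0, t))) (g t)) a (a + 2 * PI) =
  Cmult (RtoC (2 * PI)) (c (- j)%Z).
Proof.
  move=> b u.
  pose F i t := Cmult (c i) (cexp (Cmult (RtoC (IZR (i + j))) (0, t))).
  have Fu t : is_usum (fun i => F i t) (Cmult (cexp (Cmult (RtoC (IZR j)) (0, t))) (g t)).
    apply: usum_ext (usum_scal _ _ _ (u t)) => i.
    rewrite /F plus_IZR.
    have -> : Cmult (RtoC (IZR i + IZR j)) (0, t) =
      Cplus (Cmult (RtoC (IZR i)) (0, t)) (Cmult (RtoC (IZR j)) (0, t)) by rewrite RtoC_plus; ring.
    rewrite cexp_add; ring.
  have P := PI_RGT_0.
  have int := usum_RInt F (fun j => Cmod (c j)) M _ _ b _ Fu a (a + 2 * PI) ltac:(lra).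
  have {}int : is_usum (fun i => CRInt (F i) a (a + 2 * PI))
     (CRInt (fun t => Cmult (cexp (Cmult (RtoC (IZR j)) (0, t))) (g t)) a (a + 2 * PI)).
    apply int.
      move=> i t; rewrite Cmod_mult Cmod_cexp /=.
      have -> : IZR (i + j) * 0 - 0 * t = 0 by ring.
      rewrite exp_0; lra.
    move=> i t; apply ccont_mult; first by apply ccont_const.
    apply ccont_trig.
  have v : is_usum (fun i => CRInt (F i) a (a + 2 * PI)) (CRInt (F (- j)%Z) a (a + 2 * PI)).
    apply (usum_single (fun i => CRInt (F i) a (a + 2 * PI))) => i ij.
    apply (is_RInt_unique (V := C_R_CompleteNormedModule)).
    have h := CRInt_scal (c i) _ _ _ _ (is_CRInt_cexp (i + j) ltac:(lia) a).
    by rewrite Cmult_0_r in h.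
  rewrite (usum_unique _ _ _ int v).
  have h := CRInt_const (c (- j)%Z) a (a + 2 * PI).
  rewrite (is_RInt_unique (V := C_R_CompleteNormedModule) _ _ _ _ (is_RInt_ext _ (F (- j)%Z) _ _ _ _ h)).
    by f_equal; f_equal; ring.
  move=> x _; rewrite /F Z.add_opp_diag_l Cmult_0_l cexp_0 Cmult_1_r; reflexivity.
Qed.

Lemma fourier_usum (c : Z -> C) M (g : R -> C) k :
  bnd (fun j => Cmod (c j)) M ->
  (forall t, is_usum (fun j => Cmult (c j) (cexp (Cmult (RtoC (IZR j)) (0, t)))) (g t)) ->
  fourier g k = c k.
Proof.
  move=> b u; have P := PI_RGT_0.
  have := trig_RInt c M g (- k) (- PI) b u.
  have -> : - PI + 2 * PI = PI by ring.
  rewrite Z.opp_involutive /fourier => h.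
  have -> : CRInt (fun t => Cmult (Cpowz (cis t) (- k)) (g t)) (- PI) PI =
            CRInt (fun t => Cmult (cexp (Cmult (RtoC (IZR (- k))) (0, t))) (g t)) (- PI) PI.
    apply (RInt_ext (V := C_R_CompleteNormedModule)) => t _; by rewrite cis_cexp Cpowz_cexp.
  rewrite h Cmult_assoc -RtoC_mult Rinv_l; [ring | lra].
Qed.

(** * The Wiener algebra of a weight in the logarithmic coordinate *)

Definition ez (j : Z) (u : C) : C := cexp (Cmult (RtoC (IZR j)) u).

(** Where |z^j| is at most the weight, every series of finite weighted norm converges absolutely.
    For a Beurling weight this set is the closed strip over the annulus, by [A_nu_spec]. *)
Definition dom (om : Z -> R) (u : C) : Prop := forall j, exp (IZR j * fst u) <= om j.

(* Functions of the logarithmic coordinate [u], [z = cexp u]; [M] bounds the norm. *)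
Definition Wiener (om : Z -> R) (S : Z -> Prop) (f : C -> C) (M : R) : Prop :=
  exists c : Z -> C,
    (forall j, ~ S j -> c j = RtoC 0) /\
    bnd (fun j => om j * Cmod (c j)) M /\
    forall u, dom om u -> is_usum (fun j => Cmult (c j) (ez j u)) (f u).

(** Spectra stable under multiplication. The instances are all frequencies, the nonnegative and the
    nonpositive ones, so one theory serves the algebra and its two analytic halves. *)
Definition submonoid (S : Z -> Prop) : Prop :=
  S 0%Z /\ forall i j, S i -> S j -> S (i + j)%Z.

Definition coef (f : C -> C) (j : Z) : C := fourier (fun t => f (0, t)) j.

Lemma fst_RtoC_mult x u : fst (Cmult (RtoC x) u) = x * fst u.
Proof. rewrite /=; ring. Qed.

Lemma Cmod_ez j u : Cmod (ez j u) = exp (IZR j * fst u).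
Proof. by rewrite Cmod_cexp fst_RtoC_mult. Qed.

Lemma ez_add i j u : ez (i + j) u = Cmult (ez i u) (ez j u).
Proof. rewrite /ez -cexp_add plus_IZR RtoC_plus; f_equal; ring. Qed.

Lemma ez_0 u : ez 0 u = RtoC 1.
Proof. by rewrite /ez Cmult_0_l cexp_0. Qed.

Lemma usum_swap {I J : Type} (F : I * J -> C) s :
  is_usum F s -> is_usum (fun p : J * I => F (snd p, fst p)) s.
Proof.
  apply (usum_reindex (fun p : J * I => (snd p, fst p)) F).
    by move=> [a b] [a' b'] /= [-> ->].
  move=> [a b] h; by case: (h (b, a)).
Qed.

Lemma bnd_swap {I J : Type} (F : I * J -> R) s :
  bnd F s -> bnd (fun p : J * I => F (snd p, fst p)) s.
Proof.
  apply (bnd_inj (fun p : J * I => (snd p, fst p)) F).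
  by move=> [a b] [a' b'] /= [-> ->].
Qed.

Lemma bnd_mult {I J : Type} (f : I -> R) (g : J -> R) M N :
  (forall i, 0 <= f i) -> (forall j, 0 <= g j) -> bnd f M -> bnd g N ->
  bnd (fun p : I * J => f (fst p) * g (snd p)) (M * N).
Proof.
  move=> f0 g0 bf bg.
  apply (bnd_prod _ (fun i => f i * N)) => /=.
  - move=> p; by apply Rmult_le_pos.
  - move=> i; by apply bnd_scal.
  - rewrite Rmult_comm; apply: bnd_le (bnd_scal _ _ N (bnd_ge0 _ _ bg) bf) => i; lra.
Qed.

(* The pair [(k, j - k)] is listed as [(j, k)], so that summing over the second component
   first gives the convolution. *)
Lemma usum_conv (a b : Z -> C) A B x y :
  bnd (fun j => Cmod (a j)) A -> bnd (fun j => Cmod (b j)) B ->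
  is_usum a x -> is_usum b y ->
  is_usum (fun p : Z * Z => Cmult (a (snd p)) (b (fst p - snd p)%Z)) (Cmult x y).
Proof.
  move=> ba bb ua ub.
  pose F (p : Z * Z) := Cmult (a (fst p)) (b (snd p)).
  have bF : bnd (fun p => Cmod (F p)) (A * B).
    apply: bnd_le (bnd_mult _ _ _ _ (fun i => Cmod_ge_0 (a i)) (fun i => Cmod_ge_0 (b i)) ba bb) => p.
    rewrite /F Cmod_mult; lra.
  have [s us] := usum_exists F (ex_intro _ _ bF).
  have E : Cmult x y = s.
    apply (usum_unique (fun i => Cmult (a i) y)).
      rewrite Cmult_comm; apply: usum_ext (usum_scal y _ _ ua) => i; ring.
    apply (fubini F) => // i; exact: (usum_scal (a i) _ _ ub).
  rewrite E.
  apply (usum_reindex (fun p : Z * Z => (snd p, (fst p - snd p)%Z)) F) => //.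
    move=> [i j] [i' j'] /= [e1 e2]; f_equal; lia.
  move=> [i j] h; case: (h ((i + j)%Z, i)) => /=; f_equal; lia.
Qed.

Lemma bnd_conv (a b : Z -> R) A B :
  (forall i, 0 <= a i) -> (forall i, 0 <= b i) -> bnd a A -> bnd b B ->
  bnd (fun p : Z * Z => a (snd p) * b (fst p - snd p)%Z) (A * B).
Proof.
  move=> a0 b0 ba bb.
  apply (bnd_inj (fun p : Z * Z => (snd p, (fst p - snd p)%Z)) (fun p => a (fst p) * b (snd p))).
    move=> [i j] [i' j'] /= [e1 e2]; f_equal; lia.
  by apply bnd_mult.
Qed.

Section WienerAlgebra.
Context (om : Z -> R) (Hom : beurling_weight om) (S : Z -> Prop) (HS : submonoid S).

Lemma om_ge1 j : 1 <= om j.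
Proof. apply Hom. Qed.

Lemma dom_circle t : dom om (0, t).
Proof. move=> j /=; rewrite Rmult_0_r exp_0; apply om_ge1. Qed.

Lemma Wiener_l1 c M : bnd (fun j => om j * Cmod (c j)) M -> bnd (fun j : Z => Cmod (c j)) M.
Proof.
  apply bnd_le => j; have := om_ge1 j; have := Cmod_ge_0 (c j); nra.
Qed.

Lemma Wiener_term_le c u j : dom om u -> Cmod (Cmult (c j) (ez j u)) <= om j * Cmod (c j).
Proof.
  move=> d; rewrite Cmod_mult Cmod_ez; have := d j; have := Cmod_ge_0 (c j); nra.
Qed.

(** The coefficients hidden in [Wiener] are forced: the circle lies in [dom om], and termwise
    integration there identifies them with [coef f]. *)
Lemma Wiener_coef f M : Wiener om S f M ->
  (forall j, ~ S j -> coef f j = RtoC 0) /\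
  bnd (fun j => om j * Cmod (coef f j)) M /\
  forall u, dom om u -> is_usum (fun j => Cmult (coef f j) (ez j u)) (f u).
Proof.
  move=> [c [h1 [h2 h3]]].
  have E j : coef f j = c j.
    apply (fourier_usum c M) => [|t]; first exact: Wiener_l1.
    apply (h3 (0, t)), dom_circle.
  split; [|split].
  - move=> j hj; rewrite E; auto.
  - apply: bnd_le h2 => j; rewrite E; lra.
  - move=> u d; apply: usum_ext (h3 u d) => j; by rewrite E.
Qed.

Lemma Wiener_continuous f M t : Wiener om S f M -> continuous (fun t => f (0, t)) t.
Proof.
  move=> [c [h1 [h2 h3]]]; apply (usum_trig_continuous c M); first exact: Wiener_l1.
  move=> s; apply (h3 (0, s)), dom_circle.
Qed.

Lemma Wiener_sup f M u : Wiener om S f M -> dom om u -> Cmod (f u) <= M.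
Proof.
  move=> [c [h1 [h2 h3]]] d.
  apply (usum_bound (fun j => Cmult (c j) (ez j u))); last by apply h3.
  apply: bnd_le h2 => j; by apply Wiener_term_le.
Qed.

Lemma Wiener_ge0 f M : Wiener om S f M -> 0 <= M.
Proof. move=> [c [h1 [h2 h3]]]; exact: bnd_ge0 h2. Qed.

Lemma Wiener_ext f g M : (forall u, dom om u -> f u = g u) -> Wiener om S f M -> Wiener om S g M.
Proof.
  move=> E [c [h1 [h2 h3]]]; exists c; split => //; split => // u d.
  rewrite -E //; by apply h3.
Qed.

Lemma Wiener_le f M M' : M <= M' -> Wiener om S f M -> Wiener om S f M'.
Proof.
  move=> h [c [h1 [h2 h3]]]; exists c; split => //; split => //; exact: bnd_le_r h h2.
Qed.

Lemma Wiener_monom k : S k -> Wiener om S (ez k) (om k).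
Proof.
  move=> Sk; exists (fun j => if Z.eq_dec j k then RtoC 1 else RtoC 0); split; [|split].
  - move=> j hj; case: Z.eq_dec => // e; by subst.
  - move=> l nd.
    pose g j := om j * Cmod (if Z.eq_dec j k then RtoC 1 else RtoC 0).
    have g0 j : 0 <= g j by apply Rmult_le_pos; [have := om_ge1 j; lra | apply Cmod_ge_0].
    move: l nd; apply (bnd_extend (fun _ : unit => k) g).
      move=> i hi; rewrite /g; case: Z.eq_dec => e; last by rewrite Cmod_0; ring.
      by case: (hi tt).
    move=> l' nd'; apply (Rle_trans _ (rsum (fun j => g k) (tt :: nil))).
      apply rsum_incl => // -[_]; by left.
    rewrite /= /g; case: Z.eq_dec => // _; rewrite Cmod_1; lra.
  - move=> u d.
    have := usum_single (fun j => Cmult (if Z.eq_dec j k then RtoC 1 else RtoC 0) (ez j u)) k _.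
    case: (Z.eq_dec k k) => // _; rewrite Cmult_1_l; apply.
    move=> i ik; case: Z.eq_dec => // _; ring.
Qed.

Lemma Wiener_scal k f M : Wiener om S f M -> Wiener om S (fun u => Cmult k (f u)) (Cmod k * M).
Proof.
  move=> [c [h1 [h2 h3]]]; exists (fun j => Cmult k (c j)); split; [|split].
  - move=> j hj; rewrite h1 //; ring.
  - apply: bnd_le (bnd_scal _ _ _ (Cmod_ge_0 k) h2) => j; rewrite Cmod_mult; lra.
  - move=> u d; apply: usum_ext (usum_scal k _ _ (h3 u d)) => j; ring.
Qed.

Lemma Wiener_const k : Wiener om S (fun _ => k) (Cmod k * om 0%Z).
Proof.
  apply: Wiener_ext (Wiener_scal k _ _ (Wiener_monom 0 (proj1 HS))) => u _.
  rewrite ez_0; ring.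
Qed.

Lemma Wiener_plus f g M N : Wiener om S f M -> Wiener om S g N ->
  Wiener om S (fun u => Cplus (f u) (g u)) (M + N).
Proof.
  move=> [c [h1 [h2 h3]]] [c' [h1' [h2' h3']]].
  exists (fun j => Cplus (c j) (c' j)); split; [|split].
  - move=> j hj; rewrite h1 // h1' //; ring.
  - apply: bnd_le (bnd_plus _ _ _ _ h2 h2') => j.
    have := Cmod_triangle (c j) (c' j); have := om_ge1 j; nra.
  - move=> u d; apply: usum_ext (usum_plus _ _ _ _ (h3 u d) (h3' u d)) => j; ring.
Qed.

(** Submultiplicativity bounds om_j |a_k b_(j-k)| by om_k |a_k| om_(j-k) |b_(j-k)|, which is
    summable over pairs. [fubini_bnd] then gives the norm of the convolution, and [fubini] at each u
    gives its value. *)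
Lemma Wiener_mult_coef f g M N : Wiener om S f M -> Wiener om S g N ->
  exists d, (forall j, is_usum (fun k => Cmult (coef f k) (coef g (j - k))) (d j)) /\
   (forall j, ~ S j -> d j = RtoC 0) /\ bnd (fun j => om j * Cmod (d j)) (M * N) /\
   forall u, dom om u -> is_usum (fun j => Cmult (d j) (ez j u)) (Cmult (f u) (g u)).
Proof.
  move=> /Wiener_coef [h1 [h2 h3]] /Wiener_coef [h1' [h2' h3']].
  set a := coef f in h1 h2 h3 *; set b := coef g in h1' h2' h3' *.
  have ba := Wiener_l1 _ _ h2; have bb := Wiener_l1 _ _ h2'.
  have om0 j : 0 <= om j by have := om_ge1 j; lra.
  have p0 (c : Z -> C) j : 0 <= om j * Cmod (c j).
    apply Rmult_le_pos => //; apply Cmod_ge_0.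
  have bp : bnd (fun p : Z * Z => om (fst p) * Cmod (Cmult (a (snd p)) (b (fst p - snd p)%Z))) (M * N).
    apply: bnd_le (bnd_conv _ _ _ _ (p0 a) (p0 b) h2 h2') => -[i j] /=.
    rewrite Cmod_mult.
    have /Rmult_le_compat_r := proj2 (proj2 Hom) j (i - j)%Z.
    have -> : (j + (i - j) = i)%Z by lia.
    move/(_ (Cmod (a j) * Cmod (b (i - j)%Z)) ltac:(apply Rmult_le_pos; apply Cmod_ge_0)).
    lra.
  have bp1 := bnd_conv _ _ _ _ (fun i => Cmod_ge_0 (a i)) (fun i => Cmod_ge_0 (b i)) ba bb.
  have ex j : exists s, is_usum (fun k => Cmult (a k) (b (j - k)%Z)) s.
    apply usum_exists; exists (M * N).
    apply: bnd_le (bnd_row _ _ j bp1) => k /=; rewrite Cmod_mult; lra.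
  pose d j := proj1_sig (constructive_indefinite_description _ (ex j)).
  exists d.
  have hd j : is_usum (fun k => Cmult (a k) (b (j - k)%Z)) (d j).
    exact: (proj2_sig (constructive_indefinite_description _ (ex j))).
  split => //; split; [|split].
  - move=> j hj; apply (usum_unique _ _ _ (hd j)).
    apply (usum_ext (fun _ => RtoC 0)); last by apply (usum_single (fun _ : Z => RtoC 0) 0%Z).
    move=> k; case: (classic (S k)) => hk; last by rewrite h1 //; ring.
    case: (classic (S (j - k)%Z)) => hk'; last by rewrite h1' //; ring.
    case: hj; have -> : (j = k + (j - k))%Z by lia. by apply HS.
  - exact: (fubini_bnd _ d om _ om0 bp hd).
  - move=> u du.
    have b1 (c : Z -> C) K : bnd (fun j => om j * Cmod (c j)) K ->
       bnd (fun j => Cmod (Cmult (c j) (ez j u))) K.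
      apply bnd_le => j; by apply Wiener_term_le.
    have := usum_conv _ _ _ _ _ _ (b1 _ _ h2) (b1 _ _ h2') (h3 u du) (h3' u du).
    move/fubini; apply => j /=.
    have := usum_scal (ez j u) _ _ (hd j).
    rewrite Cmult_comm; apply usum_ext => k.
    have -> : ez j u = Cmult (ez k u) (ez (j - k) u) by rewrite -ez_add; f_equal; lia.
    ring.
Qed.

Lemma Wiener_mult f g M N : Wiener om S f M -> Wiener om S g N ->
  Wiener om S (fun u => Cmult (f u) (g u)) (M * N).
Proof.
  move=> hf hg; have [d [_ h]] := Wiener_mult_coef f g M N hf hg; by exists d.
Qed.

Lemma coef_mult f g M N j : Wiener om S f M -> Wiener om S g N ->
  is_usum (fun k => Cmult (coef f k) (coef g (j - k)))
    (coef (fun u => Cmult (f u) (g u)) j).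
Proof.
  move=> hf hg; have [d [h1 [_ [h2 h3]]]] := Wiener_mult_coef f g M N hf hg.
  have -> : coef (fun u => Cmult (f u) (g u)) j = d j; last exact: (h1 j).
  apply (fourier_usum d (M * N)) => [|t]; first exact: Wiener_l1 h2.
  apply (h3 (0, t)), dom_circle.
Qed.

(** The factor [om 0] is the norm of the constant 1, which may exceed 1 for a Beurling weight. *)
Lemma Wiener_pow f M n : Wiener om S f M -> Wiener om S (fun u => pow_n (f u) n) (om 0%Z * M ^ n).
Proof.
  move=> hf; elim: n => [|n IH].
    apply: Wiener_le (Wiener_const (RtoC 1)); rewrite Cmod_1 /=; lra.
  apply (Wiener_le _ (M * (om 0%Z * M ^ n))); first by rewrite /=; lra.
  exact: Wiener_mult hf IH.
Qed.

(** Completeness of the algebra for absolutely convergent series: the weighted coefficients form a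
    summable family over pairs (k, j), and summing over k first gives the coefficients of the
    limit. *)
Lemma Wiener_series (f : nat -> C -> C) (M : nat -> R) T (F : C -> C) :
  (forall k, Wiener om S (f k) (M k)) -> bnd M T ->
  (forall u, dom om u -> is_usum (fun k => f k u) (F u)) ->
  Wiener om S F T /\ forall j, is_usum (fun k => coef (f k) j) (coef F j).
Proof.
  move=> hf bM hF.
  pose c k := coef (f k).
  have hc k := Wiener_coef _ _ (hf k).
  have om0 j : 0 <= om j by have := om_ge1 j; lra.
  have bp : bnd (fun p : nat * Z => om (snd p) * Cmod (c (fst p) (snd p))) T.
    apply (bnd_prod _ M) => //=.
      move=> p; apply Rmult_le_pos => //; apply Cmod_ge_0.
    move=> k; apply hc.
  have bp' : bnd (fun p : Z * nat => om (fst p) * Cmod (c (snd p) (fst p))) T.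
    exact: (bnd_swap _ _ bp).
  have ex j : exists s, is_usum (fun k => c k j) s.
    apply usum_exists; exists T.
    apply: bnd_le (bnd_row _ _ j bp') => k /=.
    have := om_ge1 j; have := Cmod_ge_0 (c k j); nra.
  pose d j := proj1_sig (constructive_indefinite_description _ (ex j)).
  have hd j : is_usum (fun k => c k j) (d j).
    exact: (proj2_sig (constructive_indefinite_description _ (ex j))).
  have bd := fubini_bnd (fun p : Z * nat => c (snd p) (fst p)) d om _ om0 bp' hd.
  have ud u : dom om u -> is_usum (fun j => Cmult (d j) (ez j u)) (F u).
    move=> du.
    pose G (p : nat * Z) := Cmult (c (fst p) (snd p)) (ez (snd p) u).
    have bG : bnd (fun p => Cmod (G p)) T.
      apply: bnd_le bp => -[k j]; by apply Wiener_term_le.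
    have [s us] := usum_exists G (ex_intro _ _ bG).
    have -> : F u = s.
      apply (usum_unique _ _ _ (hF u du)).
      apply (fubini G _ _ us) => k; exact: (proj2 (proj2 (hc k)) u du).
    apply (fubini _ _ _ (usum_swap _ _ us)) => j /=.
    rewrite Cmult_comm; apply: usum_ext (usum_scal (ez j u) _ _ (hd j)) => k.
    rewrite /G /=; ring.
  split; last first.
    move=> j; have -> : coef F j = d j; last exact: hd.
    apply (fourier_usum d T) => [|t]; first exact: Wiener_l1 bd.
    apply (ud (0, t)), dom_circle.
  exists d; split; [|split => //].
  - move=> j hj; apply (usum_unique _ _ _ (hd j)).
    apply (usum_ext (fun _ => RtoC 0)); last by apply (usum_single (fun _ : nat => RtoC 0) 0%nat).
    move=> k; symmetry; by apply hc.
Qed.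

End WienerAlgebra.

Lemma Wiener_support om (S S' : Z -> Prop) f M :
  (forall j, S j -> S' j) -> Wiener om S f M -> Wiener om S' f M.
Proof.
  move=> h [c [h1 h2]]; exists c; split => // j hj; apply h1 => hs; apply hj; auto.
Qed.

(** * The exponential and logarithmic series *)

Definition cder (f : R -> C) (t : R) (l : C) : Prop :=
  is_derive (fun s => fst (f s)) t (fst l) /\ is_derive (fun s => snd (f s)) t (snd l).

Lemma is_derive_Rmult (p q : R -> R) t x y : is_derive p t x -> is_derive q t y ->
  is_derive (fun s => p s * q s) t (x * q t + p t * y).
Proof. move=> hp hq; apply (is_derive_mult (K := R_AbsRing)) => //; exact Rmult_comm. Qed.

Lemma cder_mult f g t a b :
  cder f t a -> cder g t b ->
  cder (fun s => Cmult (f s) (g s)) t (Cplus (Cmult a (g t)) (Cmult (f t) b)).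
Proof.
  move=> [f1 f2] [g1 g2].
  split => /=.
    have := is_derive_minus (V := R_NormedModule) _ _ _ _ _ (is_derive_Rmult _ _ _ _ _ f1 g1) (is_derive_Rmult _ _ _ _ _ f2 g2).
    rewrite /minus /plus /opp /=.
    move=> h; evar_last; [exact h | ring].
  have := is_derive_plus (V := R_NormedModule) _ _ _ _ _ (is_derive_Rmult _ _ _ _ _ f1 g2) (is_derive_Rmult _ _ _ _ _ f2 g1).
  rewrite /plus /=.
  move=> h; evar_last; [exact h | ring].
Qed.

Lemma cder_cexp f t a : cder f t a -> cder (fun s => cexp (f s)) t (Cmult a (cexp (f t))).
Proof.
  move=> [f1 f2].
  have e := is_derive_comp exp _ _ _ _ (is_derive_exp _) f1.
  have c := is_derive_comp cos _ _ _ _ (is_derive_cos _) f2.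
  have s := is_derive_comp sin _ _ _ _ (is_derive_sin _) f2.
  split => /=.
    have := is_derive_Rmult _ _ _ _ _ e c; rewrite /scal /= /mult /= => h; evar_last; [exact h | ring].
  have := is_derive_Rmult _ _ _ _ _ e s; rewrite /scal /= /mult /= => h; evar_last; [exact h | ring].
Qed.

Lemma cder_line (c d : C) t : cder (fun s => Cplus c (Cmult (RtoC s) d)) t d.
Proof. split; rewrite /=; auto_derive => //; ring. Qed.

Lemma cder_ext f g t a : (forall s, f s = g s) -> cder f t a -> cder g t a.
Proof.
  move=> E [h1 h2]; split.
    apply: is_derive_ext h1 => s; by rewrite E.
  apply: is_derive_ext h2 => s; by rewrite E.
Qed.

Lemma cder_eq0 f : (forall t, 0 <= t <= 1 -> cder f t (RtoC 0)) -> f 0 = f 1.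
Proof.
  move=> h.
  have e1 := eq_is_derive (V := R_NormedModule) (fun s => fst (f s)) 0 1 (fun t ht => proj1 (h t ht)) ltac:(lra).
  have e2 := eq_is_derive (V := R_NormedModule) (fun s => snd (f s)) 0 1 (fun t ht => proj2 (h t ht)) ltac:(lra).
  move: e1 e2; case: (f 0) (f 1) => [a b] [a' b'] /= -> ->; done.
Qed.

Lemma sum_n_pair (f : nat -> C) n :
  sum_n (f : nat -> C_R_CompleteNormedModule) n =
  (sum_n (fun k => fst (f k)) n, sum_n (fun k => snd (f k)) n).
Proof.
  elim: n => [|n IH]; first by rewrite !sum_O; case: (f 0%nat).
  by rewrite !sum_Sn IH.
Qed.

Lemma usum_components (f : nat -> C) s : is_usum f s ->
  is_series (fun k => fst (f k)) (fst s) /\ is_series (fun k => snd (f k)) (snd s).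
Proof.
  move=> /usum_is_series h.
  split.
    apply (filterlim_ext (fun n => fst (sum_n (f : nat -> C_R_CompleteNormedModule) n))).
      by move=> n; rewrite sum_n_pair.
    apply: filterlim_comp h _; case: s => x y; apply continuous_fst.
  apply (filterlim_ext (fun n => snd (sum_n (f : nat -> C_R_CompleteNormedModule) n))).
    by move=> n; rewrite sum_n_pair.
  apply: filterlim_comp h _; case: s => x y; apply continuous_snd.
Qed.

Lemma snd_RtoC_mult x u : snd (Cmult (RtoC x) u) = x * snd u.
Proof. rewrite /=; ring. Qed.

(** The exponential and logarithmic series are followed along the real segment from 0 to the given
    point. Real power series, one for each component, then suffice for differentiation. *)
Definition CPSeries (a : nat -> C) (s : R) : C :=
  (PSeries (fun k => fst (a k)) s, PSeries (fun k => snd (a k)) s).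

Lemma CPSeries_usum (a : nat -> C) s S :
  is_usum (fun k => Cmult (RtoC (s ^ k)) (a k)) S -> CPSeries a s = S.
Proof.
  move=> /usum_components [h1 h2].
  rewrite /CPSeries (surjective_pairing S); f_equal; apply is_pseries_unique, is_pseries_R.
    apply: is_series_ext h1 => n /=; ring.
  apply: is_series_ext h2 => n /=; ring.
Qed.

Lemma CV_radius_ge (a : nat -> R) r : CV_disk a r -> Rbar_le r (CV_radius a).
Proof. move=> h; exact: (proj1 (Lub_Rbar_correct (CV_disk a)) r h). Qed.

(** A radius above 1 puts the whole closed segment [0, 1] inside the disc of convergence. *)
Lemma CPSeries_der (a : nat -> C) r M t : 1 < r -> bnd (fun k => Cmod (a k) * r ^ k) M ->
  0 <= t <= 1 ->
  cder (CPSeries a) t (CPSeries (fun k => Cmult (RtoC (INR (S k))) (a (S k))) t).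
Proof.
  move=> r1 b ht.
  have rk k : 0 <= r ^ k by apply pow_le; lra.
  have D (p : C -> R) : (forall z, Rabs (p z) <= Cmod z) ->
    is_derive (PSeries (fun k => p (a k))) t (PSeries (PS_derive (fun k => p (a k))) t).
    move=> hp; apply is_derive_PSeries.
    apply (Rbar_lt_le_trans _ r); first by rewrite /= Rabs_right; lra.
    apply CV_radius_ge, (bnd_ex_series _ M) => [k|]; first by apply Rabs_pos.
    apply: bnd_le b => k; rewrite Rabs_mult (Rabs_right (r ^ k)); last by apply Rle_ge.
    by apply Rmult_le_compat_r.
  have hm z := Rmax_Cmod z.
  split.
    evar_last; first by apply (D fst) => z; apply: Rle_trans (hm z); apply Rmax_l.
    apply PSeries_ext => n; rewrite /PS_derive; rewrite fst_RtoC_mult; done.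
  evar_last; first by apply (D snd) => z; apply: Rle_trans (hm z); apply Rmax_r.
  apply PSeries_ext => n; rewrite /PS_derive; rewrite snd_RtoC_mult; done.
Qed.

Lemma bnd_geom q : 0 <= q < 1 -> bnd (fun k : nat => q ^ k) (/ (1 - q)).
Proof.
  move=> hq; apply is_series_bnd => [n|]; first by apply pow_le; lra.
  apply is_series_geom; rewrite Rabs_right; lra.
Qed.

Lemma bnd_exp x : 0 <= x -> bnd (fun k : nat => x ^ k / INR (fact k)) (exp x).
Proof.
  move=> hx; apply is_series_bnd => [n|].
    apply Rmult_le_pos; first by apply pow_le.
    apply Rlt_le, Rinv_0_lt_compat, INR_fact_lt_0.
  have := is_exp_Reals x; move/is_pseries_R; apply is_series_ext => n /=.
  rewrite /Rdiv; ring.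
Qed.

Lemma pow_n_S (z : C) k : pow_n z (S k) = Cmult z (pow_n z k).
Proof. done. Qed.

Lemma Cmod_pow_n (z : C) k : Cmod (pow_n z k) = Cmod z ^ k.
Proof. elim: k => [|k IH]; [exact: Cmod_1 | by rewrite pow_n_S Cmod_mult IH]. Qed.

Lemma usum_shift (f : nat -> C) s :
  is_usum f s -> is_usum (fun k => f (S k)) (Cminus s (f 0%nat)).
Proof.
  move=> u.
  pose d k := match k with O => Copp (f 0%nat) | S _ => RtoC 0 end.
  have ud : is_usum d (d 0%nat) by apply usum_single; case.
  have v := usum_reindex S _ _ (fun x y e => eq_add_S x y e) _ (usum_plus _ _ _ _ u ud).
  apply: usum_ext (v _) => [k|[|i] h]; rewrite /d.
  - ring.
  - ring.
  - by case: (h i).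
Qed.

Lemma geom_series (q : C) : Cmod q < 1 -> exists S,
  is_usum (fun k => pow_n q k) S /\ Cmult S (Cminus 1 q) = RtoC 1.
Proof.
  move=> hq; have q0 := Cmod_ge_0 q.
  have [S hS] : exists S, is_usum (fun k => pow_n q k) S.
    apply usum_exists; exists (/ (1 - Cmod q)).
    apply: bnd_le (bnd_geom (Cmod q) _) => [k|]; last by split.
    rewrite Cmod_pow_n; lra.
  exists S; split => //.
  have := usum_unique _ _ _ (usum_shift _ _ hS) (usum_scal q _ _ hS).
  rewrite -[pow_n q 0]/(RtoC 1) => e.
  have -> : Cmult S (Cminus 1 q) = Cminus S (Cmult q S) by ring.
  rewrite -e; ring.
Qed.

(** F(s) = sum s^k z^k / k! satisfies F' = z F, so cexp (- s z) F(s) is constant on [0, 1]. Compare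
    s = 0 with s = 1. *)
Lemma exp_series (z : C) :
  is_usum (fun k => Cmult (RtoC (/ INR (fact k))) (pow_n z k)) (cexp z).
Proof.
  pose a k := Cmult (RtoC (/ INR (fact k))) (pow_n z k).
  have fp k : 0 < / INR (fact k) by apply Rinv_0_lt_compat, INR_fact_lt_0.
  have ma k : Cmod (a k) = Cmod z ^ k / INR (fact k).
    rewrite Cmod_mult Cmod_R Cmod_pow_n Rabs_right; [rewrite /Rdiv; ring | by apply Rle_ge, Rlt_le].
  have sm s : 0 <= s <= 2 -> bnd (fun k => Cmod (a k) * s ^ k) (exp (s * Cmod z)).
    move=> hs.
    apply: bnd_le (bnd_exp (s * Cmod z) _) => [k|]; last by apply Rmult_le_pos; [lra | apply Cmod_ge_0].
    rewrite ma Rpow_mult_distr; right; rewrite /Rdiv; ring.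
  have us s : 0 <= s <= 2 -> is_usum (fun k => Cmult (RtoC (s ^ k)) (a k)) (CPSeries a s).
    move=> hs.
    have [S hS] : exists S, is_usum (fun k => Cmult (RtoC (s ^ k)) (a k)) S.
      apply usum_exists; exists (exp (s * Cmod z)); apply: bnd_le (sm s hs) => k.
      rewrite Cmod_mult Cmod_R Rabs_right; [lra | apply Rle_ge, pow_le; lra].
    by rewrite (CPSeries_usum _ _ _ hS).
  have d t : 0 <= t <= 1 -> cder (CPSeries a) t (Cmult z (CPSeries a t)).
    move=> ht.
    have -> : Cmult z (CPSeries a t) = CPSeries (fun k => Cmult (RtoC (INR (S k))) (a (S k))) t.
      symmetry; apply CPSeries_usum.
      apply: usum_ext (usum_scal z _ _ (us t ltac:(lra))) => k.
      rewrite /a pow_n_S fact_simpl mult_INR Rinv_mult !RtoC_mult.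
      have e : Cmult (RtoC (INR (S k))) (RtoC (/ INR (S k))) = RtoC 1.
        rewrite -RtoC_mult Rinv_r //; by apply not_0_INR.
      set x := RtoC (INR (S k)) in e *; set y := RtoC (/ INR (S k)) in e *.
      transitivity (Cmult (Cmult x y) (Cmult z (Cmult (RtoC (t ^ k)) (Cmult (RtoC (/ INR (fact k))) (pow_n z k))))); last ring.
      rewrite e; ring.
    apply (CPSeries_der a 2 (exp (2 * Cmod z))) => //; first lra.
    apply sm; lra.
  have E := cder_eq0 (fun s => Cmult (cexp (Cplus 0 (Cmult (RtoC s) (Copp z)))) (CPSeries a s)) _.
  have {E} : Cmult (cexp (Cplus 0 (Cmult 0 (Copp z)))) (CPSeries a 0) =
         Cmult (cexp (Cplus 0 (Cmult 1 (Copp z)))) (CPSeries a 1).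
    apply E => t ht.
    have := cder_mult _ _ t _ _ (cder_cexp _ _ _ (cder_line 0 (Copp z) t)) (d t ht).
    set w := cexp _; set v := CPSeries a t.
    have -> : Cplus (Cmult (Cmult (Copp z) w) v) (Cmult w (Cmult z v)) = RtoC 0 by ring.
    done.
  have -> : CPSeries a 0 = RtoC 1.
    apply CPSeries_usum.
    have := usum_single (fun k => Cmult (RtoC (0 ^ k)) (a k)) 0%nat.
    rewrite /a /=; have -> : Cmult 1 (Cmult (RtoC (/ 1)) one) = RtoC 1.
      rewrite Rinv_1 !Cmult_1_l; reflexivity.
    apply => i hi; rewrite pow_i; [ring | lia].
  have -> : Cplus 0 (Cmult 0 (Copp z)) = RtoC 0 by ring.
  have -> : Cplus 0 (Cmult 1 (Copp z)) = Copp z by ring.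
  rewrite cexp_0 => h.
  have -> : cexp z = CPSeries a 1.
    rewrite -[CPSeries a 1]Cmult_1_l -cexp_0 -(Cplus_opp_r z) cexp_add -Cmult_assoc -h; ring.
  apply: usum_ext (us 1 ltac:(lra)) => k; rewrite pow1 Cmult_1_l; done.
Qed.

(** F(s) = - sum (s q)^k / k satisfies F'(s) (1 - s q) = - q, so cexp (- F(s)) (1 - s q) is constant
    on [0, 1]. No branch of the logarithm has to be chosen. *)
Lemma log_series (q : C) : Cmod q < 1 -> exists l,
  is_usum (fun k => Cmult (RtoC (- / INR (S k))) (pow_n q (S k))) l /\ cexp l = Cminus 1 q.
Proof.
  move=> hq; have q0 := Cmod_ge_0 q.
  pose a k := match k with O => RtoC 0 | S _ => Cmult (RtoC (- / INR k)) (pow_n q k) end.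
  have ma k : Cmod (a k) <= Cmod q ^ k.
    case: k => [|k]; first by rewrite /= Cmod_0; lra.
    rewrite /a Cmod_mult Cmod_R Cmod_pow_n Rabs_Ropp.
    have := pow_le (Cmod q) (S k) q0.
    have h : 1 <= INR (S k) by rewrite S_INR; have := pos_INR k; lra.
    rewrite Rabs_right; last by apply Rle_ge, Rlt_le, Rinv_0_lt_compat; lra.
    have : / INR (S k) <= / 1 by apply Rinv_le_contravar; lra.
    rewrite Rinv_1; nra.
  (* A radius with r > 1 and r |q| < 1. *)
  pose r := 2 / (1 + Cmod q).
  have r1 : 1 < r by rewrite /r; apply Rlt_div_r; lra.
  have rq : 0 <= r * Cmod q < 1.
    split; first by apply Rmult_le_pos; lra.
    rewrite /r; have -> : 2 / (1 + Cmod q) * Cmod q = (2 * Cmod q) / (1 + Cmod q) by field; lra.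
    apply Rlt_div_l; lra.
  have sm s : 0 <= s <= r -> bnd (fun k => (s * Cmod q) ^ k) (/ (1 - r * Cmod q)).
    move=> hs; apply: bnd_le (bnd_geom _ rq) => k.
    apply pow_incr; split; first by apply Rmult_le_pos; lra.
    apply Rmult_le_compat_r; lra.
  have sma s : 0 <= s <= r -> bnd (fun k => Cmod (a k) * s ^ k) (/ (1 - r * Cmod q)).
    move=> hs; apply: bnd_le (sm s hs) => k; rewrite Rpow_mult_distr Rmult_comm.
    apply Rmult_le_compat_l => //; apply pow_le; lra.
  have us s : 0 <= s <= r -> is_usum (fun k => Cmult (RtoC (s ^ k)) (a k)) (CPSeries a s).
    move=> hs.
    have [S hS] : exists S, is_usum (fun k => Cmult (RtoC (s ^ k)) (a k)) S.
      apply usum_exists; exists (/ (1 - r * Cmod q)); apply: bnd_le (sma s hs) => k.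
      rewrite Cmod_mult Cmod_R Rabs_right; [lra | apply Rle_ge, pow_le; lra].
    by rewrite (CPSeries_usum _ _ _ hS).
  have d t : 0 <= t <= 1 -> exists D, cder (CPSeries a) t D /\
      Cmult D (Cminus 1 (Cmult (RtoC t) q)) = Copp q.
    move=> ht.
    pose b k := Cmult (RtoC (INR (S k))) (a (S k)).
    have bE k : b k = Copp (pow_n q (S k)).
      rewrite /b /a RtoC_opp.
      have e : Cmult (RtoC (INR (S k))) (RtoC (/ INR (S k))) = RtoC 1.
        rewrite -RtoC_mult Rinv_r //; by apply not_0_INR.
      set x := RtoC (INR (S k)) in e *; set y := RtoC (/ INR (S k)) in e *.
      transitivity (Copp (Cmult (Cmult x y) (pow_n q (S k)))); first ring.
      rewrite e; ring.
    have [D hD] : exists D, is_usum (fun k => Cmult (RtoC (t ^ k)) (b k)) D.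
      apply usum_exists; exists (Cmod q * / (1 - r * Cmod q)).
      apply: bnd_le (bnd_scal _ _ _ q0 (sm t ltac:(lra))) => k.
      rewrite bE Cmod_mult Cmod_R Cmod_opp Cmod_pow_n Rabs_right; last by apply Rle_ge, pow_le; lra.
      rewrite Rpow_mult_distr /=; right; ring.
    exists D; split.
      rewrite -(CPSeries_usum _ _ _ hD).
      apply (CPSeries_der a r (/ (1 - r * Cmod q))) => //; apply sma; lra.
    have tq : Cmod (Cmult (RtoC t) q) < 1.
      rewrite Cmod_mult Cmod_R Rabs_right; nra.
    have [G [hG eG]] := geom_series _ tq.
    have -> : D = Cmult (Copp q) G.
      apply (usum_unique _ _ _ hD).
      apply: usum_ext (usum_scal (Copp q) _ _ hG) => k.
      rewrite bE pow_n_S.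
      have -> : pow_n (Cmult (RtoC t) q) k = Cmult (RtoC (t ^ k)) (pow_n q k).
        elim: k => [|k IH]; first by rewrite /= Cmult_1_l.
        rewrite !pow_n_S IH /= RtoC_mult; ring.
      ring.
    by rewrite -Cmult_assoc eG; ring.
  have a0 : CPSeries a 0 = RtoC 0.
    apply CPSeries_usum.
    have := usum_single (fun k => Cmult (RtoC (0 ^ k)) (a k)) 0%nat.
    have -> : Cmult (RtoC (0 ^ 0)) (a 0%nat) = RtoC 0 by rewrite /=; ring.
    apply => i hi; rewrite pow_i; [ring | lia].
  have E := cder_eq0 (fun s => Cmult (cexp (Copp (CPSeries a s))) (Cplus 1 (Cmult (RtoC s) (Copp q)))) _.
  have {E} : Cmult (cexp (Copp (CPSeries a 0))) (Cplus 1 (Cmult 0 (Copp q))) =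
         Cmult (cexp (Copp (CPSeries a 1))) (Cplus 1 (Cmult 1 (Copp q))).
    apply E => t ht.
    have [D [hD eD]] := d t ht.
    have hN : cder (fun s => Copp (CPSeries a s)) t (Copp D).
      have := cder_mult (fun _ => Copp 1) _ t 0 _ _ hD.
      have -> : Cplus (Cmult 0 (CPSeries a t)) (Cmult (Copp 1) D) = Copp D by ring.
      move=> h; apply: cder_ext (h _) => [s|]; first ring.
      split; apply (is_derive_const (V := R_NormedModule)).
    have := cder_mult _ _ t _ _ (cder_cexp _ _ _ hN) (cder_line 1 (Copp q) t).
    set w := cexp _.
    have -> : Cplus (Cmult (Cmult (Copp D) w) (Cplus 1 (Cmult (RtoC t) (Copp q)))) (Cmult w (Copp q)) =
              Copp (Cmult w (Cplus (Cmult D (Cminus 1 (Cmult (RtoC t) q))) q)) by ring.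
    rewrite eD; have -> : Copp (Cmult w (Cplus (Copp q) q)) = RtoC 0 by ring.
    done.
  rewrite a0 Copp_0 cexp_0.
  have -> : Cplus 1 (Cmult 1 (Copp q)) = Cminus 1 q by ring.
  have -> : Cmult 1 (Cplus 1 (Cmult 0 (Copp q))) = RtoC 1 by ring.
  move=> h.
  exists (CPSeries a 1); split.
    have := usum_shift _ _ (us 1 ltac:(lra)).
    have -> : Cminus (CPSeries a 1) (Cmult (RtoC (1 ^ 0)) (a 0%nat)) = CPSeries a 1.
      rewrite /a Cmult_0_r; ring.
    apply usum_ext => k; rewrite pow1 Cmult_1_l; done.
  rewrite -[LHS]Cmult_1_r {1}h Cmult_assoc -cexp_add Cplus_opp_r cexp_0; ring.
Qed.

Lemma Wiener_exp om (Hom : beurling_weight om) Sp (HS : submonoid Sp) f M :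
  Wiener om Sp f M -> Wiener om Sp (fun u => cexp (f u)) (om 0%Z * exp M).
Proof.
  move=> hf.
  have M0 := Wiener_ge0 om Sp f M hf.
  have o1 := om_ge1 om Hom 0.
  have fp k : 0 < / INR (fact k) by apply Rinv_0_lt_compat, INR_fact_lt_0.
  apply (Wiener_series om Hom Sp (fun k u => Cmult (RtoC (/ INR (fact k))) (pow_n (f u) k))
    (fun k => om 0%Z * (M ^ k / INR (fact k)))).
  - move=> k.
    have := Wiener_scal om Sp (RtoC (/ INR (fact k))) _ _ (Wiener_pow om Hom Sp HS f M k hf).
    rewrite Cmod_R Rabs_right; last by apply Rle_ge, Rlt_le.
    apply Wiener_le; rewrite /Rdiv; right; ring.
  - apply bnd_scal; [lra | by apply bnd_exp].
  - move=> u _; apply exp_series.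
Qed.

(** The hypothesis bounds the powers of [q] instead of its norm: in Newman's argument only the
    spectral radius of [q] is under control. *)
Lemma Wiener_log om (Hom : beurling_weight om) Sp (HS : submonoid Sp) (q : C -> C) K theta :
  0 <= theta < 1 -> 0 <= K ->
  (forall k, Wiener om Sp (fun u => pow_n (q u) k) (K * theta ^ k)) ->
  exists g, Wiener om Sp g (K * / (1 - theta)) /\
            forall u, dom om u -> cexp (g u) = Cminus 1 (q u).
Proof.
  move=> ht K0 hq.
  have q1 u : dom om u -> Cmod (q u) < 1.
    move=> du; apply Rnot_le_lt => h.
    (* With theta^N < 1 / (K + 1) the sup bound gives |q|^N < 1, hence |q| < 1 pointwise. *)
    have [N hN] := pow_lt_1_zero theta ltac:(rewrite Rabs_right; lra) (/ (K + 1)) ltac:(apply Rinv_0_lt_compat; lra).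
    have := hN N (le_n _); have tp := pow_le theta N (proj1 ht).
    rewrite Rabs_right; last lra.
    have := Wiener_sup om Sp _ _ u (hq N) du; rewrite Cmod_pow_n => h1 h2.
    have := pow_R1_Rle _ N h.
    have : K * theta ^ N <= K * / (K + 1) by apply Rmult_le_compat_l; lra.
    have -> : K * / (K + 1) = 1 - / (K + 1) by field; lra.
    have : 0 < / (K + 1) by apply Rinv_0_lt_compat; lra.
    lra.
  have ch u : exists l, dom om u ->
    is_usum (fun k => Cmult (RtoC (- / INR (S k))) (pow_n (q u) (S k))) l /\ cexp l = Cminus 1 (q u).
    case: (classic (dom om u)) => du; last by exists (RtoC 0).
    have [l hl] := log_series (q u) (q1 u du); by exists l.
  pose g u := proj1_sig (constructive_indefinite_description _ (ch u)).
  have hg u : dom om u ->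
    is_usum (fun k => Cmult (RtoC (- / INR (S k))) (pow_n (q u) (S k))) (g u) /\ cexp (g u) = Cminus 1 (q u).
    exact: (proj2_sig (constructive_indefinite_description _ (ch u))).
  exists g; split; last by move=> u /hg [].
  apply (Wiener_series om Hom Sp (fun k u => Cmult (RtoC (- / INR (S k))) (pow_n (q u) (S k)))
    (fun k => K * theta ^ k)).
  - move=> k.
    have := Wiener_scal om Sp (RtoC (- / INR (S k))) _ _ (hq (S k)).
    have i1 : 1 <= INR (S k) by rewrite S_INR; have := pos_INR k; lra.
    have i0 : 0 < / INR (S k) by apply Rinv_0_lt_compat; lra.
    rewrite Cmod_R Rabs_Ropp Rabs_right; last lra.
    apply Wiener_le => /=.
    have : / INR (S k) <= / 1 by apply Rinv_le_contravar; lra.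
    rewrite Rinv_1 => i2.
    have tp := pow_le theta k (proj1 ht).
    have Kt : 0 <= K * theta ^ k by apply Rmult_le_pos.
    have : / INR (S k) * theta <= 1 by nra.
    have -> : / INR (S k) * (K * (theta * theta ^ k)) = / INR (S k) * theta * (K * theta ^ k) by ring.
    nra.
  - apply bnd_scal => //; by apply bnd_geom.
  - by move=> u /hg [].
Qed.

Definition all_freq (j : Z) : Prop := True.

Lemma submonoid_all : submonoid all_freq.
Proof. by []. Qed.

Lemma exp_le x y : x <= y -> exp x <= exp y.
Proof. case=> [h | ->]; [apply Rlt_le, exp_increasing; lra | lra]. Qed.

Lemma exp_le_inv x y : exp x <= exp y -> x <= y.
Proof. move=> h; apply Rnot_lt_le => hlt; have := exp_increasing y x hlt; lra. Qed.

Lemma exp_INR_mult x n : exp x ^ n = exp (INR n * x).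
Proof.
  elim: n => [|n IH]; first by rewrite /= Rmult_0_l exp_0.
  rewrite S_INR /= IH -exp_plus; f_equal; ring.
Qed.

(** The weight of the absolutely convergent Laurent series on the closed annulus exp (- B) <= |z| <=
    exp B. It stands for the larger annulus on which Laurent polynomials are inverted. *)
Definition expw (B : R) (j : Z) : R := exp (B * Rabs (IZR j)).

Lemma expw_beurling B : 0 <= B -> beurling_weight (expw B).
Proof.
  move=> B0; split; [|split].
  - move=> j; rewrite -exp_0 /expw; apply exp_le, Rmult_le_pos => //; apply Rabs_pos.
  - move=> j; by rewrite /expw opp_IZR Rabs_Ropp.
  - move=> j k; rewrite /expw -exp_plus plus_IZR; apply exp_le.
    have := Rabs_triang (IZR j) (IZR k); nra.
Qed.

Lemma expw_dom B u : dom (expw B) u <-> Rabs (fst u) <= B.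
Proof.
  split.
    move=> d; have := d 1%Z; have := d (-1)%Z.
    rewrite /expw Rabs_Ropp Rabs_R1 => /exp_le_inv h1 /exp_le_inv h2.
    apply Rabs_le; lra.
  move=> h j; apply exp_le.
  apply (Rle_trans _ _ _ (Rle_abs _)); rewrite Rabs_mult.
  rewrite Rmult_comm; apply Rmult_le_compat_r => //; apply Rabs_pos.
Qed.

Lemma Wiener_weight_le om om' Sp f M K : 0 <= K ->
  (forall j, om j <= K * om' j) -> (forall u, dom om u -> dom om' u) ->
  Wiener om' Sp f M -> Wiener om Sp f (K * M).
Proof.
  move=> K0 h hd [c [h1 [h2 h3]]]; exists c; split => //; split; last by auto.
  apply: bnd_le (bnd_scal _ _ _ K0 h2) => j.
  have := h j; have := Cmod_ge_0 (c j); nra.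
Qed.

(** * The growth rate of a Beurling weight *)

(** Fekete's lemma for the subadditive sequence ln nu_n, with A the infimum of ln nu_n / n. The
    lower estimate is the infimum property. For the upper one, fix m with ratio below A + eps and
    divide the index by m with remainder. *)
Lemma fekete nu : beurling_weight nu -> exists A, 0 <= A /\
  (forall n : nat, exp (A * INR n) <= nu (Z.of_nat n)) /\
  (forall eps, 0 < eps -> exists K, 1 <= K /\ forall n : nat, nu (Z.of_nat n) <= K * exp ((A + eps) * INR n)).
Proof.
  move=> [n1 [sym sub]].
  have pos j : 0 < nu j by have := n1 j; lra.
  have iter m q : nu (Z.of_nat (m * q)) <= nu 0%Z * nu (Z.of_nat m) ^ q.
    elim: q => [|q IH]; first by rewrite Nat.mul_0_r /=; lra.
    rewrite Nat.mul_succ_r Nat2Z.inj_add.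
    apply: Rle_trans (sub _ _) _.
    rewrite [_ ^ S q]/= [nu (Z.of_nat m) * _]Rmult_comm -Rmult_assoc.
    apply Rmult_le_compat_r => //; by apply Rlt_le.
  (* The infimum is obtained as minus the supremum of the negated ratios. *)
  pose E x := exists n : nat, x = - (ln (nu (Z.of_nat (S n))) / INR (S n)).
  have l0 n : 0 <= ln (nu (Z.of_nat n)) by rewrite -ln_1; apply ln_le; [lra | apply n1].
  have Sn n : 0 < INR (S n) by apply lt_0_INR; lia.
  have [s [ub lub]] : {s | is_lub E s}.
    apply completeness.
    - exists 0 => x [n ->]; have := l0 (S n); have := Sn n => h1 h2.
      have : 0 <= ln (nu (Z.of_nat (S n))) / INR (S n) by apply Rdiv_le_0_compat.
      lra.
    - by exists (- (ln (nu (Z.of_nat 1)) / INR 1)), 0%nat.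
  exists (- s); split; [|split].
  - have : s <= 0; last lra.
    apply lub => x [n ->].
    have : 0 <= ln (nu (Z.of_nat (S n))) / INR (S n) by apply Rdiv_le_0_compat.
    lra.
  - case=> [|n]; first by rewrite Rmult_0_r exp_0; apply n1.
    rewrite -[nu _]exp_ln //; apply exp_le.
    have h : - (ln (nu (Z.of_nat (S n))) / INR (S n)) <= s by apply ub; exists n.
    have -> : ln (nu (Z.of_nat (S n))) = ln (nu (Z.of_nat (S n))) / INR (S n) * INR (S n).
      field; have := Sn n; lra.
    apply Rmult_le_compat_r; [exact: Rlt_le | lra].
  - move=> eps e0.
    have [n hn] : exists n, ln (nu (Z.of_nat (S n))) / INR (S n) < - s + eps.
      apply NNPP => H.
      have : s <= s - eps; last lra.
      apply lub => x [n ->].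
      apply Rnot_lt_le => h; apply H; exists n; lra.
    set m := S n in hn.
    have p0 := pow_R1_Rle (nu 1%Z) m (n1 1%Z).
    exists (nu 0%Z * (nu 0%Z * nu 1%Z ^ m)); split.
      have := n1 0%Z; nra.
    move=> k.
    (* k = m q + r: the q blocks have the good growth rate, and the remainder r < m costs at most
       the constant nu_0 nu_1^m. *)
    have dm := Nat.div_mod k m ltac:(lia); have mlt := Nat.mod_upper_bound k m ltac:(lia).
    set q := (k / m)%nat in dm; set r := (k mod m)%nat in dm mlt.
    have hr : nu (Z.of_nat r) <= nu 0%Z * nu 1%Z ^ m.
      have := iter 1%nat r; rewrite Nat.mul_1_l => h.
      apply: Rle_trans h _; apply Rmult_le_compat_l; first exact: Rlt_le.
      apply Rle_pow; [apply n1 | lia].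
    have hq : nu (Z.of_nat m) ^ q <= exp ((- s + eps) * INR k).
      rewrite -[nu (Z.of_nat m)]exp_ln // exp_INR_mult; apply exp_le.
      have hm : ln (nu (Z.of_nat m)) <= (- s + eps) * INR m.
        have -> : ln (nu (Z.of_nat m)) = ln (nu (Z.of_nat m)) / INR m * INR m.
          field; have := Sn n; rewrite -/m; lra.
        apply Rmult_le_compat_r; [exact: Rlt_le (Sn n) | lra].
      have hs : 0 <= - s + eps.
        have : s <= 0; last lra.
        apply lub => x [i ->].
        have : 0 <= ln (nu (Z.of_nat (S i))) / INR (S i) by apply Rdiv_le_0_compat.
        lra.
      have hk : INR m * INR q <= INR k by rewrite -mult_INR; apply le_INR; lia.
      have := pos_INR q; nra.
    rewrite {1}dm Nat2Z.inj_add.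
    apply: Rle_trans (sub _ _) _.
    apply (Rle_trans _ (nu 0%Z * nu (Z.of_nat m) ^ q * (nu 0%Z * nu 1%Z ^ m))).
      apply Rmult_le_compat => //; by apply Rlt_le.
    have c0 : 0 <= nu 0%Z * (nu 0%Z * nu 1%Z ^ m) by have := n1 0%Z; nra.
    have := Rmult_le_compat_l _ _ _ c0 hq; lra.
Qed.

(** The limit exists and equals Fekete's infimum, which makes the strip |Re u| <= A part of
    [dom nu]. Conversely, at a point with |Re u| > A the upper growth bound would keep exp (d n)
    bounded for some d > 0. *)
Lemma A_nu_spec nu : beurling_weight nu -> 0 <= A_nu nu /\
  (forall u, dom nu u <-> Rabs (fst u) <= A_nu nu) /\
  (forall eps, 0 < eps -> exists K, 1 <= K /\ forall j, nu j <= K * expw (A_nu nu + eps) j).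
Proof.
  move=> Hnu; have [A [A0 [h1 h2]]] := fekete nu Hnu.
  have [n1 [sym sub]] := Hnu.
  have pos j : 0 < nu j by have := n1 j; lra.
  have lim : is_lim_seq (fun k : nat => ln (nu (Z.of_nat k)) / INR k) A.
    apply is_lim_seq_spec => eps.
    have e0 := cond_pos eps.
    have [K [K1 hK]] := h2 (eps / 2) ltac:(lra).
    have [N hN] := nfloor_ex (ln K / (eps / 2)) ltac:(apply Rdiv_le_0_compat; [rewrite -ln_1; apply ln_le; lra | lra]).
    exists (S N) => n hn.
    have n0 : 0 < INR n by apply lt_0_INR; lia.
    have lo : A <= ln (nu (Z.of_nat n)) / INR n.
      apply Rle_div_r => //; rewrite -[A * INR n]ln_exp; apply ln_le; [apply exp_pos | apply h1].
    have hi : ln (nu (Z.of_nat n)) <= ln K + (A + eps / 2) * INR n.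
      rewrite -[(A + eps / 2) * INR n]ln_exp -ln_mult; [|lra|apply exp_pos].
      by apply ln_le.
    have lk : ln K < eps / 2 * INR n.
      have : ln K / (eps / 2) < INR n.
        have : INR (S N) <= INR n by apply le_INR.
        rewrite S_INR; lra.
      move/(Rlt_div_l _ _ _ (ltac:(lra) : eps / 2 > 0)); lra.
    have hi2 : ln (nu (Z.of_nat n)) / INR n < A + eps.
      apply Rlt_div_l => //; nra.
    apply Rabs_def1; lra.
  have EA : A_nu nu = A by rewrite /A_nu (is_lim_seq_unique _ _ lim).
  have habs j : nu j = nu (Z.of_nat (Z.abs_nat j)).
    rewrite Zabs2Nat.id_abs; case: (Z.abs_spec j) => -[_ ->] //.
  have hIZR j : Rabs (IZR j) = INR (Z.abs_nat j).
    by rewrite -abs_IZR INR_IZR_INZ Zabs2Nat.id_abs.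
  rewrite EA; split => //; split.
  - move=> u; split => h.
      apply Rnot_lt_le => hlt.
      have [K [K1 hK]] := h2 ((Rabs (fst u) - A) / 2) ltac:(lra).
      set d := (Rabs (fst u) - A) / 2 in hK.
      have d0 : 0 < d by rewrite /d; lra.
      have hb n : exp (d * INR n) <= K.
        have : exp (Rabs (fst u) * INR n) <= nu (Z.of_nat n).
          (* Test the monomial z^n or z^(-n), whichever is large at this u. *)
          case: (Rle_dec 0 (fst u)) => hu.
            have := h (Z.of_nat n); rewrite -INR_IZR_INZ Rabs_right; [by rewrite Rmult_comm | lra].
          have := h (- Z.of_nat n)%Z; rewrite -sym opp_IZR -INR_IZR_INZ Rabs_left; last lra.
          have -> : - INR n * fst u = - fst u * INR n by ring.
          done.
        have -> : Rabs (fst u) * INR n = d * INR n + (A + d) * INR n by rewrite /d; field.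
        rewrite exp_plus => h3.
        apply (Rmult_le_reg_r (exp ((A + d) * INR n))); first by apply exp_pos.
        by apply: Rle_trans h3 (hK n).
      have [N hN] := nfloor_ex (K / d) ltac:(apply Rdiv_le_0_compat; lra).
      have := hb (S N); have := exp_ineq1_le (d * INR (S N)).
      have : K < INR (S N) * d by apply Rlt_div_l => //; rewrite S_INR; lra.
      lra.
    move=> j; rewrite habs; apply: Rle_trans (h1 _); apply exp_le.
    apply: Rle_trans (Rle_abs _) _; rewrite Rabs_mult hIZR Rmult_comm.
    apply Rmult_le_compat_r => //; apply pos_INR.
  - move=> eps e0; have [K [K1 hK]] := h2 eps e0; exists K; split => // j.
    rewrite habs /expw hIZR; apply hK.
Qed.

(** * The theorem of Wiener and Levy *)

Lemma cexp_surj z : z <> RtoC 0 -> exists u, z = cexp u.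
Proof.
  move=> z0; have m0 : 0 < Cmod z by apply Cmod_gt_0.
  have hm := Rmax_Cmod z.
  have hx : -1 <= fst z / Cmod z <= 1.
    have h : Rabs (fst z) <= Cmod z by apply: Rle_trans hm; apply Rmax_l.
    move/Rabs_le_between: h => h; split; [apply Rle_div_r | apply Rle_div_l]; lra.
  pose x := fst z / Cmod z; pose y := snd z / Cmod z.
  have xy : x² + y² = 1.
    have h : (Cmod z)² = fst z ^ 2 + snd z ^ 2.
      rewrite /Cmod Rsqr_sqrt //; nra.
    rewrite /x /y /Rsqr; rewrite /Rsqr in h.
    have -> : fst z / Cmod z * (fst z / Cmod z) + snd z / Cmod z * (snd z / Cmod z) =
       (fst z ^ 2 + snd z ^ 2) / (Cmod z * Cmod z) by field; lra.
    rewrite -h; field; lra.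
  have [t [ct st]] : exists t, cos t = x /\ sin t = y.
    have c := cos_acos x hx.
    have s : sin (acos x) = Rabs y.
      rewrite sin_acos //; have -> : 1 - x² = y² by lra.
      apply sqrt_Rsqr_abs.
    case: (Rle_dec 0 y) => hy.
      exists (acos x); rewrite s Rabs_right //; lra.
    exists (- acos x); rewrite cos_neg sin_neg s Rabs_left; [split => //; ring | lra].
  exists (ln (Cmod z), t); rewrite /cexp /= exp_ln // ct st /x /y.
  rewrite (surjective_pairing z) /=; f_equal; field; rewrite -surjective_pairing; lra.
Qed.

(** f = z^m exp g with g in the algebra; the integer m is the winding number of f on the circle.
    Carrying m along makes the class stable under products, so a polynomial can be treated root by
    root. *)
Definition loggable (om : Z -> R) (f : C -> C) : Prop :=
  exists m g N, Wiener om all_freq g N /\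
    forall u, dom om u -> f u = Cmult (ez m u) (cexp (g u)).

Lemma loggable_mult om (Hom : beurling_weight om) f g :
  loggable om f -> loggable om g -> loggable om (fun u => Cmult (f u) (g u)).
Proof.
  move=> [m [a [M [ha ea]]]] [n [b [N [hb eb]]]].
  exists (m + n)%Z, (fun u => Cplus (a u) (b u)), (M + N); split; first exact: Wiener_plus.
  move=> u du; rewrite ea // eb // ez_add cexp_add; ring.
Qed.

Lemma loggable_const om (Hom : beurling_weight om) k :
  k <> RtoC 0 -> loggable om (fun _ => k).
Proof.
  move=> /cexp_surj [v ->].
  exists 0%Z, (fun _ => v), (Cmod v * om 0%Z); split; first exact: (Wiener_const om Hom all_freq submonoid_all).
  move=> u _; rewrite ez_0; ring.
Qed.

Lemma loggable_one_minus B k m r : 0 <= B -> Cmod r * expw B k < 1 ->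
  loggable (expw B) (fun u => Cmult (ez m u) (Cminus 1 (Cmult r (ez k u)))).
Proof.
  move=> B0 h; have Hom := expw_beurling B B0.
  have hq := Wiener_scal _ all_freq r _ _ (Wiener_monom _ Hom all_freq k I).
  have w0 := om_ge1 _ Hom 0.
  have [g [hg eg]] := Wiener_log _ Hom all_freq submonoid_all (fun u => Cmult r (ez k u))
    (expw B 0) (Cmod r * expw B k) (conj (Wiener_ge0 _ _ _ _ hq) h) ltac:(lra)
    (fun n => Wiener_pow _ Hom all_freq submonoid_all _ _ n hq).
  exists m, g, (expw B 0 * / (1 - Cmod r * expw B k)); split => //.
  move=> u du; by rewrite eg.
Qed.

Lemma loggable_ext om f g : (forall u, dom om u -> f u = g u) -> loggable om f -> loggable om g.
Proof.
  move=> E [m [h [N [hh eh]]]]; exists m, h, N; split => // u du; by rewrite -E // eh.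
Qed.

Lemma ez_1 u : ez 1 u = cexp u.
Proof. by rewrite /ez Cmult_1_l. Qed.

(** A root outside the annulus gives - r (1 - z / r), a nonzero root in its hole gives z (1 - r /
    z), and r = 0 gives z itself. In each case the subtracted monomial has norm below 1 for
    [expw B]. *)
Lemma loggable_linear B r : 0 <= B -> (forall u, Rabs (fst u) <= B -> cexp u <> r) ->
  loggable (expw B) (fun u => Cminus (cexp u) r).
Proof.
  move=> B0 h; have Hom := expw_beurling B B0.
  case: (classic (r = RtoC 0)) => r0.
    apply: (loggable_ext _ (fun u => Cmult (ez 1 u) (Cminus 1 (Cmult 0 (ez 0 u))))).
      move=> u _; rewrite ez_1 r0; ring.
    apply loggable_one_minus => //; rewrite Cmod_0; lra.
  have [v ev] := cexp_surj r r0.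
  have hv : B < Rabs (fst v) by apply Rnot_le_lt => hv; apply: (h v hv).
  have mr : Cmod r = exp (fst v) by rewrite ev Cmod_cexp.
  case: (Rle_dec 0 (fst v)) => s.
    rewrite Rabs_right in hv; last lra.
    apply: (loggable_ext _ (fun u => Cmult (Copp r) (Cmult (ez 0 u) (Cminus 1 (Cmult (Cinv r) (ez 1 u)))))).
      move=> u _; rewrite ez_1 ez_0; field => //.
    apply loggable_mult => //.
      apply loggable_const => // e; apply r0.
      transitivity (Copp (Copp r)); [ring | rewrite e; ring].
    apply loggable_one_minus => //.
    rewrite Cmod_inv // mr -exp_Ropp /expw -exp_plus Rabs_R1.
    apply (Rlt_le_trans _ (exp 0)); [apply exp_increasing; lra | rewrite exp_0; lra].
  rewrite Rabs_left in hv; last lra.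
  apply: (loggable_ext _ (fun u => Cmult (ez 1 u) (Cminus 1 (Cmult r (ez (-1) u))))).
    move=> u _.
    have e : Cmult (ez 1 u) (ez (-1) u) = RtoC 1 by rewrite -ez_add ez_0.
    have -> : Cmult (ez 1 u) (Cminus 1 (Cmult r (ez (-1) u))) =
      Cminus (ez 1 u) (Cmult r (Cmult (ez 1 u) (ez (-1) u))) by ring.
    rewrite e ez_1; ring.
  apply loggable_one_minus => //.
  rewrite mr /expw -exp_plus Rabs_Ropp Rabs_R1.
  apply (Rlt_le_trans _ (exp 0)); [apply exp_increasing; lra | rewrite exp_0; lra].
Qed.

(** Factoring needs a nonzero leading coefficient, so vanishing top coefficients are removed
    first. *)
Lemma poly_strip (a : nat -> C) n :
  (forall z, sum_n (fun j => Cmult (a j) (pow_n z j)) n = RtoC 0) \/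
  exists n', a n' <> RtoC 0 /\ forall z : C,
    sum_n (fun j => Cmult (a j) (pow_n z j)) n = sum_n (fun j => Cmult (a j) (pow_n z j)) n'.
Proof.
  elim: n => [|n IH].
    case: (classic (a 0%nat = RtoC 0)) => h; [left | right; by exists 0%nat].
    move=> z; rewrite sum_O h; exact: Cmult_0_l.
  case: (classic (a (S n) = RtoC 0)) => h; last by right; exists (S n).
  have E z : sum_n (fun j => Cmult (a j) (pow_n z j)) (S n) = sum_n (fun j => Cmult (a j) (pow_n z j)) n.
    rewrite sum_Sn h Cmult_0_l; exact: Cplus_0_r.
  case: IH => [IH | [n' [h1 h2]]]; [left | right; exists n'; split => //] => z; by rewrite E.
Qed.

Lemma loggable_poly B (a : nat -> C) n : 0 <= B ->
  (forall u, Rabs (fst u) <= B -> sum_n (fun j => Cmult (a j) (pow_n (cexp u) j)) n <> RtoC 0) ->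
  loggable (expw B) (fun u => sum_n (fun j => Cmult (a j) (pow_n (cexp u) j)) n).
Proof.
  move=> B0 h; have Hom := expw_beurling B B0.
  case: (poly_strip a n) => [Z | [n' [an E]]].
    case: (h (RtoC 0)) => //; rewrite /= Rabs_R0; lra.
  have [rs hrs] := C_poly_split a n' an.
  apply: (loggable_ext _ (fun u => Cmult (a n') (fold_right (fun r acc => Cmult (Cminus (cexp u) r) acc) (RtoC 1) rs))).
    by move=> u _; rewrite E hrs.
  apply loggable_mult => //; first exact: loggable_const.
  have : forall u, Rabs (fst u) <= B -> fold_right (fun r acc => Cmult (Cminus (cexp u) r) acc) (RtoC 1) rs <> RtoC 0.
    move=> u hu e; apply (h u hu); rewrite E hrs e; exact: Cmult_0_r.
  elim: rs {hrs} => [|r rs IH] /= hz.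
    apply loggable_const => // e; have := Cmod_1; rewrite e Cmod_0; lra.
  apply loggable_mult => //.
    apply loggable_linear => // u hu e; apply (hz u hu); rewrite e; ring.
  apply IH => u hu e; apply (hz u hu); rewrite e; ring.
Qed.

Lemma cexp_2PI_IZR k : cexp (0, 2 * PI * IZR k) = RtoC 1.
Proof.
  have h1 := sin_IZR_PI k.
  have -> : 2 * PI * IZR k = 2 * (IZR k * PI) by ring.
  rewrite /cexp /= exp_0 sin_2a cos_2a_sin h1 /RtoC; f_equal; ring.
Qed.

Lemma ez_period j u k : ez j (Cplus u (0, 2 * PI * IZR k)) = ez j u.
Proof.
  rewrite /ez.
  have -> : Cmult (IZR j) (Cplus u (0, 2 * PI * IZR k)) =
            Cplus (Cmult (IZR j) u) (0, 2 * PI * IZR (j * k)).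
    rewrite mult_IZR /Cmult /Cplus /=; f_equal; ring.
  by rewrite cexp_add cexp_2PI_IZR Cmult_1_r.
Qed.

Lemma ccont_ez j (u : C) : continuous (ez j) u.
Proof.
  apply ccont_cexp, ccont_mult; [apply ccont_const | apply continuous_id].
Qed.

(** Continuity relative to the closed strip: a finite partial sum is continuous everywhere, and the
    weight bounds the tail uniformly on [dom om]. *)
Lemma Wiener_local om (Hom : beurling_weight om) w M u e :
  Wiener om all_freq w M -> dom om u -> 0 < e -> exists d, 0 < d /\ forall v, dom om v ->
  Rabs (fst v - fst u) < d -> Rabs (snd v - snd u) < d -> Cmod (Cminus (w v) (w u)) < e.
Proof.
  move=> [c [_ [bc uc]]] du e0.
  have om0 j : 0 <= om j by have := om_ge1 om Hom j; lra.
  have p0 j : 0 <= om j * Cmod (c j) by apply Rmult_le_pos => //; apply Cmod_ge_0.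
  have [l0 tail] := bnd_tail _ M (e / 4) p0 bc ltac:(lra).
  have app v : dom om v -> Cmod (Cminus (lsum (fun j => Cmult (c j) (ez j v)) (cnodup l0)) (w v)) <= e / 4.
    move=> dv; apply (usum_tail _ _ l0 (e / 4) (uc v dv)).
    - move=> l nd dis; apply: Rle_trans (Rlt_le _ _ (tail l nd dis)).
      by apply rsum_le => j _; apply Wiener_term_le.
    - apply NoDup_nodup.
    - apply incl_cnodup.
  have cont : continuous (fun v => lsum (fun j => Cmult (c j) (ez j v)) (cnodup l0)) u.
    apply ccont_lsum => j; apply ccont_mult; [apply ccont_const | apply ccont_ez].
  have [d hd] := proj1 (filterlim_locally _ _) cont (mkposreal (e / 8) ltac:(lra)).
  exists d; split; first by apply cond_pos.
  move=> v dv h1 h2.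
  have k := Cmod_of_ball _ _ _ (hd v (conj h1 h2)).
  have := app v dv; have := app u du.
  rewrite [pos _]/= in k.
  set a := lsum _ (cnodup l0); set b := lsum _ (cnodup l0) => m1 m2.
  have m3 : Cmod (Cminus b a) < e / 4 by apply: Rlt_le_trans k _; lra.
  have := Cmod_minus_triangle (w v) b (w u).
  have := Cmod_minus_triangle b a (w u).
  rewrite (Cmod_minus_sym (w v) b); lra.
Qed.

(** The strip is not compact, but w has period 2 pi in Im u. Compactness of the rectangle [-A, A] x
    [0, 2 pi] gives the bound there, and translation carries it to the rest. *)
Lemma Wiener_lower_bound om (Hom : beurling_weight om) A w M :
  (forall u, dom om u <-> Rabs (fst u) <= A) -> Wiener om all_freq w M ->
  (forall u, dom om u -> w u <> RtoC 0) ->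
  exists d, 0 < d /\ forall u, dom om u -> d <= Cmod (w u).
Proof.
  move=> hdom hw nz.
  have ch (p : R * R) : exists d : posreal, dom om p -> forall v, dom om v ->
      Rabs (fst v - fst p) < d -> Rabs (snd v - snd p) < d -> d <= Cmod (w v).
    case: (classic (dom om p)) => dp; last by exists (mkposreal 1 Rlt_0_1).
    have wp : 0 < Cmod (w p) by apply Cmod_gt_0, nz.
    have [d [d0 hd]] := Wiener_local om Hom w M p (Cmod (w p) / 2) hw dp ltac:(lra).
    (* A single number serves as radius of the neighbourhood and as lower bound of |w| on it, which
       is the form that the compactness theorem returns. *)
    have m0 : 0 < Rmin d (Cmod (w p) / 2) by apply Rmin_pos; lra.
    exists (mkposreal _ m0) => _ v dv h1 h2.
    have := hd v dv (Rlt_le_trans _ _ _ h1 (Rmin_l _ _)) (Rlt_le_trans _ _ _ h2 (Rmin_l _ _)).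
    rewrite Cmod_minus_sym => h3.
    have := Cmod_triangle (Cminus (w p) (w v)) (w v).
    have -> : Cplus (Cminus (w p) (w v)) (w v) = w p by ring.
    have := Rmin_r d (Cmod (w p) / 2); rewrite /=; lra.
  pose delta x y := proj1_sig (constructive_indefinite_description _ (ch (x, y))).
  have hdelta x y : dom om (x, y) -> forall v, dom om v ->
      Rabs (fst v - x) < delta x y -> Rabs (snd v - y) < delta x y -> delta x y <= Cmod (w v).
    exact: (proj2_sig (constructive_indefinite_description _ (ch (x, y)))).
  have [d hd] := compactness_value_2d (- A) A 0 (2 * PI) delta.
  exists d; split; first by apply cond_pos.
  have box u : dom om u -> 0 <= snd u <= 2 * PI -> d <= Cmod (w u).
    move=> du hy.
    have hx : - A <= fst u <= A by apply Rabs_le_between, hdom.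
    apply NNPP => hn; apply (hd (fst u) (snd u) hx hy) => -[x [y [h1 [h2 [h3 [h4 h5]]]]]].
    apply hn, (Rle_trans _ _ _ h5), (hdelta x y) => //.
    by apply hdom, Rabs_le_between.
  move=> u du.
  have P := PI_RGT_0.
  (* Move u into the rectangle by an integer number of periods. *)
  pose k := Int_part (snd u / (2 * PI)).
  pose v : C := Cplus u (0, 2 * PI * IZR (- k)).
  have dv : dom om v by apply hdom; rewrite /v /= Rplus_0_r; apply hdom.
  have -> : w u = w v.
    have [c [_ [_ uc]]] := hw.
    apply: (usum_unique _ _ _ (uc u du)).
    apply: usum_ext (uc v dv) => j; by rewrite /v ez_period.
  apply box => //.
  have [b1 b2] := base_Int_part (snd u / (2 * PI)).
  rewrite -/k in b1 b2.
  rewrite /v /= opp_IZR.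
  have e : snd u = snd u / (2 * PI) * (2 * PI) by field; lra.
  set q := snd u / (2 * PI) in b1 b2 e.
  rewrite e; nra.
Qed.

Lemma fourier_bound (g : R -> C) T j : (forall t, continuous g t) -> (forall t, Cmod (g t) <= T) ->
  Cmod (fourier g j) <= T.
Proof.
  move=> cg gT; have P := PI_RGT_0.
  pose h t := Cmult (Cpowz (cis t) (- j)) (g t).
  have E t : Cpowz (cis t) (- j) = cexp (Cmult (RtoC (IZR (- j))) (0, t)) by rewrite cis_cexp Cpowz_cexp.
  have ch t : continuous h t.
    apply ccont_mult => //.
    apply (continuous_ext (fun t => cexp (Cmult (RtoC (IZR (- j))) (0, t)))); first by move=> s; rewrite E.
    apply ccont_trig.
  have := Cmod_RInt_le h (- PI) PI _ T ltac:(lra) _ (ccont_RInt h (- PI) PI ch).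
  rewrite /fourier -/h Cmod_mult Cmod_R Rabs_right; last by apply Rle_ge, Rlt_le, Rinv_0_lt_compat; lra.
  move=> H.
  have {}H : Cmod (CRInt h (- PI) PI) <= (PI - - PI) * T.
    apply H => t; rewrite /h Cmod_mult E Cmod_cexp fst_RtoC_mult /= Rmult_0_r exp_0 Rmult_1_l; apply gT.
  have p : 0 < / (2 * PI) by apply Rinv_0_lt_compat; lra.
  apply (Rle_trans _ (/ (2 * PI) * ((PI - - PI) * T))); first by apply Rmult_le_compat_l; lra.
  right; field; lra.
Qed.

(** On the line Re u = x the j-th Fourier coefficient is exp (j x) times [coef f j], and it is at
    most T. Take x = B or x = - B according to the sign of j. *)
Lemma Wiener_Cauchy B f M T : 0 <= B -> Wiener (expw B) all_freq f M ->
  (forall u, Rabs (fst u) <= B -> Cmod (f u) <= T) ->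
  forall j, Cmod (coef f j) <= T * exp (- B * Rabs (IZR j)).
Proof.
  move=> B0 hf fT j.
  have Hom := expw_beurling B B0.
  have [_ [bc uc]] := Wiener_coef _ Hom _ _ _ hf.
  have [x [hx ex]] : exists x, Rabs x <= B /\ IZR j * x = B * Rabs (IZR j).
    case: (Rle_dec 0 (IZR j)) => h.
      exists B; rewrite !Rabs_right; lra.
    exists (- B); rewrite Rabs_Ropp Rabs_right ?Rabs_left; lra.
  pose c k := Cmult (coef f k) (ez k (x, 0)).
  have dx t : dom (expw B) (x, t) by apply expw_dom.
  have bc' : bnd (fun k => Cmod (c k)) M.
    apply: bnd_le bc => k; apply: (Wiener_term_le _ _ _ _ (dx 0)).
  have u' t : is_usum (fun k => Cmult (c k) (cexp (Cmult (RtoC (IZR k)) (0, t)))) (f (x, t)).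
    apply: usum_ext (uc (x, t) (dx t)) => k.
    rewrite /c -Cmult_assoc; f_equal; rewrite /ez -cexp_add; f_equal.
    rewrite /Cmult /Cplus /=; f_equal; ring.
  have F := fourier_usum c M _ j bc' u'.
  have := fourier_bound _ T j (usum_trig_continuous c M _ bc' u') (fun t => fT (x, t) hx).
  rewrite F /c Cmod_mult Cmod_ez /= ex => h.
  have -> : - B * Rabs (IZR j) = - (B * Rabs (IZR j)) by ring.
  rewrite exp_Ropp.
  have p := exp_pos (B * Rabs (IZR j)).
  by apply Rle_div_r.
Qed.

Lemma bnd_exp_decay d : 0 < d -> exists G, bnd (fun j => exp (- d * Rabs (IZR j))) G.
Proof.
  move=> d0.
  have q1 : exp (- d) < 1 by rewrite -exp_0; apply exp_increasing; lra.
  have g : ex_series (fun n => exp (- d) ^ n).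
    apply ex_series_geom; rewrite Rabs_right //; apply Rle_ge, Rlt_le, exp_pos.
  (* Membership in [in_W] with all coefficients 1 is a device for joining two one-sided geometric
     series into a bound over the integers. *)
  have W : in_W (fun j => exp (- d * Rabs (IZR j))) (fun _ => RtoC 1).
    split.
      apply: ex_series_ext g => n.
      rewrite Cmod_1 Rmult_1_r exp_INR_mult -INR_IZR_INZ Rabs_right; [f_equal; ring | apply Rle_ge, pos_INR].
    apply (ex_series_ext (fun n => exp (- d) ^ S n)).
      move=> n.
      rewrite Cmod_1 Rmult_1_r exp_INR_mult opp_IZR Rabs_Ropp -INR_IZR_INZ Rabs_right; [f_equal; ring | apply Rle_ge, pos_INR].
    by apply (ex_series_incr_1 (fun n => exp (- d) ^ n)).
  have [G hG] := in_W_bnd _ _ (fun j => Rlt_le _ _ (exp_pos _)) W.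
  exists G; apply: bnd_le hG => j; rewrite Cmod_1; lra.
Qed.

Lemma usum_finite {I : Type} (f : I -> C) (l : list I) : NoDup l ->
  is_usum (fun i => if in_dec classic_eq_dec i l then f i else RtoC 0) (lsum f l).
Proof.
  elim: l => [|a l IH] nd.
    by apply (usum_ext (fun _ => RtoC 0)) => // e e0; exists nil => l _ _;
      rewrite lsum_eq0 // /Cminus Cplus_opp_r Cmod_0.
  inversion nd; subst.
  have h1 := usum_single (fun i => if classic_eq_dec i a then f i else RtoC 0) a.
  case: (classic_eq_dec a a) h1 => // _ h1.
  have {}h1 := h1 ltac:(by move=> i ia; case: classic_eq_dec).
  apply: usum_ext (usum_plus _ _ _ _ h1 (IH H2)) => i.
  case: (classic_eq_dec i a) => [->|ia].
    case: (in_dec classic_eq_dec a (a :: l)) => [_|[]]; last by left.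
    case: (in_dec classic_eq_dec a l) => // _; ring.
  case: (in_dec classic_eq_dec i l) => h; case: (in_dec classic_eq_dec i (a :: l)) => h'.
  - ring.
  - by case: h'; right.
  - case: h' => // e; by case: ia.
  - ring.
Qed.

Definition Zrange (N : nat) : list Z :=
  map (fun k => (Z.of_nat k - Z.of_nat N)%Z) (seq 0 (2 * N + 1)).

Lemma Zrange_NoDup N : NoDup (Zrange N).
Proof. apply FinFun.Injective_map_NoDup; [move=> x y; lia | apply seq_NoDup]. Qed.

Lemma in_Zrange N j : (- Z.of_nat N <= j <= Z.of_nat N)%Z -> In j (Zrange N).
Proof.
  move=> h; apply in_map_iff; exists (Z.to_nat (j + Z.of_nat N)); split; first lia.
  apply in_seq; lia.
Qed.

Lemma Z_list_bounded (l : list Z) : exists N, incl l (Zrange N).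
Proof.
  have [N hN] : exists N, forall j, In j l -> (Z.abs j <= Z.of_nat N)%Z.
    elim: l => [|a l [N hN]]; first by exists 0%nat.
    exists (N + Z.abs_nat a)%nat => j /= [<-|/hN]; lia.
  exists N => j /hN h; apply in_Zrange; lia.
Qed.

(** Bounds the change of a Laurent polynomial when only Re u moves, uniformly in Im u, whose
    contribution has modulus 1. *)
Lemma rsum_exp_cont (a : Z -> R) (l : list Z) x0 e : (forall j, 0 <= a j) -> 0 < e ->
  exists d, 0 < d /\ forall x, Rabs (x - x0) < d ->
    rsum (fun j => a j * Rabs (exp (IZR j * x) - exp (IZR j * x0))) l < e.
Proof.
  move=> a0; elim: l e => [|j l IH] e e0.
    exists 1; split; [lra | move=> x _ /=; lra].
  have [d1 [d10 h1]] := IH (e / 2) ltac:(lra).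
  have c : continuous (fun x => a j * exp (IZR j * x)) x0.
    apply (ex_derive_continuous (V := R_NormedModule)); by auto_derive.
  have [d2 h2] := proj1 (filterlim_locally _ _) c (mkposreal (e / 2) ltac:(lra)).
  exists (Rmin d1 d2); split; first by apply Rmin_pos => //; apply cond_pos.
  move=> x hx /=.
  have k1 := h1 x (Rlt_le_trans _ _ _ hx (Rmin_l _ _)).
  have k2 := h2 x (Rlt_le_trans _ _ _ hx (Rmin_r _ _)).
  change (Rabs (a j * exp (IZR j * x) - a j * exp (IZR j * x0)) < e / 2) in k2.
  rewrite -Rmult_minus_distr_l Rabs_mult (Rabs_right (a j)) in k2; last exact: Rle_ge.
  lra.
Qed.

Lemma ez_nat k u : ez (Z.of_nat k) u = pow_n (cexp u) k.
Proof. by rewrite pow_n_cexp /ez INR_IZR_INZ. Qed.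

Lemma Wiener_trunc om (Hom : beurling_weight om) w M e :
  Wiener om all_freq w M -> 0 < e -> exists (c : Z -> C) N,
  Wiener om all_freq (fun u => Cminus (lsum (fun j => Cmult (c j) (ez j u)) (Zrange N)) (w u)) e.
Proof.
  move=> [c [_ [bc uc]]] e0.
  have p0 j : 0 <= om j * Cmod (c j).
    apply Rmult_le_pos; [have := om_ge1 om Hom j; lra | apply Cmod_ge_0].
  have [l0 tail] := bnd_tail _ M e p0 bc e0.
  have [N inc] := Z_list_bounded l0.
  exists c, N, (fun j => if in_dec classic_eq_dec j (Zrange N) then RtoC 0 else Copp (c j)).
  split; [by move=> j h; case: (h I) | split].
  - move=> l nd.
    pose l' := filter (fun j => if in_dec classic_eq_dec j (Zrange N) then false else true) l.
    apply (Rle_trans _ (rsum (fun j => om j * Cmod (c j)) l')).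
      right; rewrite /l'; elim: l {nd l'} => //= a l ->.
      case: in_dec => h /=; first by rewrite Cmod_0; ring.
      by rewrite Cmod_opp.
    apply Rlt_le, tail; first by apply NoDup_filter.
    move=> i; rewrite filter_In; case: in_dec => [_ [] //|h _ h']; apply h; by apply inc.
  - move=> u du.
    have h := usum_plus _ _ _ _ (usum_finite (fun j => Cmult (c j) (ez j u)) _ (Zrange_NoDup N))
      (usum_scal (Copp 1) _ _ (uc u du)).
    have -> : Cminus (lsum (fun j => Cmult (c j) (ez j u)) (Zrange N)) (w u) =
       Cplus (lsum (fun j => Cmult (c j) (ez j u)) (Zrange N)) (Cmult (Copp 1) (w u)) by ring.
    apply: usum_ext h => j; case: in_dec => _; ring.
Qed.

Lemma loggable_Laurent B (c : Z -> C) N : 0 <= B ->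
  (forall u, Rabs (fst u) <= B -> lsum (fun j => Cmult (c j) (ez j u)) (Zrange N) <> RtoC 0) ->
  loggable (expw B) (fun u => lsum (fun j => Cmult (c j) (ez j u)) (Zrange N)).
Proof.
  move=> B0 nz; have Hom := expw_beurling B B0.
  pose a k := c (Z.of_nat k - Z.of_nat N)%Z.
  have E u : lsum (fun j => Cmult (c j) (ez j u)) (Zrange N) =
     Cmult (ez (- Z.of_nat N) u) (sum_n (fun k => Cmult (a k) (pow_n (cexp u) k)) (2 * N)).
    have -> : sum_n (fun k => Cmult (a k) (pow_n (cexp u) k)) (2 * N) =
       lsum (fun k => Cmult (a k) (pow_n (cexp u) k)) (seq 0 (S (2 * N))).
      exact: sum_n_lsum.
    rewrite -lsum_scal /Zrange Nat.add_1_r.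
    elim: (seq 0 (S (2 * N))) => //= k l ->; f_equal.
    rewrite -ez_nat Cmult_assoc [Cmult _ (a k)]Cmult_comm -Cmult_assoc -ez_add /a; do 2 f_equal; lia.
  apply: (loggable_ext _ (fun u => Cmult (ez (- Z.of_nat N) u) (sum_n (fun k => Cmult (a k) (pow_n (cexp u) k)) (2 * N)))).
    by move=> u _; rewrite E.
  apply loggable_mult => //.
    exists (- Z.of_nat N)%Z, (fun _ => RtoC 0), (Cmod 0 * expw B 0); split; first exact: (Wiener_const _ Hom _ submonoid_all).
    move=> u _; rewrite cexp_0; ring.
  apply loggable_poly => // u hu e.
  by apply (nz u hu); rewrite E e; apply Cmult_0_r.
Qed.

(* Newman's argument: [w] is close to a Laurent polynomial [p], and the powers of [1 / p]
   are controlled by Cauchy's estimate on a slightly larger annulus. *)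
Theorem wiener_levy nu w M : beurling_weight nu -> Wiener nu all_freq w M ->
  (forall u, dom nu u -> w u <> RtoC 0) -> loggable nu w.
Proof.
  move=> Hnu hw nz.
  have [A0 [hdom gr]] := A_nu_spec nu Hnu.
  set A := A_nu nu in A0 hdom gr.
  have [d [d0 hd]] := Wiener_lower_bound nu Hnu A w M hdom hw nz.
  (* The error d / 4 is matched to the bound 2 / d for 1 / p proved below: their product is 1 / 2,
     the decay rate of the powers of (p - w) / p. *)
  have [c [N hc]] := Wiener_trunc nu Hnu w M (d / 4) hw ltac:(lra).
  pose p u := lsum (fun j => Cmult (c j) (ez j u)) (Zrange N).
  have pd u : dom nu u -> 3 * d / 4 <= Cmod (p u).
    move=> du; have := Wiener_sup nu _ _ _ u hc du; have := hd u du; rewrite -/(p u).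
    have := Cmod_triangle (Cminus (w u) (p u)) (p u).
    have -> : Cplus (Cminus (w u) (p u)) (p u) = w u by ring.
    rewrite (Cmod_minus_sym (w u)); lra.
  have diff x x0 t : Cmod (Cminus (p (x, t)) (p (x0, t))) <=
    rsum (fun j => Cmod (c j) * Rabs (exp (IZR j * x) - exp (IZR j * x0))) (Zrange N).
    have -> : Cminus (p (x, t)) (p (x0, t)) =
      lsum (fun j => Cmult (c j) (Cminus (ez j (x, t)) (ez j (x0, t)))) (Zrange N).
      rewrite /p; elim: (Zrange N) => /= [|j l <-]; ring.
    apply: Rle_trans (Cmod_lsum _ _) _; apply rsum_le => j _.
    rewrite Cmod_mult; apply Rmult_le_compat_l; first by apply Cmod_ge_0.
    have E y : ez j (y, t) = Cmult (RtoC (exp (IZR j * y))) (cexp (0, IZR j * t)).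
      rewrite /ez /cexp /Cmult /= exp_0; f_equal.
        rewrite !Rmult_0_l Rminus_0_r Rplus_0_r; ring.
      rewrite !Rmult_0_l Rminus_0_r Rplus_0_r; ring.
    rewrite !E.
    have -> : forall a b z, Cminus (Cmult (RtoC a) z) (Cmult (RtoC b) z) = Cmult (RtoC (a - b)) z.
      move=> a b z; rewrite RtoC_minus; ring.
    rewrite Cmod_mult Cmod_R Cmod_cexp /= exp_0; lra.
  have [e1 [e10 h1]] := rsum_exp_cont (fun j => Cmod (c j)) (Zrange N) A (d / 4) (fun j => Cmod_ge_0 _) ltac:(lra).
  have [e2 [e20 h2]] := rsum_exp_cont (fun j => Cmod (c j)) (Zrange N) (- A) (d / 4) (fun j => Cmod_ge_0 _) ltac:(lra).
  have e0 : 0 < Rmin e1 e2 by apply Rmin_pos.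
  (* Between A and B the values of p move by less than d / 4 from those on the edge of the strip,
     where |p| >= 3 d / 4. So p has no zero in the larger strip. *)
  pose B := A + Rmin e1 e2 / 2.
  have B0 : 0 <= B by rewrite /B; lra.
  have pB u : Rabs (fst u) <= B -> d / 2 <= Cmod (p u).
    case: u => x t /= hx.
    have key x0 : Rabs x0 <= A ->
       rsum (fun j => Cmod (c j) * Rabs (exp (IZR j * x) - exp (IZR j * x0))) (Zrange N) < d / 4 ->
       d / 2 <= Cmod (p (x, t)).
      move=> hx0 hs; have := diff x x0 t; have := pd (x0, t) (proj2 (hdom (x0, t)) hx0).
      have := Cmod_triangle (Cminus (p (x0, t)) (p (x, t))) (p (x, t)).
      have -> : Cplus (Cminus (p (x0, t)) (p (x, t))) (p (x, t)) = p (x0, t) by ring.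
      rewrite Cmod_minus_sym; lra.
    have m1 := Rmin_l e1 e2; have m2 := Rmin_r e1 e2.
    case: (Rle_dec (Rabs x) A) => hA.
      apply: Rle_trans (pd (x, t) (proj2 (hdom (x, t)) hA)); lra.
    case: (Rle_dec 0 x) => hx0.
      have ax : Rabs x = x by apply Rabs_right; lra.
      rewrite ax in hA hx.
      apply (key A); first by rewrite Rabs_right; lra.
      apply h1; apply Rabs_def1; rewrite /B in hx; lra.
    have ax : Rabs x = - x by apply Rabs_left; lra.
    rewrite ax in hA hx.
    apply (key (- A)); first by rewrite Rabs_Ropp Rabs_right; lra.
    apply h2; apply Rabs_def1; rewrite /B in hx; lra.
  have HB := expw_beurling B B0.
  have [m [g [K [hg eg]]]] : loggable (expw B) p.
    apply loggable_Laurent => // u hu e.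
    have := pB u hu; rewrite /p e Cmod_0; lra.
  pose pinv u := Cmult (ez (- m) u) (cexp (Copp (g u))).
  have pE u : Rabs (fst u) <= B -> Cmult (p u) (pinv u) = RtoC 1.
    move=> hu; rewrite eg; last by apply expw_dom.
    have e1' : Cmult (ez m u) (ez (- m) u) = RtoC 1 by rewrite -ez_add Z.add_opp_diag_r ez_0.
    have e2' : Cmult (cexp (g u)) (cexp (Copp (g u))) = RtoC 1 by rewrite -cexp_add Cplus_opp_r cexp_0.
    transitivity (Cmult (Cmult (ez m u) (ez (- m) u)) (Cmult (cexp (g u)) (cexp (Copp (g u))))).
      rewrite /pinv; ring.
    rewrite e1' e2'; ring.
  have [P hP] : exists P, Wiener (expw B) all_freq pinv P.
    have hm : Wiener (expw B) all_freq (fun u => Copp (g u)) (Cmod (Copp 1) * K).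
      apply: Wiener_ext (Wiener_scal _ _ (Copp 1) _ _ hg) => u _; ring.
    have := Wiener_mult _ HB _ submonoid_all _ _ _ _ (Wiener_monom _ HB all_freq (- m)%Z I)
      (Wiener_exp _ HB _ submonoid_all _ _ hm).
    by eexists; eassumption.
  have pinv_le u : Rabs (fst u) <= B -> Cmod (pinv u) <= 2 / d.
    move=> hu; have := pB u hu; have := f_equal Cmod (pE u hu); rewrite Cmod_mult Cmod_1 => h3 h4.
    apply Rle_div_r; first lra.
    have := Cmod_ge_0 (pinv u); nra.
  (* nu grows at most like exp ((A + eps) |j|) and Cauchy's estimate decays like exp (- B |j|),
     which leaves the summable factor exp (- eps |j|). *)
  pose eps := (B - A) / 2.
  have ep : 0 < eps by rewrite /eps /B; lra.
  have [K1 [K11 hK1]] := gr eps ep.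
  have [G hG] := bnd_exp_decay eps ep.
  have G0 := bnd_ge0 _ _ hG.
  have domB u : dom nu u -> dom (expw B) u.
    move/hdom => h; apply expw_dom; rewrite /B; lra.
  (* The constant K1 G does not depend on k. Up to it, the norm in the nu-algebra of the k-th power
     is governed by the sup bound on the larger strip alone. *)
  have hpow k : Wiener nu all_freq (fun u => pow_n (pinv u) k) ((2 / d) ^ k * K1 * G).
    have hk := Wiener_pow _ HB _ submonoid_all _ _ k hP.
    have [_ [_ uk]] := Wiener_coef _ HB _ _ _ hk.
    exists (coef (fun u => pow_n (pinv u) k)); split; [by move=> j h; case: (h I) | split; last by move=> u /domB; apply uk].
    have p2 : 0 <= (2 / d) ^ k by apply pow_le; apply Rdiv_le_0_compat; lra.
    have C := Wiener_Cauchy B _ _ ((2 / d) ^ k) B0 hk _.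
    apply: bnd_le (bnd_scal _ _ ((2 / d) ^ k * K1) _ hG) => [j|]; last by apply Rmult_le_pos; lra.
    have {}C : Cmod (coef (fun u => pow_n (pinv u) k) j) <= (2 / d) ^ k * exp (- B * Rabs (IZR j)).
      apply C => u hu; rewrite Cmod_pow_n; apply pow_incr; split; [apply Cmod_ge_0 | by apply pinv_le].
    have n0 : 0 <= nu j by have := om_ge1 nu Hnu j; lra.
    apply (Rle_trans _ ((K1 * expw (A + eps) j) * ((2 / d) ^ k * exp (- B * Rabs (IZR j))))).
      apply Rmult_le_compat => //; apply Cmod_ge_0.
    right; rewrite /expw.
    have -> : exp (- eps * Rabs (IZR j)) = exp ((A + eps) * Rabs (IZR j)) * exp (- B * Rabs (IZR j)).
      rewrite -exp_plus; f_equal; rewrite /eps; field.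
    ring.
  (* w = p (1 - q), so a logarithm of w is the sum of those of p and of 1 - q. *)
  pose q u := Cmult (Cminus (p u) (w u)) (pinv u).
  have hq k : Wiener nu all_freq (fun u => pow_n (q u) k) ((nu 0%Z * K1 * G) * (/ 2) ^ k).
    have := Wiener_mult nu Hnu _ submonoid_all _ _ _ _ (Wiener_pow nu Hnu _ submonoid_all _ _ k hc) (hpow k).
    have -> : nu 0%Z * (d / 4) ^ k * ((2 / d) ^ k * K1 * G) = nu 0%Z * K1 * G * (/ 2) ^ k.
      have -> : / 2 = d / 4 * (2 / d) by field; lra.
      rewrite Rpow_mult_distr; ring.
    apply Wiener_ext => u du; rewrite /q -/(p u).
    elim: k => [|k IH]; first by apply Cmult_1_l.
    rewrite !pow_n_S -IH; ring.
  have n0 := om_ge1 nu Hnu 0.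
  have [l [hl el]] := Wiener_log nu Hnu _ submonoid_all q (nu 0%Z * K1 * G) (/ 2) ltac:(lra)
     ltac:(apply Rmult_le_pos; [nra | lra]) hq.
  exists m, (fun u => Cplus (g u) (l u)); eexists; split.
    apply Wiener_plus; [done | | exact hl].
    apply (Wiener_weight_le nu (expw B) all_freq g K K1); [lra | | done | done].
    move=> j; apply: Rle_trans (hK1 j) _; apply Rmult_le_compat_l; first lra.
    apply exp_le, Rmult_le_compat_r; [apply Rabs_pos | rewrite /eps /B; lra].
  move=> u du; rewrite cexp_add Cmult_assoc -eg; last by apply domB.
  rewrite el // /q.
  have := pE u (proj1 (expw_dom B u) (domB u du)) => e.
  transitivity (Cminus (p u) (Cmult (Cminus (p u) (w u)) (Cmult (p u) (pinv u)))); last ring.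
  rewrite e; ring.
Qed.

(** The imaginary part is continuous with values in 2 pi Z. If it took two values, it would take one
    at distance in (0, 1] above the smaller, where the cosine of the difference is below 1. *)
Lemma cexp_eq1_constant (h : R -> C) : (forall t, continuous h t) ->
  (forall t, cexp (h t) = RtoC 1) -> forall s t, h s = h t.
Proof.
  move=> ch e1.
  have f0 t : fst (h t) = 0.
    have := f_equal Cmod (e1 t); rewrite Cmod_cexp Cmod_1 => e.
    by rewrite -(ln_exp (fst (h t))) e ln_1.
  have c1 t : cos (snd (h t)) = 1.
    have := f_equal fst (e1 t); rewrite /= f0 exp_0; lra.
  have key s t : snd (h s) < snd (h t) -> False.
    move=> lt.
    pose y := Rmin (snd (h t)) (snd (h s) + 1).
    have y1 : snd (h s) < y by apply Rmin_glb_lt; lra.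
    have y2 : y <= snd (h s) + 1 by apply Rmin_r.
    have y3 : y <= snd (h t) by apply Rmin_l.
    have [x [_ hx]] : exists x, Rmin s t <= x <= Rmax s t /\ snd (h x) = y.
      have cs : continuity (fun t => snd (h t)).
        move=> x; apply continuity_pt_filterlim; exact: ccont_snd (ch x).
      have ry : Rmin (snd (h s)) (snd (h t)) <= y <= Rmax (snd (h s)) (snd (h t)).
        by rewrite Rmin_left ?Rmax_right; lra.
      have [x [h1 h2]] := IVT_gen (fun t => snd (h t)) s t y cs ry.
      by exists x.
    have a : cos y = 1 by rewrite -hx c1.
    have s0 : sin (snd (h s)) = 0.
      have := sin2_cos2 (snd (h s)); rewrite c1 /Rsqr => e; nra.
    have : cos (y - snd (h s)) = 1.
      rewrite cos_minus a c1 s0; ring.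
    have := cos_decreasing_1 0 (y - snd (h s)).
    have := PI2_1; rewrite cos_0 => p h1 h2.
    have := h1 ltac:(lra) ltac:(lra) ltac:(lra) ltac:(lra) ltac:(lra); lra.
  move=> s t; rewrite (surjective_pairing (h s)) (surjective_pairing (h t)) !f0; f_equal.
  case: (Rtotal_order (snd (h s)) (snd (h t))) => [/key //|[//|/key //]].
Qed.

Lemma Wiener_of_fseries nu c : beurling_weight nu -> in_W nu c ->
  exists M, Wiener nu all_freq (fun u => fseries c (cexp u)) M.
Proof.
  move=> Hnu hc.
  have n0 j : 0 <= nu j by have := om_ge1 nu Hnu j; lra.
  have [M hM] := in_W_bnd nu c n0 hc.
  exists M, c; split; [by move=> j h; case: (h I) | split => //].
  move=> u du.
  have sm : summable (fun j => Cmult (c j) (ez j u)).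
    exists M; apply: bnd_le hM => j; by apply Wiener_term_le.
  have [s us] := usum_exists _ sm.
  have -> : fseries c (cexp u) = s; last done.
  apply CZsum_usum.
    have [K hK] := sm; exists K; apply: bnd_le hK => j; rewrite Cpowz_cexp; apply Rle_refl.
  apply: usum_ext us => j; by rewrite Cpowz_cexp.
Qed.

(** [wiener_levy] gives another continuous logarithm i m t + g(it), so L differs from it by a
    constant. Both L and g have period 2 pi on the circle, which forces m = 0; the constant is
    absorbed in g. *)
Lemma Wiener_cont_log nu c L : beurling_weight nu -> in_W nu c ->
  (forall z, in_annulus nu z -> fseries c z <> RtoC 0) ->
  is_cont_log (fun t => fseries c (cis t)) L ->
  exists g N, Wiener nu all_freq g N /\ forall t, L t = g (0, t).
Proof.
  move=> Hnu hc nz [cL [pL eL]].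
  have [M hM] := Wiener_of_fseries nu c Hnu hc.
  have [A0 [hdom _]] := A_nu_spec nu Hnu.
  have nz' u : dom nu u -> fseries c (cexp u) <> RtoC 0.
    move=> /hdom /Rabs_le_between [h1 h2]; apply nz; rewrite /in_annulus Cmod_cexp.
    by split; apply exp_le.
  have [m [g [N [hg eg]]]] := wiener_levy nu _ M Hnu hM nz'.
  have gcont t := Wiener_continuous nu Hnu all_freq g N t hg.
  pose h t := Cplus (L t) (Copp (Cplus (Cmult (RtoC (IZR m)) (0, t)) (g (0, t)))).
  have ch t : continuous h t.
    apply ccont_plus => //.
    apply ccont_opp, ccont_plus => //.
    apply ccont_mult; first by apply ccont_const.
    apply ccont_pair => /=; [apply continuous_const | apply continuous_id].
  have eh t : cexp (h t) = RtoC 1.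
    have dt := dom_circle nu Hnu t.
    rewrite /h cexp_add eL cis_cexp (eg _ dt) -cexp_add -cexp_add Cplus_opp_r; exact: cexp_0.
  have hc0 := cexp_eq1_constant h ch eh.
  have gper : g (0, 0 + 2 * PI) = g (0, 0).
    have [a [_ [_ ua]]] := hg.
    apply: (usum_unique _ _ _ (ua _ (dom_circle nu Hnu _))).
    apply: usum_ext (ua _ (dom_circle nu Hnu 0)) => j.
    rewrite -(ez_period j (0, 0) 1); do 2 f_equal.
    rewrite /Cplus /=; f_equal; ring.
  have m0 : IZR m = 0.
    have := f_equal snd (hc0 (0 + 2 * PI) 0).
    rewrite /h pL gper /=.
    have := PI_RGT_0 => P h1.
    have : IZR m * (2 * PI) = 0 by lra.
    move/Rmult_integral => [] //; lra.
  exists (fun u => Cplus (g u) (h 0)), (N + Cmod (h 0) * nu 0%Z); split.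
    exact: (Wiener_plus nu Hnu _ _ _ _ _ hg (Wiener_const nu Hnu all_freq submonoid_all (h 0))).
  move=> t; rewrite (hc0 0 t) /h m0 Cmult_0_l; ring.
Qed.

(** * Boundary values of the Szego function *)

(** Multipliers range over [0, 1] instead of {0, 1}, since the zeroth coefficient of log w has to be
    halved. *)
Lemma Wiener_mask om (Hom : beurling_weight om) f M (phi : Z -> R) (Sp : Z -> Prop) :
  (forall j, 0 <= phi j <= 1) -> (forall j, ~ Sp j -> phi j = 0) ->
  Wiener om all_freq f M -> exists F, Wiener om Sp F M /\
    forall j, coef F j = Cmult (RtoC (phi j)) (coef f j).
Proof.
  move=> h1 h2 hf; have [_ [bc uc]] := Wiener_coef om Hom _ _ _ hf.
  pose c j := Cmult (RtoC (phi j)) (coef f j).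
  have cle j : Cmod (c j) <= Cmod (coef f j).
    rewrite Cmod_mult Cmod_R Rabs_right; last by apply Rle_ge, h1.
    have := h1 j; have := Cmod_ge_0 (coef f j); nra.
  have bc' : bnd (fun j => om j * Cmod (c j)) M.
    apply: bnd_le bc => j; apply Rmult_le_compat_l => //.
    have := om_ge1 om Hom j; lra.
  have ch u : exists s, dom om u -> is_usum (fun j => Cmult (c j) (ez j u)) s.
    case: (classic (dom om u)) => du; last by exists (RtoC 0).
    have [s us] : exists s, is_usum (fun j => Cmult (c j) (ez j u)) s; last by exists s.
    apply usum_exists; exists M; apply: bnd_le bc' => j; by apply Wiener_term_le.
  pose F u := proj1_sig (constructive_indefinite_description _ (ch u)).
  have uF u : dom om u -> is_usum (fun j => Cmult (c j) (ez j u)) (F u).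
    exact: (proj2_sig (constructive_indefinite_description _ (ch u))).
  exists F; split.
    exists c; split => // j hj; rewrite /c h2 //; ring.
  move=> j; apply (fourier_usum c M); first exact: (Wiener_l1 om Hom _ _ bc').
  move=> t; apply (uF (0, t)); by apply dom_circle.
Qed.

(** The multiplier hidden in the Szego integral: the kernel (1 + q) / (1 - q) = 1 + 2 q + 2 q^2 +
    ..., normalized by 1 / (4 pi), gives weight 1 / 2 to the mean and 1 to the other frequencies of
    one sign. *)
Definition half_pos (j : Z) : R :=
  if Z_lt_dec j 0 then 0 else if Z.eq_dec j 0 then / 2 else 1.

Lemma half_pos_bound j : 0 <= half_pos j <= 1.
Proof. rewrite /half_pos; case: Z_lt_dec => _; [lra | case: Z.eq_dec => _; lra]. Qed.

Lemma half_pos_neg j : (j < 0)%Z -> half_pos j = 0.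
Proof. by rewrite /half_pos; case: Z_lt_dec. Qed.

Lemma half_pos_pos j : (0 < j)%Z -> half_pos j = 1.
Proof. rewrite /half_pos; case: Z_lt_dec => h1 h2; [lia | case: Z.eq_dec => h3 //; lia]. Qed.

Lemma half_pos_0 : half_pos 0 = / 2.
Proof. by []. Qed.

Lemma half_pos_sym j : half_pos j + half_pos (- j) = 1.
Proof.
  case: (Z.lt_trichotomy j 0) => [h|[->|h]].
  - rewrite half_pos_neg // half_pos_pos; [ring | lia].
  - rewrite half_pos_0; field.
  - rewrite half_pos_pos // half_pos_neg; [ring | lia].
Qed.

(* [2 * half_pos k] is [1] for [k = 0] and [2] for [k > 0]. *)
Lemma kernel_series q : Cmod q < 1 ->
  is_usum (fun k => Cmult (RtoC (2 * half_pos (Z.of_nat k))) (pow_n q k)) (Cdiv (Cplus 1 q) (Cminus 1 q)).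
Proof.
  move=> hq; have [G [uG eG]] := geom_series q hq.
  have n0 : Cminus 1 q <> RtoC 0.
    move=> e; have := Cmod_1; rewrite -eG e Cmult_0_r Cmod_0; lra.
  have -> : Cdiv (Cplus 1 q) (Cminus 1 q) = Cplus (Cmult 2 G) (Copp 1).
    have -> : G = Cinv (Cminus 1 q).
      transitivity (Cmult (Cmult G (Cminus 1 q)) (Cinv (Cminus 1 q))); [field => // | rewrite eG; ring].
    field => //.
  have u0 : is_usum (fun k : nat => if Nat.eq_dec k 0 then Copp 1 else RtoC 0) (Copp 1).
    apply (usum_single (fun k : nat => if Nat.eq_dec k 0 then Copp 1 else RtoC 0) 0%nat) => i hi.
    by case: Nat.eq_dec.
  apply: usum_ext (usum_plus _ _ _ _ (usum_scal 2 _ _ uG) u0) => k.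
  case: Nat.eq_dec => h.
    subst k; rewrite half_pos_0 Rinv_r; last lra.
    rewrite -[pow_n q 0]/(RtoC 1); ring.
  rewrite half_pos_pos; last lia.
  rewrite Rmult_1_r; ring.
Qed.

Lemma pow_n_mult_ez (a : C) s u k :
  pow_n (Cmult a (ez s u)) k = Cmult (pow_n a k) (ez (s * Z.of_nat k) u).
Proof.
  elim: k => [|k IH].
    rewrite Z.mul_0_r ez_0 Cmult_1_r; reflexivity.
  have -> : (s * Z.of_nat (S k) = s + s * Z.of_nat k)%Z by lia.
  rewrite !pow_n_S IH ez_add.
  have E (x y z w : C) : Cmult (Cmult x y) (Cmult z w) = Cmult (Cmult x z) (Cmult y w) by ring.
  exact: E.
Qed.

Lemma pow_n_RtoC r k : pow_n (RtoC r) k = RtoC (r ^ k).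
Proof. elim: k => [|k IH]; [done | by rewrite pow_n_S IH -RtoC_mult]. Qed.

(** Absolute convergence makes Abel's theorem easy: for all r in [0, 1] one finite list leaves a
    tail of at most eps / 4, and the finite sum is continuous at r = 1. *)
Lemma abel_limit (e : nat -> C) M E1 eps : bnd (fun k => Cmod (e k)) M -> is_usum e E1 -> 0 < eps ->
  exists d, 0 < d /\ forall r E, 0 <= r <= 1 -> 1 - d < r ->
    is_usum (fun k => Cmult (RtoC (r ^ k)) (e k)) E -> Cmod (Cminus E E1) < eps.
Proof.
  move=> b u e0.
  have [l0 tail] := bnd_tail _ M (eps / 4) (fun k => Cmod_ge_0 (e k)) b ltac:(lra).
  pose S r := lsum (fun k => Cmult (RtoC (r ^ k)) (e k)) (cnodup l0).
  have cS : continuous S 1.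
    apply ccont_lsum => k; apply ccont_mult; last by apply ccont_const.
    apply ccont_pair => /=; last by apply continuous_const.
    apply (ex_derive_continuous (V := R_NormedModule)); by auto_derive.
  have [d [d0 hd]] := proj2 (ccont_eps S 1) cS (eps / 4) ltac:(lra).
  exists d; split => // r E hr hdr uE.
  have app s F : 0 <= s <= 1 -> is_usum (fun k => Cmult (RtoC (s ^ k)) (e k)) F -> Cmod (Cminus (S s) F) <= eps / 4.
    move=> hs uF; apply (usum_tail _ _ l0 (eps / 4) uF).
    - move=> l' nd dis; apply: Rle_trans (Rlt_le _ _ (tail l' nd dis)).
      apply rsum_le => k _; rewrite Cmod_mult Cmod_R Rabs_right; last by apply Rle_ge, pow_le; lra.
      have : s ^ k <= 1 by rewrite -(pow1 k); apply pow_incr.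
      have := Cmod_ge_0 (e k); nra.
    - apply NoDup_nodup.
    - apply incl_cnodup.
  have a1 := app r E hr uE.
  have a2 : Cmod (Cminus (S 1) E1) <= eps / 4.
    apply app; first lra.
    apply: usum_ext u => k; rewrite pow1 Cmult_1_l; done.
  have a3 := hd r ltac:(apply Rabs_def1; lra).
  have := Cmod_minus_triangle E (S r) E1.
  have := Cmod_minus_triangle (S r) (S 1) E1.
  rewrite (Cmod_minus_sym E (S r)); lra.
Qed.

Lemma cexp_filterlim (F : (R -> Prop) -> Prop) (FF : Filter F) (f : R -> C) E1 :
  (forall d, 0 < d -> F (fun r => exists E, f r = cexp E /\ Cmod (Cminus E E1) < d)) ->
  filterlim f F (locally (cexp E1)).
Proof.
  move=> H; apply filterlim_locally => eps.
  have cc : continuous (fun u : C => cexp u) E1 by apply ccont_cexp, continuous_id.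
  have [d hd] := proj1 (filterlim_locally _ _) cc eps.
  apply: filter_imp (H d (cond_pos d)) => r [E [-> hE]].
  exact: hd (ball_of_Cmod _ _ _ hE).
Qed.

(** The normalization 1 / (4 pi), the 2 of the kernel series and the 2 pi of the Fourier integral
    cancel. *)
Lemma quarter_pi (a b c : C) :
  Cmult (RtoC (/ (4 * PI))) (Cmult (Cmult (Cmult (RtoC 2) a) b) (Cmult (RtoC (2 * PI)) c)) =
  Cmult (Cmult a b) c.
Proof.
  have P := PI_RGT_0.
  have e : Cmult (RtoC (/ (4 * PI))) (Cmult (RtoC 2) (RtoC (2 * PI))) = RtoC 1.
    rewrite -!RtoC_mult; f_equal; field; lra.
  transitivity (Cmult (Cmult (RtoC (/ (4 * PI))) (Cmult (RtoC 2) (RtoC (2 * PI)))) (Cmult (Cmult a b) c)).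
    ring.
  rewrite e; ring.
Qed.

Lemma cis_ez t : cis t = ez 1 (0, t).
Proof. by rewrite ez_1 cis_cexp. Qed.

Lemma ez_opp_mul j u : Cmult (ez j u) (ez (- j) u) = RtoC 1.
Proof. by rewrite -ez_add Z.add_opp_diag_r ez_0. Qed.

Section Szego.
Context (nu : Z -> R) (Hnu : beurling_weight nu) (g : C -> C) (N : R).
Hypothesis hg : Wiener nu all_freq g N.

Let l := coef g.

(** One integrand for both sides of the circle: inside kap = z and s = -1; outside kap = 1 / z and s
    = 1, with a change of sign. Always |kap| < 1. *)
Let kernel kap s t :=
  Cmult (g (0, t)) (Cdiv (Cplus 1 (Cmult kap (ez s (0, t)))) (Cminus 1 (Cmult kap (ez s (0, t))))).

(** Expand the kernel in powers of kap exp (i s t) and integrate termwise; the k-th term picks the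
    Fourier coefficient of g of index - s k. *)
Lemma kernel_RInt kap s : Cmod kap < 1 -> (forall t, continuous (kernel kap s) t) /\
  is_usum (fun k => Cmult (Cmult (RtoC (2 * half_pos (Z.of_nat k))) (pow_n kap k))
                     (Cmult (RtoC (2 * PI)) (l (- (s * Z.of_nat k))%Z)))
   (CRInt (kernel kap s) 0 (2 * PI)).
Proof.
  move=> hk.
  have [_ [bc uc]] := Wiener_coef nu Hnu _ _ _ hg.
  have b1 := Wiener_l1 nu Hnu _ _ bc.
  have uc' t : is_usum (fun j => Cmult (coef g j) (cexp (Cmult (RtoC (IZR j)) (0, t)))) (g (0, t)).
    exact: (uc (0, t) (dom_circle nu Hnu t)).
  pose a k := Cmult (RtoC (2 * half_pos (Z.of_nat k))) (pow_n kap k).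
  pose G j t := Cmult (cexp (Cmult (RtoC (IZR j)) (0, t))) (g (0, t)).
  pose f k t := Cmult (a k) (G (s * Z.of_nat k)%Z t).
  have e1 j t : Cmod (ez j (0, t)) = 1 by rewrite Cmod_ez /= Rmult_0_r exp_0.
  have gc t := Wiener_continuous nu Hnu _ _ _ t hg.
  have Gc j t : continuous (G j) t.
    apply ccont_mult => //; apply ccont_trig.
  have N0 := Wiener_ge0 _ _ _ _ hg.
  have am k : Cmod (a k) <= 2 * Cmod kap ^ k.
    rewrite Cmod_mult Cmod_R Cmod_pow_n Rabs_right; last by have := half_pos_bound (Z.of_nat k); lra.
    apply Rmult_le_compat_r; first by apply pow_le, Cmod_ge_0.
    have := half_pos_bound (Z.of_nat k); lra.
  have fm k t : Cmod (f k t) <= 2 * N * Cmod kap ^ k.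
    rewrite /f Cmod_mult [Cmod (G _ _)]Cmod_mult.
    have := e1 (s * Z.of_nat k)%Z t; rewrite /ez => ->; rewrite Rmult_1_l.
    apply (Rle_trans _ (2 * Cmod kap ^ k * N)); last lra.
    have gN : Cmod (g (0, t)) <= N by exact: (Wiener_sup nu _ _ _ (0, t) hg (dom_circle nu Hnu t)).
    apply Rmult_le_compat; [apply Cmod_ge_0 | apply Cmod_ge_0 | apply am | exact: gN].
  have bm : bnd (fun k => 2 * N * Cmod kap ^ k) (2 * N * / (1 - Cmod kap)).
    apply bnd_scal; [lra | apply bnd_geom; split => //; apply Cmod_ge_0].
  have fc k t : continuous (f k) t by apply ccont_mult => //; apply ccont_const.
  have fF t : is_usum (fun k => f k t) (kernel kap s t).
    have hq : Cmod (Cmult kap (ez s (0, t))) < 1 by rewrite Cmod_mult e1 Rmult_1_r.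
    apply: usum_ext (usum_scal (g (0, t)) _ _ (kernel_series _ hq)) => k.
    rewrite /f /G /a.
    rewrite pow_n_mult_ez /ez; ring.
  have P := PI_RGT_0.
  split; first exact: (usum_continuous f _ _ _ fm bm fc fF).
  apply: usum_ext (usum_RInt f _ _ _ fm bm fc fF 0 (2 * PI) ltac:(lra)) => k.
  have := trig_RInt l N (fun t => g (0, t)) (s * Z.of_nat k)%Z 0 b1 uc'.
  rewrite Rplus_0_l => e.
  rewrite -/(a k) -e; apply (is_RInt_unique (V := C_R_CompleteNormedModule)).
  apply CRInt_scal, ccont_RInt, Gc.
Qed.

Lemma Szego_inside L r t E : (forall t, L t = g (0, t)) -> 0 < r < 1 ->
  is_usum (fun k => Cmult (RtoC (r ^ k))
     (Cmult (Cmult (RtoC (half_pos (Z.of_nat k))) (l (Z.of_nat k))) (ez (Z.of_nat k) (0, t)))) E ->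
  Szego L (Cmult (RtoC r) (cis t)) = cexp E.
Proof.
  move=> hL hr uE; rewrite /Szego; f_equal.
  set z := Cmult (RtoC r) (cis t).
  have mz : Cmod z < 1.
    rewrite /z Cmod_mult Cmod_R cis_cexp Cmod_cexp /= exp_0 Rabs_right; lra.
  have -> : CRInt (fun x => Cmult (L x) (Cdiv (Cplus (cis x) z) (Cminus (cis x) z))) 0 (2 * PI) =
     CRInt (kernel z (-1)) 0 (2 * PI).
    apply (RInt_ext (V := C_R_CompleteNormedModule)) => x _; rewrite hL /kernel; f_equal.
    have e := ez_opp_mul 1 (0, x); rewrite -cis_ez in e.
    set y := ez (-1) (0, x) in e *.
    have nz w : Cmod w < 1 -> Cminus 1 w <> RtoC 0.
      move=> hw e0; have : w = RtoC 1 by transitivity (Cminus 1 (Cminus 1 w)); [ring | rewrite e0; ring].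
      move=> ew; rewrite ew Cmod_1 in hw; lra.
    have my : Cmod y = 1 by rewrite Cmod_ez /= Rmult_0_r exp_0.
    have n1 : Cminus 1 (Cmult z y) <> RtoC 0 by apply nz; rewrite Cmod_mult my; lra.
    have e2 : Cminus (cis x) z = Cmult (cis x) (Cminus 1 (Cmult z y)).
      transitivity (Cminus (cis x) (Cmult z (Cmult (cis x) y))); [rewrite e; ring | ring].
    have e3 : Cplus (cis x) z = Cmult (cis x) (Cplus 1 (Cmult z y)).
      transitivity (Cplus (cis x) (Cmult z (Cmult (cis x) y))); [rewrite e; ring | ring].
    have n2 : cis x <> RtoC 0 by rewrite cis_cexp; apply cexp_neq0.
    rewrite e2 e3; field; split => //.
  have := usum_scal (RtoC (/ (4 * PI))) _ _ (proj2 (kernel_RInt z (-1) mz)).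
  move/usum_unique; apply; apply: usum_ext uE => k.
  rewrite RtoC_mult quarter_pi /z cis_ez pow_n_mult_ez pow_n_RtoC.
  have -> : (- (-1 * Z.of_nat k) = Z.of_nat k)%Z by lia.
  rewrite Z.mul_1_l; ring.
Qed.

Lemma Szego_outside L r t E : (forall t, L t = g (0, t)) -> 1 < r ->
  is_usum (fun k => Cmult (RtoC ((/ r) ^ k))
     (Cmult (Cmult (RtoC (half_pos (Z.of_nat k))) (l (- Z.of_nat k)%Z)) (ez (- Z.of_nat k) (0, t)))) E ->
  Szego L (Cmult (RtoC r) (cis t)) = cexp (Copp E).
Proof.
  move=> hL hr uE; rewrite /Szego; f_equal.
  set z := Cmult (RtoC r) (cis t).
  pose k0 := Cmult (RtoC (/ r)) (ez (-1) (0, t)).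
  have ir : 0 < / r < 1 by split; [apply Rinv_0_lt_compat; lra | rewrite -Rinv_1; apply Rinv_lt_contravar; lra].
  have zk : Cmult z k0 = RtoC 1.
    have e := ez_opp_mul 1 (0, t); rewrite -cis_ez in e.
    transitivity (Cmult (RtoC (r * / r)) (Cmult (cis t) (ez (-1) (0, t)))).
      rewrite /z /k0 RtoC_mult; ring.
    rewrite -[ez (-1) _]/(ez (- (1)) (0, t)) e Rinv_r; [ring | lra].
  have mk : Cmod k0 < 1.
    rewrite /k0 Cmod_mult Cmod_R Cmod_ez /= Rmult_0_r exp_0 Rabs_right; lra.
  have -> : CRInt (fun x => Cmult (L x) (Cdiv (Cplus (cis x) z) (Cminus (cis x) z))) 0 (2 * PI) =
     Copp (CRInt (kernel k0 1) 0 (2 * PI)).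
    have -> : forall w : C, Copp w = Cmult (Copp 1) w by move=> w; ring.
    apply (is_RInt_unique (V := C_R_CompleteNormedModule)).
    apply (is_RInt_ext (V := C_R_CompleteNormedModule)
      (fun x => Cmult (Copp 1) (kernel k0 1 x))).
      move=> x _; rewrite hL /kernel -cis_ez.
      have n1 : Cminus 1 (Cmult k0 (cis x)) <> RtoC 0.
        move=> e0; have ew : Cmult k0 (cis x) = RtoC 1.
          transitivity (Cminus 1 (Cminus 1 (Cmult k0 (cis x)))); [ring | rewrite e0; ring].
        have := f_equal Cmod ew; rewrite Cmod_mult cis_cexp Cmod_cexp /= exp_0 Cmod_1; lra.
      have e2 : Cminus (cis x) z = Copp (Cmult z (Cminus 1 (Cmult k0 (cis x)))).
        transitivity (Cminus (Cmult (Cmult z k0) (cis x)) z); [rewrite zk; ring | ring].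
      have e3 : Cplus (cis x) z = Cmult z (Cplus 1 (Cmult k0 (cis x))).
        transitivity (Cplus (Cmult (Cmult z k0) (cis x)) z); [rewrite zk; ring | ring].
      have n2 : z <> RtoC 0 by move=> e0; have := Cmod_1; rewrite -zk e0 Cmult_0_l Cmod_0; lra.
      rewrite e2 e3.
      have E1 (x' p q w : C) : w <> RtoC 0 -> q <> RtoC 0 ->
        Cmult (Copp 1) (Cmult x' (Cdiv p q)) = Cmult x' (Cdiv (Cmult w p) (Copp (Cmult w q))).
        by move=> w0 q0; field; split.
      exact: E1.
    exact: (CRInt_scal _ _ _ _ _ (ccont_RInt _ _ _ (proj1 (kernel_RInt k0 1 mk)))).
  have -> : forall a w : C, Cmult a (Copp w) = Copp (Cmult a w) by move=> a w; ring.
  f_equal.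
  have := usum_scal (RtoC (/ (4 * PI))) _ _ (proj2 (kernel_RInt k0 1 mk)).
  move/usum_unique; apply; apply: usum_ext uE => k.
  rewrite RtoC_mult quarter_pi /k0 pow_n_mult_ez pow_n_RtoC.
  have -> : (- (1 * Z.of_nat k) = - Z.of_nat k)%Z by lia.
  have -> : (- (1) * Z.of_nat k = - Z.of_nat k)%Z by lia.
  ring.
Qed.
Lemma bnd_one_sided (s : Z) (b : nat -> R) t : (s <> 0)%Z -> (forall k, 0 <= b k <= 1) ->
  bnd (fun k : nat => Cmod (Cmult (Cmult (RtoC (b k)) (l (s * Z.of_nat k)%Z)) (ez (s * Z.of_nat k) (0, t)))) N.
Proof.
  move=> s0 hb.
  have [_ [bc _]] := Wiener_coef nu Hnu _ _ _ hg.
  have b1 := Wiener_l1 nu Hnu _ _ bc.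
  have := bnd_inj (fun k : nat => (s * Z.of_nat k)%Z) _ N _ b1.
  move=> h; apply: bnd_le (h _) => [k|x y e]; last nia.
  have e1 : Cmod (ez (s * Z.of_nat k) (0, t)) = 1 by rewrite Cmod_ez /= Rmult_0_r exp_0.
  rewrite Cmod_mult e1 Cmod_mult Cmod_R Rabs_right; last by apply Rle_ge, hb.
  have := hb k; have := Cmod_ge_0 (coef g (s * Z.of_nat k)); rewrite /l; nra.
Qed.

Lemma Szego_limit_inside L G M t : (forall t, L t = g (0, t)) ->
  Wiener nu (fun j => 0 <= j)%Z G M ->
  (forall j, coef G j = Cmult (RtoC (half_pos j)) (l j)) ->
  filterlim (fun r => Szego L (Cmult (RtoC r) (cis t))) (at_left 1) (locally (cexp (G (0, t)))).
Proof.
  move=> hL hG cG.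
  pose e k := Cmult (Cmult (RtoC (half_pos (Z.of_nat k))) (l (1 * Z.of_nat k)%Z)) (ez (1 * Z.of_nat k) (0, t)).
  have be : bnd (fun k => Cmod (e k)) N by apply bnd_one_sided => // k; apply half_pos_bound.
  have [sG [_ uG]] := Wiener_coef nu Hnu _ _ _ hG.
  have ue : is_usum e (G (0, t)).
    have h := usum_reindex Z.of_nat _ _ ltac:(move=> x y; lia) _ (uG _ (dom_circle nu Hnu t)).
    apply: usum_ext (h _) => [k|i hi]; first by rewrite /e cG !Z.mul_1_l.
    rewrite sG; [ring | move=> i0; apply (hi (Z.to_nat i)); lia].
  apply cexp_filterlim; first by typeclasses eauto.
  move=> eps e0.
  have [d [d0 hd]] := abel_limit e N _ eps be ue e0.
  (* The minimum with 1 keeps r positive. *)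
  have m0 : 0 < Rmin d 1 by apply Rmin_pos; lra.
  exists (mkposreal _ m0) => r hr r1.
  have hr' : Rabs (r - 1) < Rmin d 1 by exact: hr.
  have := Rmin_l d 1; have := Rmin_r d 1 => m1 m2.
  move/Rabs_def2: hr' => hr'.
  have [E uE] : exists E, is_usum (fun k => Cmult (RtoC (r ^ k)) (e k)) E.
    apply usum_exists; exists N; apply: bnd_le be => k.
    rewrite Cmod_mult Cmod_R Rabs_right; last by apply Rle_ge, pow_le; lra.
    have : r ^ k <= 1 by rewrite -(pow1 k); apply pow_incr; lra.
    have := Cmod_ge_0 (e k); nra.
  exists E; split; last by apply (hd r) => //; lra.
  apply Szego_inside => //; first lra.
  apply: usum_ext uE => k; by rewrite /e !Z.mul_1_l.
Qed.

Lemma Szego_limit_outside L G M t : (forall t, L t = g (0, t)) ->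
  Wiener nu (fun j => j <= 0)%Z G M ->
  (forall j, coef G j = Cmult (RtoC (half_pos (- j))) (l j)) ->
  filterlim (fun r => Szego L (Cmult (RtoC r) (cis t))) (at_right 1) (locally (cexp (Copp (G (0, t))))).
Proof.
  move=> hL hG cG.
  pose e k := Cmult (Cmult (RtoC (half_pos (Z.of_nat k))) (l (-1 * Z.of_nat k)%Z)) (ez (-1 * Z.of_nat k) (0, t)).
  have be : bnd (fun k => Cmod (e k)) N by apply bnd_one_sided => // k; apply half_pos_bound.
  have [sG [_ uG]] := Wiener_coef nu Hnu _ _ _ hG.
  have ue : is_usum e (G (0, t)).
    have h := usum_reindex (fun k => (-1 * Z.of_nat k)%Z) _ _ ltac:(move=> x y; cbv beta; lia) _ (uG _ (dom_circle nu Hnu t)).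
    apply: usum_ext (h _) => [k|i hi].
      rewrite /e cG; do 4 f_equal; lia.
    rewrite sG; [ring | move=> i0; apply (hi (Z.to_nat (- i))); lia].
  apply cexp_filterlim; first by typeclasses eauto.
  move=> eps e0.
  have [d [d0 hd]] := abel_limit e N _ eps be ue e0.
  exists (mkposreal _ d0) => r hr r1.
  have hr' : Rabs (r - 1) < d by exact: hr.
  move/Rabs_def2: hr' => hr'.
  have ir : 0 < / r <= 1.
    split; [apply Rinv_0_lt_compat; lra | rewrite -Rinv_1; apply Rinv_le_contravar; lra].
  have ir2 : 1 - d < / r.
    apply (Rmult_lt_reg_r r); first lra.
    rewrite Rinv_l; nra.
  have [E uE] : exists E, is_usum (fun k => Cmult (RtoC ((/ r) ^ k)) (e k)) E.
    apply usum_exists; exists N; apply: bnd_le be => k.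
    rewrite Cmod_mult Cmod_R Rabs_right; last by apply Rle_ge, pow_le; lra.
    have : (/ r) ^ k <= 1 by rewrite -(pow1 k); apply pow_incr; lra.
    have := Cmod_ge_0 (e k); nra.
  exists (Copp E); split.
    apply Szego_outside => //.
  have -> : Cminus (Copp E) (Copp (G (0, t))) = Copp (Cminus E (G (0, t))) by ring.
  rewrite Cmod_opp; apply (hd (/ r)) => //; lra.
Qed.

End Szego.

(** * The tail estimate *)

Lemma bnd_finite {I : Type} (f : I -> R) (l0 : list I) :
  (forall i, 0 <= f i) -> (forall i, ~ In i l0 -> f i = 0) -> bnd f (rsum f l0).
Proof.
  move=> f0 z l nd.
  pose l' := filter (fun i => if in_dec classic_eq_dec i l0 then true else false) l.
  have -> : rsum f l = rsum f l'.
    rewrite /l'; elim: l {nd l'} => //= a l ->.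
    case: in_dec => h //=; rewrite z //; ring.
  apply rsum_incl => //; first by apply NoDup_filter.
  move=> i; rewrite filter_In; by case: in_dec => h [].
Qed.

Lemma small_tail (a : nat -> C) A e : bnd (fun k => Cmod (a k)) A -> 0 < e ->
  exists N, forall N', (N <= N')%nat -> bnd (fun k => if le_dec N' k then Cmod (a k) else 0) e.
Proof.
  move=> bA e0.
  have [l0 tail] := bnd_tail _ A e (fun k => Cmod_ge_0 (a k)) bA e0.
  have [N inc] := nat_list_bounded l0.
  exists N => N' hN l nd.
  pose l' := filter (fun k => if le_dec N' k then true else false) l.
  have -> : rsum (fun k => if le_dec N' k then Cmod (a k) else 0) l = rsum (fun k => Cmod (a k)) l'.
    rewrite /l'; elim: l {nd l'} => //= k l ->.
    case: le_dec => h //=; ring.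
  apply Rlt_le, tail; first by apply NoDup_filter.
  move=> i; rewrite filter_In; case: le_dec => h [_ //] _ h1.
  have := inc i h1; rewrite in_seq; lia.
Qed.

Section TailEstimate.
(** In the application [al k] is a_(-k), [be k] is b_k, [phi n] is Phi_n(0) and [kap] is the zeroth
    coefficient of w_+. The entry [H n m] stands for frequency -(m + 1), which is why S m occurs in
    the indices. *)
Context (al be : nat -> C) (nu : nat -> R) (kap : C) (n0 : nat).
Context (f H : nat -> nat -> C) (phi : nat -> C).
Hypothesis nu1 : forall n, 1 <= nu n.
Hypothesis num : forall n k, (n <= k)%nat -> nu n <= nu k.
Hypothesis fsum : forall n, (n0 <= n)%nat -> summable (f n).
Hypothesis E1 : forall n k, (n0 <= n)%nat -> is_usum (fun m => Cmult (H n m) (be (n + k + S m)%nat))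
  (Cminus (if Nat.eq_dec k 0 then kap else RtoC 0) (f n k)).
Hypothesis E2 : forall n m, (n0 <= n)%nat ->
  is_usum (fun i => Cmult (f n i) (al (n + i + S m)%nat)) (Copp (H n m)).
Hypothesis E3 : forall n, (n0 <= n)%nat ->
  is_usum (fun i => Cmult (f n i) (al (n + i)%nat)) (Cmult (phi n) kap).

Section Window.
Context (N N1 : nat).
Hypothesis N0 : (n0 <= N)%nat.

(** The upper cutoff N1 leaves finitely many n, so that the antidiagonal sums have some finite bound
    before the contraction starts. The final bounds do not depend on N1. *)
Definition window n : R := if le_dec N n then if lt_dec n N1 then 1 else 0 else 0.

(* A bound on every [f n] separately would lose a factor [n]; the sums of [|f n i|] along the
   antidiagonals [n + i = q] contract. *)
Definition diag q n : R := window n * (if le_dec n q then Cmod (f n (q - n)) else 0).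

Lemma window_cases n : (window n = 1 /\ (N <= n)%nat) \/ window n = 0.
Proof. rewrite /window; case: le_dec => h; [case: lt_dec => h' | ]; tauto. Qed.

Lemma window_ge0 n : 0 <= window n.
Proof. case: (window_cases n) => [[-> _]|->]; lra. Qed.

Lemma diag_ge0 q n : 0 <= diag q n.
Proof.
  apply Rmult_le_pos; first by apply window_ge0.
  case: le_dec => _; [apply Cmod_ge_0 | lra].
Qed.

(** Group the terms of [E2] by q = n + i: the coefficient [al (q + m + 1)] is then independent of n,
    and the sum over n of |f n (q - n)| is at most [z]. As the index of [al] is at least n, the
    weight [om n] moves onto it. *)
Lemma H_bound (om a' : nat -> R) T z m : (forall n, 0 <= om n) -> (forall k, 0 <= a' k) ->
  (forall n k, (n <= k)%nat -> om n * Cmod (al k) <= a' k) ->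
  bnd (fun k => if le_dec N k then a' k else 0) T ->
  (forall q, bnd (diag q) z) ->
  bnd (fun n => window n * om n * Cmod (H n m)) (z * T).
Proof.
  move=> om0 a0 hom bT hz.
  have z0 := bnd_ge0 _ _ (hz 0%nat).
  pose F (p : nat * nat) := if le_dec N (fst p)
     then Cmult (f (fst p) (snd p)) (al (fst p + snd p + S m)%nat) else RtoC 0.
  pose g n := if le_dec N n then Copp (H n m) else RtoC 0.
  have rows n : is_usum (fun i => F (n, i)) (g n).
    rewrite /F /g /=; case: le_dec => h; first by apply E2; lia.
    by apply (usum_single (fun _ : nat => RtoC 0) 0%nat).
  pose a2 q := if le_dec N (q + S m) then a' (q + S m)%nat else 0.
  have a20 q : 0 <= a2 q by rewrite /a2; case: le_dec => _; [apply a0 | lra].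
  have ba2 : bnd a2 T.
    by apply (bnd_inj (fun q => (q + S m)%nat) (fun k => if le_dec N k then a' k else 0)) => // x y; lia.
  have b2 : bnd (fun p : nat * nat => diag (fst p) (snd p) * a2 (fst p)) (z * T).
    apply (bnd_prod _ (fun q => z * a2 q)) => /=.
    - move=> p; apply Rmult_le_pos => //; apply diag_ge0.
    - move=> q; rewrite Rmult_comm; apply: bnd_le (bnd_scal _ _ _ (a20 q) (hz q)) => n; lra.
    - by apply bnd_scal.
  have w0 n : 0 <= window n * om n by apply Rmult_le_pos => //; apply window_ge0.
  have bF : bnd (fun p => window (fst p) * om (fst p) * Cmod (F p)) (z * T).
    have := bnd_inj (fun p : nat * nat => ((fst p + snd p)%nat, fst p)) _ _ _ b2.
    move=> h; apply: bnd_le (h _) => [[n i]|[n i] [n' i'] /= [e1 e2]]; last by f_equal; lia.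
    rewrite /diag /F /a2 /=.
    case: (window_cases n) => [[-> h1]| ->]; last by rewrite !Rmult_0_l; lra.
    case: le_dec => // h2; case: le_dec => h3; last lia.
    case: le_dec => h4; last lia.
    have -> : (n + i - n = i)%nat by lia.
    rewrite Cmod_mult.
    have := hom n (n + i + S m)%nat ltac:(lia); have := Cmod_ge_0 (f n i); nra.
  have := fubini_bnd F g (fun n => window n * om n) _ w0 bF rows.
  apply bnd_le => n; rewrite /g.
  case: (window_cases n) => [[-> h1]| ->]; last by rewrite !Rmult_0_l; lra.
  case: le_dec => // _; rewrite Cmod_opp; lra.
Qed.

(** In [E1] with k = q - n the coefficient is [be (q + m + 1)], independent of n, so the sum over n
    of the |H n m| can be taken first. The additional weight [om' n] moves onto [be] because q >=
    n. *)
Lemma f_bound (om om' b' : nat -> R) T z q : (forall n, 0 <= om n) -> (forall n, 0 <= om' n) ->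
  (forall k, 0 <= b' k) ->
  (forall n k, (n <= k)%nat -> om' n * Cmod (be k) <= b' k) ->
  bnd (fun k => if le_dec N k then b' k else 0) T ->
  (forall m, bnd (fun n => window n * om n * Cmod (H n m)) z) ->
  bnd (fun n => window n * (om n * om' n) * (if le_dec n q then
     Cmod (Cminus (if Nat.eq_dec (q - n) 0 then kap else RtoC 0) (f n (q - n))) else 0)) (z * T).
Proof.
  move=> om0 om0' b0 hom bT hz.
  have z0 := bnd_ge0 _ _ (hz 0%nat).
  (* The guard n <= q protects the truncated subtraction q - n. *)
  pose good n := andb (Nat.leb N n) (Nat.leb n q).
  pose F (p : nat * nat) := if good (fst p)
     then Cmult (H (fst p) (snd p)) (be (q + S (snd p))%nat) else RtoC 0.
  pose g n := if good n then Cminus (if Nat.eq_dec (q - n) 0 then kap else RtoC 0) (f n (q - n)) else RtoC 0.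
  have goodP n : good n = true -> (N <= n <= q)%nat.
    by move/andb_prop => [/Nat.leb_le h1 /Nat.leb_le h2].
  have rows n : is_usum (fun i => F (n, i)) (g n).
    rewrite /F /g /=; case E: (good n).
      have h := goodP n E; have := E1 n (q - n) ltac:(lia).
      by have -> : (n + (q - n) = q)%nat by lia.
    by apply (usum_single (fun _ : nat => RtoC 0) 0%nat).
  pose b2 m := if le_dec N (q + S m) then b' (q + S m)%nat else 0.
  have b20 m : 0 <= b2 m by rewrite /b2; case: le_dec => _; [apply b0 | lra].
  have bb2 : bnd b2 T.
    by apply (bnd_inj (fun m => (q + S m)%nat) (fun k => if le_dec N k then b' k else 0)) => // x y; lia.
  have bb : bnd (fun p : nat * nat => window (snd p) * om (snd p) * Cmod (H (snd p) (fst p)) * b2 (fst p)) (z * T).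
    apply (bnd_prod _ (fun m => z * b2 m)) => /=.
    - move=> p; apply Rmult_le_pos => //; apply Rmult_le_pos; last by apply Cmod_ge_0.
      apply Rmult_le_pos => //; apply window_ge0.
    - move=> m; rewrite Rmult_comm; apply: bnd_le (bnd_scal _ _ _ (b20 m) (hz m)) => n; lra.
    - by apply bnd_scal.
  have w0 n : 0 <= window n * (om n * om' n).
    apply Rmult_le_pos; [apply window_ge0 | by apply Rmult_le_pos].
  have bF : bnd (fun p => window (fst p) * (om (fst p) * om' (fst p)) * Cmod (F p)) (z * T).
    apply: bnd_le (bnd_swap _ _ bb) => -[n m]; rewrite /F /=.
    have h2 : 0 <= window n * om n * Cmod (H n m).
      apply Rmult_le_pos; last by apply Cmod_ge_0.
      apply Rmult_le_pos => //; apply window_ge0.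
    case E: (good n); last by rewrite Cmod_0 Rmult_0_r; apply Rmult_le_pos.
    have h := goodP n E; rewrite /b2; case: le_dec => h'; last lia.
    rewrite Cmod_mult.
    have := hom n (q + S m)%nat ltac:(lia) => h1.
    have := Rmult_le_compat_l _ _ _ h2 h1; lra.
  have := fubini_bnd F g (fun n => window n * (om n * om' n)) _ w0 bF rows.
  apply bnd_le => n; rewrite /g /good.
  case: (window_cases n) => [[-> h1]| ->]; last by rewrite !Rmult_0_l; lra.
  have -> : Nat.leb N n = true by apply Nat.leb_le.
  case: le_dec => h2 /=.
    have -> : Nat.leb n q = true by apply Nat.leb_le.
    lra.
  have -> : Nat.leb n q = false by apply Nat.leb_gt; lia.
  rewrite Cmod_0; lra.
Qed.

(** One passage through [E2] and [E1] with weights 1. The term [kap] of [E1] appears on an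
    antidiagonal only at n = q, hence contributes |kap| once. *)
Lemma diag_step z ta tb : (forall q, bnd (diag q) z) ->
  bnd (fun k => if le_dec N k then Cmod (al k) else 0) ta ->
  bnd (fun k => if le_dec N k then Cmod (be k) else 0) tb ->
  forall q, bnd (diag q) (Cmod kap + z * ta * tb).
Proof.
  move=> hz ba bb q.
  have one0 (n : nat) : 0 <= 1 by lra.
  have h1 m := H_bound (fun _ => 1) (fun k => Cmod (al k)) ta z m one0
    (fun k => Cmod_ge_0 _) (fun n k _ => Req_le _ _ (Rmult_1_l _)) ba hz.
  have h2 := f_bound (fun _ => 1) (fun _ => 1) (fun k => Cmod (be k)) tb (z * ta) q one0 one0
    (fun k => Cmod_ge_0 _) (fun n k _ => Req_le _ _ (Rmult_1_l _)) bb h1.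
  have h3 : bnd (fun n => if Nat.eq_dec n q then Cmod kap else 0) (Cmod kap).
    have := bnd_finite (fun n => if Nat.eq_dec n q then Cmod kap else 0) (q :: nil).
    rewrite /=; case: Nat.eq_dec => // _; rewrite Rplus_0_r; apply.
      move=> i; case: Nat.eq_dec => _; [apply Cmod_ge_0 | lra].
    move=> i hi; case: Nat.eq_dec => // e; case: hi; by left.
  apply: bnd_le (bnd_plus _ _ _ _ h3 h2) => n; rewrite /diag.
  have k0 := Cmod_ge_0 kap.
  have key : window n <= 1 by case: (window_cases n) => [[-> _]|->]; lra.
  have w0 := window_ge0 n.
  case: le_dec => h; last by case: Nat.eq_dec => _; lra.
  set d := Cminus _ _.
  have d0 := Cmod_ge_0 d.
  have : Cmod (f n (q - n)) <= Cmod (if Nat.eq_dec (q - n) 0 then kap else RtoC 0) + Cmod d.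
    have -> : f n (q - n) = Cplus (if Nat.eq_dec (q - n) 0 then kap else RtoC 0) (Copp d) by rewrite /d; ring.
    apply: Rle_trans (Cmod_triangle _ _) _; rewrite Cmod_opp; lra.
  have f0 := Cmod_ge_0 (f n (q - n)).
  case: (Nat.eq_dec (q - n) 0) => e1; case: (Nat.eq_dec n q) => e2; try lia; rewrite ?Cmod_0; nra.
Qed.

(** The map z -> |kap| + z / 2 has the fixed point 2 |kap|; iterating from any finite bound z gives
    2 |kap| + z / 2^j. *)
Lemma diag_bound ta tb :
  bnd (fun k => if le_dec N k then Cmod (al k) else 0) ta ->
  bnd (fun k => if le_dec N k then Cmod (be k) else 0) tb ->
  ta * tb <= / 2 -> forall q, bnd (diag q) (2 * Cmod kap).
Proof.
  move=> ba bb ht.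
  have k0 := Cmod_ge_0 kap.
  (* The starting bound adds up the bounds of the finitely many rows in the window. It depends on
     N1, and the iteration removes it. *)
  have [z hz] : exists z, forall q, bnd (diag q) z.
    have ch n : exists K, 0 <= K /\ ((N <= n)%nat -> forall i, Cmod (f n i) <= K).
      case: (le_dec N n) => h; last by exists 0; split; [lra | lia].
      have [K hK] := fsum n ltac:(lia).
      exists K; split; first exact: bnd_ge0 hK.
      move=> _ i; exact: (bnd_term _ _ i hK).
    pose K n := proj1_sig (constructive_indefinite_description _ (ch n)).
    have hK n : 0 <= K n /\ ((N <= n)%nat -> forall i, Cmod (f n i) <= K n).
      exact: (proj2_sig (constructive_indefinite_description _ (ch n))).
    exists (rsum (fun n => window n * K n) (seq 0 N1)) => q.
    apply (bnd_le _ (fun n => window n * K n)).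
      move=> n; rewrite /diag; case: (window_cases n) => [[-> h1]| ->]; last by rewrite !Rmult_0_l; lra.
      have := hK n; case: le_dec => h [h2 h3]; last lra.
      have := h3 h1 (q - n)%nat; lra.
    apply bnd_finite => n.
      apply Rmult_le_pos; [apply window_ge0 | apply hK].
    rewrite in_seq /window => h; case: le_dec => h1; last ring.
    case: lt_dec => h2; [lia | ring].
  have z0 := bnd_ge0 _ _ (hz 0%nat).
  have iter j : forall q, bnd (diag q) (2 * Cmod kap + z * (/ 2) ^ j).
    elim: j => [|j IH] q; first by apply: bnd_le_r (hz q); rewrite /=; lra.
    apply: bnd_le_r (diag_step _ _ _ IH ba bb q).
    have p0 : 0 <= (/ 2) ^ j by apply pow_le; lra.
    have ta0 := bnd_ge0 _ _ ba; have tb0 := bnd_ge0 _ _ bb.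
    rewrite Rmult_assoc /=.
    have h : 0 <= 2 * Cmod kap + z * (/ 2) ^ j by nra.
    have := Rmult_le_compat_l _ _ _ h ht; lra.
  move=> q l nd; apply le_epsilon => e e0.
  have [j hj] := pow_lt_1_zero (/ 2) ltac:(rewrite Rabs_right; lra) (e / (z + 1)) ltac:(apply Rdiv_lt_0_compat; lra).
  have := hj j (le_n _); have p0 : 0 <= (/ 2) ^ j by apply pow_le; lra.
  rewrite Rabs_right; last lra.
  move=> h; have := iter j q l nd.
  have : z * (/ 2) ^ j <= z * (e / (z + 1)) by apply Rmult_le_compat_l; lra.
  have -> : z * (e / (z + 1)) = e - e / (z + 1) by field; lra.
  have : 0 < e / (z + 1) by apply Rdiv_lt_0_compat; lra.
  lra.
Qed.

Lemma bnd_mask (a : nat -> R) A : (forall k, 0 <= a k) -> bnd a A ->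
  bnd (fun k => if le_dec N k then a k else 0) A.
Proof. move=> a0; apply bnd_le => k; case: le_dec => _; [lra | apply a0]. Qed.

(* Summation over [y = n + k] turns [nu_n^3] into [nu_y * nu_(y+m+1) * nu_(n+m+1+i)]. *)
Lemma window_estimate ta tb A B :
  bnd (fun k => if le_dec N k then Cmod (al k) else 0) ta ->
  bnd (fun k => if le_dec N k then Cmod (be k) else 0) tb ->
  ta * tb <= / 2 ->
  bnd (fun k => nu k * Cmod (al k)) A -> bnd (fun k => nu k * Cmod (be k)) B ->
  bnd (fun n => window n * nu n ^ 3 * Cmod (Cmult kap (Cminus (phi n) (al n))))
      (2 * Cmod kap * A * B * A).
Proof.
  move=> ba bb ht bA bB.
  have hz := diag_bound ta tb ba bb ht.
  have n0' n : 0 <= nu n by have := nu1 n; lra.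
  have pa (a : nat -> C) k : 0 <= nu k * Cmod (a k) by apply Rmult_le_pos => //; apply Cmod_ge_0.
  have hom (a : nat -> C) n k : (n <= k)%nat -> nu n * Cmod (a k) <= nu k * Cmod (a k).
    move=> h; apply Rmult_le_compat_r; [apply Cmod_ge_0 | by apply num].
  have h1 m := H_bound nu _ A _ m n0' (pa al) (hom al) (bnd_mask _ _ (pa al) bA) hz.
  have h2 q := f_bound nu nu _ B _ q n0' n0' (pa be) (hom be) (bnd_mask _ _ (pa be) bB) h1.
  (* Subtracting [E3] from its leading term gives kap (phi n - al n) = - sum over k of d n k times
     al (n + k). Here d is itself given by [E1] and H by [E2]: these are the three factors. *)
  pose d n k := Cminus (if Nat.eq_dec k 0 then kap else RtoC 0) (f n k).
  pose F (p : nat * nat) := if le_dec N (fst p)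
     then Cmult (d (fst p) (snd p)) (al (fst p + snd p)%nat) else RtoC 0.
  pose g n := if le_dec N n then Copp (Cmult kap (Cminus (phi n) (al n))) else RtoC 0.
  have rows n : is_usum (fun i => F (n, i)) (g n).
    rewrite /F /g /=; case: le_dec => h; last by apply (usum_single (fun _ : nat => RtoC 0) 0%nat).
    have u1 := usum_scal (Copp 1) _ _ (E3 n ltac:(lia)).
    have u2 := usum_single (fun k => Cmult (if Nat.eq_dec k 0 then kap else RtoC 0) (al (n + k)%nat)) 0%nat.
    have {}u2 := u2 ltac:(move=> i hi; case: Nat.eq_dec => // _; ring).
    have -> : Copp (Cmult kap (Cminus (phi n) (al n))) =
       Cplus (Cmult (if Nat.eq_dec 0 0 then kap else 0) (al (n + 0)%nat)) (Cmult (Copp 1) (Cmult (phi n) kap)).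
      rewrite Nat.add_0_r; case: Nat.eq_dec => // _; ring.
    apply: usum_ext (usum_plus _ _ _ _ u2 u1) => k; rewrite /d; ring.
  have T0 : 0 <= 2 * Cmod kap * A * B.
    have := bnd_ge0 _ _ bA; have := bnd_ge0 _ _ bB; have := Cmod_ge_0 kap => x y z.
    apply Rmult_le_pos => //; apply Rmult_le_pos => //; lra.
  pose Q (p : nat * nat) := window (snd p) * (nu (snd p) * nu (snd p)) *
     (if le_dec (snd p) (fst p) then Cmod (d (snd p) (fst p - snd p)%nat) else 0) * (nu (fst p) * Cmod (al (fst p))).
  have Q1 y n : 0 <= window n * (nu n * nu n) * (if le_dec n y then Cmod (d n (y - n)%nat) else 0).
    apply Rmult_le_pos.
      apply Rmult_le_pos; [apply window_ge0 | by apply Rmult_le_pos].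
    case: le_dec => _; [apply Cmod_ge_0 | lra].
  have bQ : bnd Q (2 * Cmod kap * A * B * A).
    apply (bnd_prod _ (fun y => 2 * Cmod kap * A * B * (nu y * Cmod (al y)))).
    - move=> [y n]; by apply Rmult_le_pos.
    - move=> y; rewrite Rmult_comm.
      apply: bnd_le (bnd_scal _ _ _ (pa al y) (h2 y)) => n; rewrite /Q /d /=; lra.
    - by apply bnd_scal.
  have w0 n : 0 <= window n * nu n ^ 3.
    apply Rmult_le_pos; [apply window_ge0 | by apply pow_le].
  have bF : bnd (fun p => window (fst p) * nu (fst p) ^ 3 * Cmod (F p)) (2 * Cmod kap * A * B * A).
    have := bnd_inj (fun p : nat * nat => ((fst p + snd p)%nat, fst p)) _ _ _ bQ.
    move=> h; apply: bnd_le (h _) => [[n k]|[n k] [n' k'] /= [e1 e2]]; last by f_equal; lia.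
    rewrite /Q /F /=.
    case: (window_cases n) => [[-> h3]| ->]; last by rewrite !Rmult_0_l; lra.
    case: le_dec => // _; case: le_dec => h4; last lia.
    have -> : (n + k - n = k)%nat by lia.
    rewrite Cmod_mult.
    have := hom al n (n + k)%nat ltac:(lia) => h5.
    have h6 : 0 <= nu n * nu n * Cmod (d n k).
      apply Rmult_le_pos; [by apply Rmult_le_pos | apply Cmod_ge_0].
    have := Rmult_le_compat_l _ _ _ h6 h5; lra.
  have := fubini_bnd F g (fun n => window n * nu n ^ 3) _ w0 bF rows.
  apply bnd_le => n; rewrite /g.
  case: (window_cases n) => [[-> h3]| ->]; last by rewrite !Rmult_0_l; lra.
  case: le_dec => // _; rewrite Cmod_opp; lra.
Qed.

End Window.

Theorem tail_estimate A B : kap <> RtoC 0 ->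
  bnd (fun k => nu k * Cmod (al k)) A -> bnd (fun k => nu k * Cmod (be k)) B ->
  exists N T, (n0 <= N)%nat /\
    bnd (fun n => if le_dec N n then nu n ^ 3 * Cmod (Cminus (phi n) (al n)) else 0) T.
Proof.
  move=> k0 bA bB.
  have kp : 0 < Cmod kap by apply Cmod_gt_0.
  have l1 (a : nat -> C) : forall k, Cmod (a k) <= nu k * Cmod (a k).
    move=> k; have := nu1 k; have := Cmod_ge_0 (a k); nra.
  (* Beyond N the tails of [al] and [be] are at most 1 / 2 and 1, so their product is the 1 / 2
     required by [diag_bound]. *)
  have [Na hNa] := small_tail al A (/ 2) (bnd_le _ _ _ (l1 al) bA) ltac:(lra).
  have [Nb hNb] := small_tail be B 1 (bnd_le _ _ _ (l1 be) bB) ltac:(lra).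
  pose N := (n0 + Na + Nb)%nat.
  exists N, (/ Cmod kap * (2 * Cmod kap * A * B * A)); split; first by rewrite /N; lia.
  move=> l nd.
  (* The window is chosen after the list [l] to be bounded; the bound itself does not see it. *)
  have [N1 inc] := nat_list_bounded l.
  have h := window_estimate N N1 ltac:(rewrite /N; lia) _ _ A B (hNa N ltac:(rewrite /N; lia))
    (hNb N ltac:(rewrite /N; lia)) ltac:(lra) bA bB.
  have ik : 0 < / Cmod kap by apply Rinv_0_lt_compat.
  apply: Rle_trans (bnd_scal _ _ _ (Rlt_le _ _ ik) h l nd).
  apply rsum_le => n hn.
  have := inc n hn; rewrite in_seq => hn1.
  rewrite /window; case: le_dec => h1; last by rewrite !Rmult_0_l Rmult_0_r; lra.
  case: lt_dec => h2; last lia.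
  rewrite Cmod_mult; right; field; lra.
Qed.

End TailEstimate.

(** * Orthogonal polynomials and the Wiener-Hopf factorization *)

Lemma fourier_ext (g1 g2 : R -> C) k : (forall t, g1 t = g2 t) -> fourier g1 k = fourier g2 k.
Proof.
  move=> h; rewrite /fourier; f_equal.
  apply (RInt_ext (V := C_R_CompleteNormedModule)) => t _; by rewrite h.
Qed.

Lemma usum_0 {I : Type} : is_usum (fun _ : I => RtoC 0) (RtoC 0).
Proof.
  move=> e e0; exists nil => l _ _.
  rewrite lsum_eq0 //; have -> : Cminus 0 0 = RtoC 0 by ring.
  by rewrite Cmod_0.
Qed.

Section Coefficients.
Context (om : Z -> R) (Hom : beurling_weight om).

Lemma coef_rep (c : Z -> C) (f : C -> C) M : bnd (fun j => om j * Cmod (c j)) M ->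
  (forall u, dom om u -> is_usum (fun j => Cmult (c j) (ez j u)) (f u)) ->
  forall j, coef f j = c j.
Proof.
  move=> b u j; apply (fourier_usum c M) => [|t]; first exact: Wiener_l1 b.
  apply (u (0, t)); by apply dom_circle.
Qed.

Lemma coef_plus Sp Sp' f g M N j : Wiener om Sp f M -> Wiener om Sp' g N ->
  coef (fun u => Cplus (f u) (g u)) j = Cplus (coef f j) (coef g j).
Proof.
  move=> /(Wiener_support om Sp all_freq _ _ (fun _ _ => I)) hf.
  move=> /(Wiener_support om Sp' all_freq _ _ (fun _ _ => I)) hg.
  have [_ [b1 u1]] := Wiener_coef om Hom _ _ _ hf.
  have [_ [b2 u2]] := Wiener_coef om Hom _ _ _ hg.
  apply (coef_rep (fun j => Cplus (coef f j) (coef g j)) _ (M + N)).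
    apply: bnd_le (bnd_plus _ _ _ _ b1 b2) => i.
    have := om_ge1 om Hom i; have := Cmod_triangle (coef f i) (coef g i); nra.
  move=> u du; apply: usum_ext (usum_plus _ _ _ _ (u1 u du) (u2 u du)) => i; ring.
Qed.

Lemma coef_scal Sp f M k j : Wiener om Sp f M ->
  coef (fun u => Cmult k (f u)) j = Cmult k (coef f j).
Proof.
  move=> hf; have [_ [b1 u1]] := Wiener_coef om Hom _ _ _ hf.
  apply (coef_rep (fun j => Cmult k (coef f j)) _ (Cmod k * M)).
    apply: bnd_le (bnd_scal _ _ _ (Cmod_ge_0 k) b1) => i; rewrite Cmod_mult; lra.
  move=> u du; apply: usum_ext (usum_scal k _ _ (u1 u du)) => i; ring.
Qed.

Lemma coef_const k j : coef (fun _ => k) j = if Z.eq_dec j 0 then k else RtoC 0.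
Proof.
  have [M hM] : exists M, bnd (fun j => om j * Cmod (if Z.eq_dec j 0 then k else RtoC 0)) M.
    eexists; apply (bnd_finite _ (0%Z :: nil)) => i.
      apply Rmult_le_pos; [have := om_ge1 om Hom i; lra | apply Cmod_ge_0].
    move=> h; case: Z.eq_dec => e; [by case: h; left | rewrite Cmod_0; ring].
  apply (coef_rep _ _ M hM) => u du.
  have := usum_single (fun j => Cmult (if Z.eq_dec j 0 then k else RtoC 0) (ez j u)) 0%Z.
  case: (Z.eq_dec 0 0) => // _; rewrite ez_0 Cmult_1_r; apply => i hi.
  case: Z.eq_dec => // _; ring.
Qed.

Lemma coef_shift f M m j : Wiener om all_freq f M ->
  coef (fun u => Cmult (ez m u) (f u)) j = coef f (j - m).
Proof.
  move=> hf; have [_ [b1 u1]] := Wiener_coef om Hom _ _ _ hf.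
  have b2 := Wiener_l1 om Hom _ _ b1.
  apply (fourier_usum (fun j => coef f (j - m)) M).
    by apply (bnd_inj (fun j => (j - m)%Z) (fun j => Cmod (coef f j))) => // x y; lia.
  move=> t.
  have u := usum_scal (ez m (0, t)) _ _ (u1 (0, t) (dom_circle om Hom t)).
  have := usum_reindex (fun j => (j - m)%Z) _ _ ltac:(move=> x y; cbv beta; lia) _ u.
  move=> h; apply: usum_ext (h _) => [i|i hi]; last by case: (hi (i + m)%Z); lia.
  have E : ez i (0, t) = Cmult (ez m (0, t)) (ez (i - m) (0, t)) by rewrite -ez_add; f_equal; lia.
  rewrite -/(ez i (0, t)) E; ring.
Qed.

Lemma coef_mult_eq0 f g M N j : Wiener om all_freq f M -> Wiener om all_freq g N ->
  (forall k, coef f k = RtoC 0 \/ coef g (j - k) = RtoC 0) ->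
  coef (fun u => Cmult (f u) (g u)) j = RtoC 0.
Proof.
  move=> hf hg z.
  apply: (usum_unique _ _ _ (coef_mult om Hom _ submonoid_all f g M N j hf hg)).
  apply: usum_ext (usum_0) => k; case: (z k) => ->; ring.
Qed.

Lemma coef_mult_single f g M N j k0 : Wiener om all_freq f M -> Wiener om all_freq g N ->
  (forall k, k <> k0 -> coef f k = RtoC 0 \/ coef g (j - k) = RtoC 0) ->
  coef (fun u => Cmult (f u) (g u)) j = Cmult (coef f k0) (coef g (j - k0)).
Proof.
  move=> hf hg z.
  apply: (usum_unique _ _ _ (coef_mult om Hom _ submonoid_all f g M N j hf hg)).
  apply (usum_single (fun k => Cmult (coef f k) (coef g (j - k)))) => k hk.
  case: (z k hk) => ->; ring.
Qed.

(** With frequencies on one side of 0, only 0 + 0 contributes to frequency 0 of a product. So taking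
    the zeroth coefficient is multiplicative and passes through the exponential series, like
    evaluation at z = 0 or at infinity. *)
Lemma coef0_cexp Sp f M : submonoid Sp -> (forall j, Sp j -> Sp (- j)%Z -> j = 0%Z) ->
  Wiener om Sp f M -> coef (fun u => cexp (f u)) 0 = cexp (coef f 0).
Proof.
  move=> HS sg hf.
  have all g K : Wiener om Sp g K -> Wiener om all_freq g K.
    exact: (Wiener_support om Sp all_freq _ _ (fun _ _ => I)).
  have hk k := Wiener_pow om Hom Sp HS f M k hf.
  have ck k : coef (fun u => pow_n (f u) k) 0 = pow_n (coef f 0) k.
    elim: k => [|k IH].
      by rewrite -[LHS]/(coef (fun _ => RtoC 1) 0) coef_const.
    rewrite pow_n_S -IH.
    apply (coef_mult_single f (fun u => pow_n (f u) k) _ _ 0 0 (all _ _ hf) (all _ _ (hk k))) => i hi.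
    have [s1 _] := Wiener_coef om Hom _ _ _ hf.
    have [s2 _] := Wiener_coef om Hom _ _ _ (hk k).
    case: (classic (Sp i)) => h1; last by left; apply s1.
    right; apply s2 => h2; apply hi, sg => //.
  have M0 := Wiener_ge0 om Sp f M hf.
  have fp k : 0 < / INR (fact k) by apply Rinv_0_lt_compat, INR_fact_lt_0.
  have hs k : Wiener om Sp (fun u => Cmult (RtoC (/ INR (fact k))) (pow_n (f u) k))
     (om 0%Z * (M ^ k / INR (fact k))).
    have := Wiener_scal om Sp (RtoC (/ INR (fact k))) _ _ (hk k).
    rewrite Cmod_R Rabs_right; last by apply Rle_ge, Rlt_le.
    apply Wiener_le; rewrite /Rdiv; right; ring.
  have bs : bnd (fun k => om 0%Z * (M ^ k / INR (fact k))) (om 0%Z * exp M).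
    apply bnd_scal; [have := om_ge1 om Hom 0; lra | by apply bnd_exp].
  have [_ u] := Wiener_series om Hom Sp _ _ _ (fun u => cexp (f u)) hs bs (fun u _ => exp_series (f u)).
  apply: (usum_unique _ _ _ (u 0%Z)).
  apply: usum_ext (exp_series (coef f 0)) => k.
  by rewrite (coef_scal Sp _ _ _ 0 (hk k)) ck.
Qed.

Lemma Wiener_peval (p : nat -> C) n : exists M,
  Wiener om all_freq (fun u => peval p n (cexp u)) M /\
  forall j, coef (fun u => peval p n (cexp u)) j =
    if Z_le_dec 0 j then if Z_le_dec j (Z.of_nat n) then p (Z.to_nat j) else RtoC 0 else RtoC 0.
Proof.
  pose l := map Z.of_nat (seq 0 (S n)).
  have inl j : In j l <-> (0 <= j <= Z.of_nat n)%Z.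
    rewrite /l in_map_iff; split.
      move=> [k [<-]]; rewrite in_seq; lia.
    move=> h; exists (Z.to_nat j); rewrite in_seq; lia.
  pose c j := if in_dec classic_eq_dec j l then p (Z.to_nat j) else RtoC 0.
  have ndl : NoDup l by apply FinFun.Injective_map_NoDup; [move=> x y; lia | apply seq_NoDup].
  have bc : bnd (fun j => om j * Cmod (c j)) (rsum (fun j => om j * Cmod (c j)) l).
    apply bnd_finite => i.
      apply Rmult_le_pos; [have := om_ge1 om Hom i; lra | apply Cmod_ge_0].
    rewrite /c; case: in_dec => // _ _; rewrite Cmod_0; ring.
  have uc u : is_usum (fun j => Cmult (c j) (ez j u)) (peval p n (cexp u)).
    have := usum_finite (fun j => Cmult (p (Z.to_nat j)) (ez j u)) l ndl.
    have -> : lsum (fun j => Cmult (p (Z.to_nat j)) (ez j u)) l = peval p n (cexp u).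
      transitivity (lsum (fun k => Cmult (p k) (pow_n (cexp u) k)) (seq 0 (S n))).
        rewrite /l; elim: (seq 0 (S n)) => //= k s ->; by rewrite Nat2Z.id ez_nat.
      symmetry; exact: sum_n_lsum.
    apply usum_ext => j; rewrite /c; case: in_dec => _; ring.
  exists (rsum (fun j => om j * Cmod (c j)) l); split.
    exists c; split; [by move=> j h; case: (h I) | by split].
  move=> j; rewrite (coef_rep c _ _ bc (fun u _ => uc u)) /c.
  case: in_dec => h.
    have h' := proj1 (inl j) h; case: Z_le_dec => h1; last lia.
    case: Z_le_dec => h2 //; lia.
  case: Z_le_dec => h1 //; case: Z_le_dec => h2 //; case: h; apply inl; lia.
Qed.

End Coefficients.

Lemma Wiener_cexp_opp om (Hom : beurling_weight om) Sp (HS : submonoid Sp) f M :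
  Wiener om Sp f M -> exists K, Wiener om Sp (fun u => cexp (Copp (f u))) K.
Proof.
  move=> hf; eexists; apply (Wiener_exp om Hom Sp HS).
  apply: (Wiener_ext om Sp (fun u => Cmult (Copp 1) (f u))); last exact: (Wiener_scal om Sp (Copp 1) _ _ hf).
  move=> u _; ring.
Qed.

Lemma submonoid_nonneg : submonoid (fun j => 0 <= j)%Z.
Proof. split; lia. Qed.

Lemma submonoid_nonpos : submonoid (fun j => j <= 0)%Z.
Proof. split; lia. Qed.

Section WienerHopf.
Context (nu : Z -> R) (Hnu : beurling_weight nu) (Gi Ge : C -> C) (Mi Me : R).
Hypothesis hGi : Wiener nu (fun j => 0 <= j)%Z Gi Mi.
Hypothesis hGe : Wiener nu (fun j => j <= 0)%Z Ge Me.
Hypothesis h00 : coef Gi 0 = coef Ge 0.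

Let wp u := cexp (Gi u).
Let wpi u := cexp (Copp (Gi u)).
Let wm u := cexp (Ge u).
Let wmi u := cexp (Copp (Ge u)).

Lemma supp_all Sp f M : Wiener nu Sp f M ->
  Wiener nu all_freq f M /\ forall j, ~ Sp j -> coef f j = RtoC 0.
Proof.
  move=> hf; split; last exact: (proj1 (Wiener_coef nu Hnu _ _ _ hf)).
  exact: (Wiener_support nu Sp all_freq _ _ (fun _ _ => I) hf).
Qed.

Lemma wp_neq0 : coef wp 0 <> RtoC 0.
Proof.
  rewrite /wp (coef0_cexp nu Hnu _ _ _ submonoid_nonneg _ hGi); last by move=> j; lia.
  apply cexp_neq0.
Qed.

(** [kap] enters [E1] through w_- and [E3] through w_+. Their equality comes from the even split of
    the mean of log w. *)
Lemma wm_wp_0 : coef wm 0 = coef wp 0.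
Proof.
  rewrite /wm /wp (coef0_cexp nu Hnu _ _ _ submonoid_nonneg _ hGi); last by move=> j; lia.
  rewrite (coef0_cexp nu Hnu _ _ _ submonoid_nonpos _ hGe); last by move=> j; lia.
  by rewrite h00.
Qed.

Let a u := Cmult (wp u) (wmi u).
Let b u := Cmult (wm u) (wpi u).

Lemma wp_wpi u : Cmult (wp u) (wpi u) = RtoC 1.
Proof. by rewrite -cexp_add Cplus_opp_r cexp_0. Qed.

Lemma wm_wmi u : Cmult (wm u) (wmi u) = RtoC 1.
Proof. by rewrite -cexp_add Cplus_opp_r cexp_0. Qed.

Lemma Wiener_a : exists K, Wiener nu all_freq a K.
Proof.
  have [K hK] := Wiener_cexp_opp nu Hnu _ submonoid_nonpos _ _ hGe.
  eexists; apply (Wiener_mult nu Hnu _ submonoid_all).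
    exact: (proj1 (supp_all _ _ _ (Wiener_exp nu Hnu _ submonoid_nonneg _ _ hGi))).
  exact: (proj1 (supp_all _ _ _ hK)).
Qed.

Lemma Wiener_b : exists K, Wiener nu all_freq b K.
Proof.
  have [K hK] := Wiener_cexp_opp nu Hnu _ submonoid_nonneg _ _ hGi.
  eexists; apply (Wiener_mult nu Hnu _ submonoid_all).
    exact: (proj1 (supp_all _ _ _ (Wiener_exp nu Hnu _ submonoid_nonpos _ _ hGe))).
  exact: (proj1 (supp_all _ _ _ hK)).
Qed.

Lemma coef_fun_ext f g j : (forall u, dom nu u -> f u = g u) -> coef f j = coef g j.
Proof. move=> h; apply fourier_ext => t; apply h; by apply dom_circle. Qed.

Lemma Wiener_cut f M (P : Z -> Prop) : Wiener nu all_freq f M ->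
  exists F, Wiener nu all_freq F M /\ (forall j, P j -> coef F j = coef f j) /\
    (forall j, ~ P j -> coef F j = RtoC 0).
Proof.
  move=> hf.
  pose phi j := if excluded_middle_informative (P j) then 1 else 0.
  have [F [hF cF]] := Wiener_mask nu Hnu f M phi all_freq
    ltac:(move=> j; rewrite /phi; case: excluded_middle_informative => _; lra)
    ltac:(move=> j h; case: (h I)) hf.
  exists F; split => //; split => j hj; rewrite cF /phi; case: excluded_middle_informative => // _; ring.
Qed.

(* If [F] and [G] are the parts of [P w] of frequency [>= n] and [< 0], then [f] and [H] are the
   Fourier coefficients of [z^(-n) F / w_+] and [G / w_-]; [H m] is the one of index [-(m + 1)]. *)
Lemma OP_equations (p : nat -> C) n : p n = RtoC 1 ->
  (forall k, (0 <= k < Z.of_nat n)%Z ->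
     coef (fun u => Cmult (peval p n (cexp u)) (Cmult (wp u) (wm u))) k = RtoC 0) ->
  exists f H : nat -> C, summable f /\
   (forall k, is_usum (fun m => Cmult (H m) (coef b (Z.of_nat (n + k + S m))))
     (Cminus (if Nat.eq_dec k 0 then coef wp 0 else RtoC 0) (f k))) /\
   (forall m, is_usum (fun i => Cmult (f i) (coef a (- Z.of_nat (n + i + S m)))) (Copp (H m))) /\
   is_usum (fun i => Cmult (f i) (coef a (- Z.of_nat (n + i)))) (Cmult (p 0%nat) (coef wp 0)).
Proof.
  move=> pn orth.
  pose P u := peval p n (cexp u).
  have [KP [hP cP]] := Wiener_peval nu Hnu p n; rewrite -/P in hP cP.
  have [wpA wpS] := supp_all _ _ _ (Wiener_exp nu Hnu _ submonoid_nonneg _ _ hGi); rewrite -/wp in wpA wpS.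
  have [wmA wmS] := supp_all _ _ _ (Wiener_exp nu Hnu _ submonoid_nonpos _ _ hGe); rewrite -/wm in wmA wmS.
  have [Kpi hpi] := Wiener_cexp_opp nu Hnu _ submonoid_nonneg _ _ hGi.
  have [wpiA wpiS] := supp_all _ _ _ hpi; rewrite -/wpi in wpiA wpiS.
  have [Kmi hmi] := Wiener_cexp_opp nu Hnu _ submonoid_nonpos _ _ hGe.
  have [wmiA wmiS] := supp_all _ _ _ hmi; rewrite -/wmi in wmiA wmiS.
  have [Ka ha] := Wiener_a; have [Kb hb] := Wiener_b.
  have mul f g M N := Wiener_mult nu Hnu _ submonoid_all f g M N.
  have wA := mul _ _ _ _ wpA wmA.
  have UA := mul _ _ _ _ hP wA.
  set U := (fun u => Cmult (P u) (Cmult (wp u) (wm u))) in UA.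
  have [F [FA [F1 F0]]] := Wiener_cut _ _ (fun j => Z.of_nat n <= j)%Z UA.
  have [G [GA [G1 G0]]] := Wiener_cut _ _ (fun j => j < 0)%Z UA.
  (* Orthogonality empties the band 0 <= j < n, so P w has no part other than F and G. *)
  have UFG u : dom nu u -> U u = Cplus (F u) (G u).
    move=> du.
    have [_ [_ uU]] := Wiener_coef nu Hnu _ _ _ UA.
    have [_ [_ uF]] := Wiener_coef nu Hnu _ _ _ FA.
    have [_ [_ uG]] := Wiener_coef nu Hnu _ _ _ GA.
    apply: (usum_unique _ _ _ (uU u du)).
    apply: usum_ext (usum_plus _ _ _ _ (uF u du) (uG u du)) => j.
    case: (Z_lt_le_dec j 0) => h1.
      rewrite F0 ?G1 //; [ring | lia].
    case: (Z_lt_le_dec j (Z.of_nat n)) => h2.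
      rewrite F0 ?G0 ?(orth j) //; [ring | lia | lia].
    rewrite F1 ?G0 //; [ring | lia].
  have shift m := Wiener_monom nu Hnu all_freq m I.
  pose ff u := Cmult (wpi u) (Cmult (ez (- Z.of_nat n) u) (F u)).
  pose hh u := Cmult (wmi u) (G u).
  have FnA := mul _ _ _ _ (shift (- Z.of_nat n)%Z) FA.
  have ffA := mul _ _ _ _ wpiA FnA; rewrite -/ff in ffA.
  have hhA := mul _ _ _ _ wmiA GA; rewrite -/hh in hhA.
  have ffS j : (j < 0)%Z -> coef ff j = RtoC 0.
    move=> hj; apply (coef_mult_eq0 nu Hnu _ _ _ _ j wpiA FnA) => k.
    case: (Z_lt_le_dec k 0) => h1; [left; apply wpiS; lia | right].
    rewrite (coef_shift nu Hnu _ _ _ _ FA); apply F0; lia.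
  have hhS j : (0 <= j)%Z -> coef hh j = RtoC 0.
    move=> hj; apply (coef_mult_eq0 nu Hnu _ _ _ _ j wmiA GA) => k.
    case: (Z_lt_le_dec 0 k) => h1; [left; apply wmiS; lia | right; apply G0; lia].
  have hbA := mul _ _ _ _ hhA hb.
  have faA := mul _ _ _ _ ffA ha.
  have I1 k : (0 <= k)%Z -> coef (fun u => Cmult (hh u) (b u)) (k + Z.of_nat n) =
     Cminus (if Z.eq_dec k 0 then coef wp 0 else RtoC 0) (coef ff k).
    move=> hk.
    have e u : dom nu u -> Cplus (ff u) (Cmult (ez (- Z.of_nat n) u) (Cmult (hh u) (b u))) =
       Cmult (ez (- Z.of_nat n) u) (Cmult (P u) (wm u)).
      move=> du; have := UFG u du; have := wp_wpi u; have := wm_wmi u.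
      rewrite /ff /hh /b /U; set x := ez _ u => e1 e2 e3.
      transitivity (Cmult x (Cmult (wpi u) (Cplus (F u) (Cmult (Cmult (wm u) (wmi u)) (G u))))); first ring.
      rewrite e1 Cmult_1_l -e3.
      transitivity (Cmult x (Cmult (Cmult (wp u) (wpi u)) (Cmult (P u) (wm u)))); first ring.
      rewrite e2; ring.
    have PmA := mul _ _ _ _ hP wmA.
    have c1 := coef_fun_ext _ _ k e.
    rewrite (coef_plus nu Hnu _ _ _ _ _ _ k ffA (mul _ _ _ _ (shift (- Z.of_nat n)%Z) hbA)) in c1.
    rewrite (coef_shift nu Hnu _ _ _ _ hbA) (coef_shift nu Hnu _ _ _ _ PmA) in c1.
    (* P has frequencies at most n and w_- at most 0, so from n upwards only the leading coefficient
       1 of P contributes. *)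
    have c2 : coef (fun u => Cmult (P u) (wm u)) (k - - Z.of_nat n) =
       (if Z.eq_dec k 0 then coef wp 0 else RtoC 0).
      rewrite (coef_mult_single nu Hnu _ _ _ _ (k - - Z.of_nat n) (Z.of_nat n) hP wmA).
        rewrite cP; case: Z_le_dec => h1; last lia.
        case: Z_le_dec => h2; last lia.
        rewrite Nat2Z.id pn Cmult_1_l.
        case: Z.eq_dec => h3.
          rewrite h3 -wm_wp_0; f_equal; lia.
        apply wmS; lia.
      move=> i hi; case: (Z_lt_le_dec i (Z.of_nat n)) => h1; [right; apply wmS; lia | left].
      rewrite cP; case: Z_le_dec => h2 //; case: Z_le_dec => h3 //; lia.
    rewrite c2 in c1; rewrite -c1.
    have -> : (k - - Z.of_nat n = k + Z.of_nat n)%Z by lia.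
    ring.
  have I2 j : (j <= 0)%Z -> coef (fun u => Cmult (ff u) (a u)) (j - Z.of_nat n) =
     Cminus (if Z.eq_dec j 0 then Cmult (p 0%nat) (coef wp 0) else RtoC 0) (coef hh j).
    move=> hj.
    have e u : dom nu u -> Cplus (Cmult (ez (Z.of_nat n) u) (Cmult (ff u) (a u))) (hh u) = Cmult (P u) (wp u).
      move=> du; have := UFG u du; have := wp_wpi u; have := wm_wmi u.
      have := ez_opp_mul (Z.of_nat n) u.
      rewrite /ff /hh /a /U; set x := ez _ u; set y := ez _ u => e0 e1 e2 e3.
      transitivity (Cmult (wmi u) (Cplus (Cmult (Cmult (Cmult x y) (Cmult (wp u) (wpi u))) (F u)) (G u))); first ring.
      rewrite e0 e2 !Cmult_1_l -e3.
      transitivity (Cmult (Cmult (wm u) (wmi u)) (Cmult (P u) (wp u))); first ring.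
      rewrite e1; ring.
    have c1 := coef_fun_ext _ _ j e.
    rewrite (coef_plus nu Hnu _ _ _ _ _ _ j (mul _ _ _ _ (shift (Z.of_nat n)) faA) hhA) in c1.
    rewrite (coef_shift nu Hnu _ _ _ _ faA) in c1.
    (* Both factors have nonnegative frequencies, so at j <= 0 only the constant terms can meet. *)
    have c2 : coef (fun u => Cmult (P u) (wp u)) j =
       (if Z.eq_dec j 0 then Cmult (p 0%nat) (coef wp 0) else RtoC 0).
      rewrite (coef_mult_single nu Hnu _ _ _ _ j 0 hP wpA).
        rewrite cP; case: Z_le_dec => h1; last lia.
        case: Z_le_dec => h2; last lia.
        case: Z.eq_dec => h3; first by rewrite h3.
        rewrite wpS; [ring | lia].
      move=> i hi; case: (Z_lt_le_dec i 0) => h1; [left | right; apply wpS; lia].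
      rewrite cP; case: Z_le_dec => h2 //; lia.
    rewrite c2 in c1; rewrite -c1; ring.
  have [_ [bff _]] := Wiener_coef nu Hnu _ _ _ ffA.
  exists (fun i => coef ff (Z.of_nat i)), (fun m => coef hh (- Z.of_nat (S m))); split; [|split; [|split]].
  - eexists; apply (bnd_inj Z.of_nat (fun j => Cmod (coef ff j))); first by move=> x y; lia.
    exact: (Wiener_l1 nu Hnu _ _ bff).
  - move=> k.
    have u := coef_mult nu Hnu _ submonoid_all _ _ _ _ (Z.of_nat k + Z.of_nat n) hhA hb.
    rewrite I1 in u; last lia.
    have := usum_reindex (fun m => (- Z.of_nat (S m))%Z) _ _ ltac:(move=> x y; cbv beta; lia) _ u.
    have -> : (if Z.eq_dec (Z.of_nat k) 0 then coef wp 0 else RtoC 0) =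
              (if Nat.eq_dec k 0 then coef wp 0 else RtoC 0).
      case: Z.eq_dec => e1; case: Nat.eq_dec => e2 //; lia.
    move=> h; apply: usum_ext (h _) => [m|i hi]; first by do 2 f_equal; lia.
    rewrite hhS; [ring | apply Z.le_ngt => lt; apply (hi (Z.to_nat (- i - 1))); lia].
  - move=> m.
    have u := coef_mult nu Hnu _ submonoid_all _ _ _ _ (- Z.of_nat (S m) - Z.of_nat n) ffA ha.
    rewrite I2 in u; last lia.
    have e1 : Cminus (if Z.eq_dec (- Z.of_nat (S m)) 0 then Cmult (p 0%nat) (coef wp 0) else RtoC 0)
      (coef hh (- Z.of_nat (S m))) = Copp (coef hh (- Z.of_nat (S m))).
      case: Z.eq_dec => h1; [lia | ring].
    rewrite e1 in u.
    have h := usum_reindex Z.of_nat _ _ ltac:(move=> x y; lia) _ u.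
    apply: usum_ext (h _) => [i|i hi]; first by do 2 f_equal; lia.
    rewrite ffS; [ring | apply Z.nle_gt => le; apply (hi (Z.to_nat i)); lia].
  - have u := coef_mult nu Hnu _ submonoid_all _ _ _ _ (0 - Z.of_nat n) ffA ha.
    rewrite I2 in u; last lia.
    rewrite hhS in u; last lia.
    have e1 : Cminus (if Z.eq_dec 0 0 then Cmult (p 0%nat) (coef wp 0) else RtoC 0) 0 = Cmult (p 0%nat) (coef wp 0).
      case: Z.eq_dec => h1; [ring | lia].
    rewrite e1 in u.
    have h := usum_reindex Z.of_nat _ _ ltac:(move=> x y; lia) _ u.
    apply: usum_ext (h _) => [i|i hi]; first by do 2 f_equal; lia.
    rewrite ffS; [ring | apply Z.nle_gt => le; apply (hi (Z.to_nat i)); lia].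
Qed.

End WienerHopf.

(** * Conjugation on the circle and assembly of the theorem *)

Lemma ex_series_eventually (e : nat -> R) N T : (forall n, 0 <= e n) ->
  bnd (fun n => if le_dec N n then e n else 0) T -> ex_series e.
Proof.
  move=> e0 b.
  pose e1 n := if le_dec N n then 0 else e n.
  have b1 := bnd_finite e1 (seq 0 N)
    ltac:(move=> n; rewrite /e1; case: le_dec => _; [lra | apply e0])
    ltac:(move=> n; rewrite in_seq /e1; case: le_dec => // h h'; lia).
  apply (bnd_ex_series _ (T + rsum e1 (seq 0 N)) e0).
  apply: bnd_le (bnd_plus _ _ _ _ b b1) => n; rewrite /e1; case: le_dec => _; lra.
Qed.

Lemma usum_conj {I : Type} (f : I -> C) s : is_usum f s -> is_usum (fun i => Cconj (f i)) (Cconj s).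
Proof.
  move=> u e e0; have [l0 h] := u e e0; exists l0 => l nd inc.
  have -> : lsum (fun i => Cconj (f i)) l = Cconj (lsum f l).
    elim: l {nd inc} => [|i l IH] /=; first by rewrite /Cconj /= Ropp_0.
    by rewrite IH Cplus_conj.
  rewrite -Cminus_conj Cmod_conj; by apply h.
Qed.

Lemma ez_conj j t : Cconj (ez j (0, t)) = ez (- j) (0, t).
Proof.
  rewrite /ez cexp_conj; f_equal; rewrite opp_IZR /Cconj /Cmult /=; f_equal; ring.
Qed.

Lemma usum_conj_circle nu (Hnu : beurling_weight nu) f M t : Wiener nu all_freq f M ->
  is_usum (fun j => Cmult (Cconj (coef f (- j))) (ez j (0, t))) (Cconj (f (0, t))).
Proof.
  move=> hf; have [_ [_ u]] := Wiener_coef nu Hnu _ _ _ hf.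
  have v := usum_conj _ _ (u (0, t) (dom_circle nu Hnu t)).
  have h := usum_reindex Z.opp _ _ ltac:(move=> x y; lia) _ v.
  apply: usum_ext (h _) => [j|i hi]; last by case: (hi (- i)%Z); lia.
  by rewrite Cmult_conj ez_conj Z.opp_involutive.
Qed.

Lemma fourier_conj nu (Hnu : beurling_weight nu) f M j : Wiener nu all_freq f M ->
  fourier (fun t => Cconj (f (0, t))) j = Cconj (coef f (- j)).
Proof.
  move=> hf; have [_ [b _]] := Wiener_coef nu Hnu _ _ _ hf.
  apply (fourier_usum (fun j => Cconj (coef f (- j))) M).
    have := bnd_inj Z.opp _ M _ (Wiener_l1 nu Hnu _ _ b).
    move=> h; apply: bnd_le (h _) => [i|x y]; [rewrite Cmod_conj; lra | lia].
  move=> t; exact: usum_conj_circle Hnu _ _ _ hf.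
Qed.

Section Assembly.
Context (nu : Z -> R) (Hnu : beurling_weight nu) (g Gi Ge : C -> C) (N : R).
Hypothesis hg : Wiener nu all_freq g N.
Hypothesis hGi : Wiener nu (fun j => 0 <= j)%Z Gi N.
Hypothesis hGe : Wiener nu (fun j => j <= 0)%Z Ge N.
Hypothesis cGi : forall j, coef Gi j = Cmult (RtoC (half_pos j)) (coef g j).
Hypothesis cGe : forall j, coef Ge j = Cmult (RtoC (half_pos (- j))) (coef g j).

Lemma log_split t : g (0, t) = Cplus (Gi (0, t)) (Ge (0, t)).
Proof.
  have d := dom_circle nu Hnu t.
  have [_ [_ u]] := Wiener_coef nu Hnu _ _ _ hg.
  have [_ [_ ui]] := Wiener_coef nu Hnu _ _ _ hGi.
  have [_ [_ ue]] := Wiener_coef nu Hnu _ _ _ hGe.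
  apply: (usum_unique _ _ _ (u _ d)).
  apply: usum_ext (usum_plus _ _ _ _ (ui _ d) (ue _ d)) => j.
  rewrite cGi cGe.
  transitivity (Cmult (Cmult (Cplus (RtoC (half_pos j)) (RtoC (half_pos (- j)))) (coef g j)) (ez j (0, t))); first ring.
  rewrite -RtoC_plus half_pos_sym; ring.
Qed.

Lemma coef_G0 : coef Gi 0 = coef Ge 0.
Proof. by rewrite cGi cGe. Qed.

(* If [w = cexp g] is positive then [Im g] is constant, so that [conj Ge] and [Gi] differ by a constant. *)
Lemma positive_case t0 : (forall t, snd (cexp (g (0, t))) = 0 /\ 0 < fst (cexp (g (0, t)))) ->
  Cconj (cexp (Copp (Ge (0, t0)))) = Cinv (cexp (Gi (0, t0))).
Proof.
  move=> pos.
  have e1 t : cexp (0, snd (g (0, t))) = RtoC 1.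
    have [] := pos t; rewrite /cexp /= exp_0.
    have ep := exp_pos (fst (g (0, t))); set y := snd (g (0, t)) => h1 h2.
    have s0 : sin y = 0 by case: (Rmult_integral _ _ h1) => //; lra.
    have c0 : 0 < cos y by apply (Rmult_lt_reg_l (exp (fst (g (0, t))))) => //; rewrite Rmult_0_r.
    have := sin2_cos2 y; rewrite s0 /Rsqr => h3.
    have -> : cos y = 1 by nra.
    rewrite /RtoC; f_equal; ring.
  have cont t : continuous (fun t : R => (0, snd (g (0, t))) : C) t.
    apply ccont_pair => /=; first by apply continuous_const.
    apply (ccont_snd (fun t => g (0, t))); exact: Wiener_continuous nu Hnu _ _ _ _ hg.
  have cst := cexp_eq1_constant _ cont e1.
  (* i times the constant value of Im g. By [e1] its exponential is 1, so it drops out in the last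
     line. *)
  pose y : C := (0, snd (g (0, 0))).
  have conj_g t : Cconj (g (0, t)) = Cplus (g (0, t)) (Cmult (Copp 2) y).
    have := f_equal snd (cst t 0); rewrite /= => e.
    rewrite (surjective_pairing (g (0, t))) e /Cconj /Cplus /Cmult /y /=; f_equal; ring.
  (* Since conj g and g differ by a constant, the coefficients of index j and - j are conjugate
     except at 0. *)
  have cc j : Cconj (coef g (- j)) = Cplus (coef g j) (if Z.eq_dec j 0 then Cmult (Copp 2) y else RtoC 0).
    rewrite -(fourier_conj nu Hnu _ _ _ hg) -(coef_const nu Hnu).
    rewrite -(coef_plus nu Hnu _ _ _ _ _ _ j hg (Wiener_const nu Hnu _ submonoid_all _)).
    by apply fourier_ext.
  have conjGe : Cconj (Ge (0, t0)) = Cplus (Gi (0, t0)) (Copp y).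
    have hGe' := Wiener_support nu _ all_freq _ _ (fun _ _ => I) hGe.
    apply: (usum_unique _ _ _ (usum_conj_circle nu Hnu _ _ t0 hGe')).
    have [_ [_ ui]] := Wiener_coef nu Hnu _ _ _ hGi.
    have v := usum_single (fun j => Cmult (RtoC (half_pos j))
        (Cmult (if Z.eq_dec j 0 then Cmult (Copp 2) y else RtoC 0) (ez j (0, t0)))) 0%Z.
    have {}v := v ltac:(move=> i hi; case: Z.eq_dec => // _; ring).
    have E : Cmult (RtoC (half_pos 0)) (Cmult (if Z.eq_dec 0 0 then Cmult (Copp 2) y else RtoC 0) (ez 0 (0, t0))) = Copp y.
      case: Z.eq_dec => // _; rewrite half_pos_0 ez_0.
      have e2 : Cmult (RtoC (/ 2)) (RtoC 2) = RtoC 1 by rewrite -RtoC_mult; f_equal; field.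
      transitivity (Copp (Cmult (Cmult (RtoC (/ 2)) (RtoC 2)) y)); [ring | rewrite e2; ring].
    rewrite E in v.
    apply: usum_ext (usum_plus _ _ _ _ (ui _ (dom_circle nu Hnu t0)) v) => j.
    rewrite cGi cGe Z.opp_involutive Cmult_conj cc.
    have -> : Cconj (RtoC (half_pos j)) = RtoC (half_pos j) by rewrite /Cconj /RtoC /= Ropp_0.
    ring.
  rewrite cexp_conj Copp_conj conjGe.
  have -> : Copp (Cplus (Gi (0, t0)) (Copp y)) = Cplus (Copp (Gi (0, t0))) y by ring.
  rewrite cexp_add (e1 0) Cmult_1_r; exact: cexp_opp.
Qed.

(** [OP_equations] supplies, for each n, the data of [tail_estimate]. The symmetry of nu turns the
    bound on all coefficients of a into one for a_(-k) with weight nu_k. *)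
Lemma szego_asymptotics (Phi : nat -> nat -> C) n0 :
  (forall j k, (0 <= j)%Z -> (j < k)%Z -> nu j <= nu k) ->
  (forall n, (n0 <= n)%nat -> Phi n n = RtoC 1 /\ forall k, (0 <= k < Z.of_nat n)%Z ->
    coef (fun u => Cmult (peval (Phi n) n (cexp u)) (Cmult (cexp (Gi u)) (cexp (Ge u)))) k = RtoC 0) ->
  exists N' T, (n0 <= N')%nat /\ bnd (fun n => if le_dec N' n then nu (Z.of_nat n) ^ 3 *
    Cmod (Cminus (Phi n 0%nat) (coef (fun u => Cmult (cexp (Gi u)) (cexp (Copp (Ge u)))) (- Z.of_nat n))) else 0) T.
Proof.
  move=> mono hPhi.
  set a := fun u => Cmult (cexp (Gi u)) (cexp (Copp (Ge u))).
  pose b u := Cmult (cexp (Ge u)) (cexp (Copp (Gi u))).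
  pose kap := coef (fun u => cexp (Gi u)) 0.
  have ch n : exists fH : (nat -> C) * (nat -> C), (n0 <= n)%nat -> summable (fst fH) /\
   (forall k, is_usum (fun m => Cmult (snd fH m) (coef b (Z.of_nat (n + k + S m))))
     (Cminus (if Nat.eq_dec k 0 then kap else RtoC 0) (fst fH k))) /\
   (forall m, is_usum (fun i => Cmult (fst fH i) (coef a (- Z.of_nat (n + i + S m)))) (Copp (snd fH m))) /\
   is_usum (fun i => Cmult (fst fH i) (coef a (- Z.of_nat (n + i)))) (Cmult (Phi n 0%nat) kap).
    (* Below n0 the pair is a mere filler. *)
    case: (le_dec n0 n) => h; last by exists (fun _ => RtoC 0, fun _ => RtoC 0); lia.
    have [p1 p2] := hPhi n h.
    have [f [H hfH]] := OP_equations nu Hnu Gi Ge N N hGi hGe coef_G0 (Phi n) n p1 p2.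
    by exists (f, H).
  pose fH n := proj1_sig (constructive_indefinite_description _ (ch n)).
  have hfH n := proj2_sig (constructive_indefinite_description _ (ch n)).
  have [Ka ha] := Wiener_a nu Hnu Gi Ge N N hGi hGe.
  have [Kb hb] := Wiener_b nu Hnu Gi Ge N N hGi hGe.
  have [_ [ba _]] := Wiener_coef nu Hnu _ _ _ ha.
  have [_ [bb _]] := Wiener_coef nu Hnu _ _ _ hb.
  have bA : bnd (fun k => nu (Z.of_nat k) * Cmod (coef a (- Z.of_nat k))) Ka.
    have h := bnd_inj (fun k => (- Z.of_nat k)%Z) _ Ka _ ba.
    apply: bnd_le (h _) => [k|x y]; last by cbv beta; lia.
    rewrite (proj1 (proj2 Hnu) (Z.of_nat k)); exact: Rle_refl.
  have bB : bnd (fun k => nu (Z.of_nat k) * Cmod (coef b (Z.of_nat k))) Kb.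
    apply (bnd_inj Z.of_nat (fun j => nu j * Cmod (coef b j))) => [x y|]; [lia | exact: bb].
  have k0 : kap <> RtoC 0 by exact: (wp_neq0 nu Hnu Gi N hGi).
  apply (tail_estimate (fun k => coef a (- Z.of_nat k)) (fun k => coef b (Z.of_nat k))
     (fun k => nu (Z.of_nat k)) kap n0 (fun n => fst (fH n)) (fun n => snd (fH n)) (fun n => Phi n 0%nat))
     with (A := Ka) (B := Kb) => //.
  - move=> n; by apply om_ge1.
  - move=> n k h; case: (Nat.eq_dec n k) => [->|e]; [lra | apply mono; lia].
  - move=> n h; exact: (proj1 (hfH n h)).
  - move=> n k h; exact: (proj1 (proj2 (hfH n h)) k).
  - move=> n m h; exact: (proj1 (proj2 (proj2 (hfH n h))) m).
  - move=> n h; exact: (proj2 (proj2 (proj2 (hfH n h)))).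
Qed.

End Assembly.

Theorem theorem4 (nu : Z -> R) (c : Z -> C) (n0 : nat) (Phi : nat -> nat -> C) :
  beurling_weight nu ->
  increasing_on_Zplus nu ->
  in_W nu c ->
  (forall z : C, in_annulus nu z -> fseries c z <> RtoC 0) ->
  wind_number (fun t => fseries c (cis t)) 0%Z ->
  (forall n : nat, (n0 <= n)%nat ->
     is_monic_OP (fseries c) n (Phi n) /\
     (forall q : nat -> C, is_monic_OP (fseries c) n q ->
        forall j : nat, (j <= n)%nat -> q j = Phi n j)) ->
  forall L : R -> C, is_cont_log (fun t => fseries c (cis t)) L ->
  exists Di De : R -> C,
    (forall t : R, filterlim (fun r : R => Szego L (Cmult (RtoC r) (cis t)))
                             (at_left 1) (locally (Di t))) /\
    (forall t : R, filterlim (fun r : R => Szego L (Cmult (RtoC r) (cis t)))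
                             (at_right 1) (locally (De t))) /\
    ex_series (fun n : nat => nu (Z.of_nat n) ^ 3 *
       Cmod (Cminus (fourier (fun t => Cmult (Cconj (Di t)) (Cconj (De t))) (Z.of_nat n))
                    (Scoef n0 Phi n))) /\
    ((forall t : R, snd (fseries c (cis t)) = 0 /\ 0 < fst (fseries c (cis t))) ->
     ex_series (fun n : nat => nu (Z.of_nat n) ^ 3 *
       Cmod (Cminus (fourier (fun t => Cdiv (Cconj (Di t)) (Di t)) (Z.of_nat n))
                    (Scoef n0 Phi n)))).
Proof.
  move=> Hnu mono hc nz _ hOP L hL.
  have [g [N [hg Lg]]] := Wiener_cont_log nu c L Hnu hc nz hL.
  have wg t : fseries c (cis t) = cexp (g (0, t)).
    by rewrite -Lg; symmetry; apply hL.
  have [Gi [hGi cGi]] := Wiener_mask nu Hnu g N half_pos (fun j => 0 <= j)%Z half_pos_bound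
    ltac:(cbv beta; move=> j hj; apply half_pos_neg; lia) hg.
  have [Ge [hGe cGe]] := Wiener_mask nu Hnu g N (fun j => half_pos (- j)) (fun j => j <= 0)%Z
    (fun j => half_pos_bound (- j)) ltac:(cbv beta; move=> j hj; apply half_pos_neg; lia) hg.
  have split_g := log_split nu Hnu g Gi Ge N hg hGi hGe cGi cGe.
  (* Outside the disc the kernel changes sign, so D_e is the exponential of - Ge, that is 1 /
     w_-. *)
  exists (fun t => cexp (Gi (0, t))), (fun t => cexp (Copp (Ge (0, t)))).
  split; first by move=> t; exact: (Szego_limit_inside nu Hnu g N hg L Gi N t Lg hGi cGi).
  split; first by move=> t; exact: (Szego_limit_outside nu Hnu g N hg L Ge N t Lg hGe cGe).
  have orth n : (n0 <= n)%nat -> Phi n n = RtoC 1 /\ forall k, (0 <= k < Z.of_nat n)%Z ->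
    coef (fun u => Cmult (peval (Phi n) n (cexp u)) (Cmult (cexp (Gi u)) (cexp (Ge u)))) k = RtoC 0.
    move=> h; have [[pn on] _] := hOP n h; split => // k hk.
    have := on (Z.to_nat k) ltac:(lia); rewrite Z2Nat.id; last lia.
    move=> e; rewrite /coef /fourier.
    have -> : CRInt (fun t => Cmult (Cpowz (cis t) (- k)) (Cmult (peval (Phi n) n (cexp (0, t)))
         (Cmult (cexp (Gi (0, t))) (cexp (Ge (0, t)))))) (- PI) PI = RtoC 0.
      rewrite -e; apply (RInt_ext (V := C_R_CompleteNormedModule)) => t _.
      rewrite wg split_g cexp_add -cis_cexp.
      have E (x y z : C) : Cmult x (Cmult y z) = Cmult (Cmult y x) z by ring.
      exact: E.
    ring.
  have [N' [T [hN' hT]]] := szego_asymptotics nu Hnu g Gi Ge N hGi hGe cGi cGe Phi n0 mono orth.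
  have [Ka ha] := Wiener_a nu Hnu Gi Ge N N hGi hGe.
  set a := fun u => Cmult (cexp (Gi u)) (cexp (Copp (Ge u))) in ha hT.
  have nu0 n : 0 <= nu (Z.of_nat n) ^ 3 by apply pow_le; have := om_ge1 nu Hnu (Z.of_nat n); lra.
  have main : ex_series (fun n : nat => nu (Z.of_nat n) ^ 3 *
       Cmod (Cminus (fourier (fun t => Cmult (Cconj (cexp (Gi (0, t)))) (Cconj (cexp (Copp (Ge (0, t)))))) (Z.of_nat n))
                    (Scoef n0 Phi n))).
    (* S N' excludes n = 0, where S has coefficient 0 and not the conjugate of Phi_0(0). *)
    apply (ex_series_eventually _ (S N') T).
      move=> n; apply Rmult_le_pos => //; apply Cmod_ge_0.
    apply: bnd_le hT => n.
    have p1 z : 0 <= nu (Z.of_nat n) ^ 3 * Cmod z by apply Rmult_le_pos => //; apply Cmod_ge_0.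
    case: (le_dec (S N') n) => h1; last by case: le_dec => _; [apply p1 | lra].
    case: (le_dec N' n) => h2; last lia.
    have -> : fourier (fun t => Cmult (Cconj (cexp (Gi (0, t)))) (Cconj (cexp (Copp (Ge (0, t)))))) (Z.of_nat n) =
              Cconj (coef a (- Z.of_nat n)).
      rewrite -(fourier_conj nu Hnu _ _ _ ha); apply fourier_ext => t; by rewrite /a Cmult_conj.
    (* The minus signs of S and of alpha cancel; the branch n >= n0 applies because N' >= n0. *)
    have -> : Scoef n0 Phi n = Cconj (Phi n 0%nat).
      case: n h1 h2 {p1} => [|n] h1 h2; first lia.
      rewrite /Scoef /alpha.
      have -> : Nat.leb n0 (S n) = true by apply Nat.leb_le; lia.
      ring.
    rewrite -Cminus_conj Cmod_conj Cmod_minus_sym; lra.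
  split => // pos.
  apply: ex_series_ext main => n; f_equal; f_equal; f_equal.
  apply fourier_ext => t.
  (* For positive w the conjugate of D_e is 1 / D_i, so both claims concern the same function. *)
  rewrite /Cdiv; f_equal; apply: (positive_case nu Hnu g Gi Ge N hg hGi hGe cGi cGe).
  move=> s; by rewrite -wg.
Qed.
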